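(* Let $\mathbf n=(n_1,n_2,\dots)$ be any sequence of positive integers, and let $\Delta_{\mathbf n}$, $\Delta^+_{\mathbf n}$, $\tilde I$, $\tilde T_{\mathbf n}$, $\tilde\Omega_{\mathbf n}$, $\tilde I_1,\tilde I_2,\tilde I_3$, $\tilde\Upsilon^+$ and $\tilde\Upsilon$ be as defined in the context. Then: (a) $\tilde\Upsilon^+:(\Delta^+_{\mathbf n},S)\to(\tilde\Omega_{\mathbf n},\tilde T_{\mathbf n})$ is a strictly order reversing topological conjugacy (a homeomorphism of $\Delta^+_{\mathbf n}$ onto $\tilde\Omega_{\mathbf n}$ with $\tilde\Upsilon^+\circ S=\tilde T_{\mathbf n}\circ\tilde\Upsilon^+$, such that $s<s'$ lexicographically implies $\tilde\Upsilon^+(s)>\tilde\Upsilon^+(s')$ in $\tilde I$). Moreover, for each $s\in\Delta^+_{\mathbf n}$ the itinerary of $\tilde\Upsilon^+(s)$ under $\tilde T_{\mathbf n}$ with respect to the partition $\tilde I_1,\tilde I_2,\tilde I_3$ is $s$. (b) $\tilde\Upsilon:(\Delta_{\mathbf n},S)\to(\tilde\Omega_{\mathbf n},\tilde T_{\mathbf n})$ is a topological semiconjugacy whose only noninjectivity is that $\tilde\Upsilon^{-1}(\tilde T_{\mathbf n}^j(0))=\{S^j(t),S^j(\hat t)\}$ for $j\ge 0$. In particular, the three symbol infimax minimal set $\Delta^+_{\mathbf n}$ has a geometric representation as the attractor of a (slightly extended) interval translation map on three intervals.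
   Context: **Substitutions.** The alphabet is $\{1,2,3\}$, $\epsilon$ is the empty word, $\mathbb N^+=\{1,2,3,\dots\}$, $1^m$ is the letter $1$ repeated $m$ times. For $n\in\mathbb N^+$, $\Lambda_n$ is the substitution $1\mapsto 2,\ 2\mapsto 31^{n+1},\ 3\mapsto 31^n$. Fix $\mathbf n=(n_1,n_2,\dots)\in(\mathbb N^+)^{\mathbb N^+}$; $\Lambda^{(0)}=\mathrm{id}$, $\Lambda^{(k)}=\Lambda_{n_1}\circ\dots\circ\Lambda_{n_k}$. Bi-infinite sequences are written $\dots s_{-2}s_{-1}.s_0s_1\dots$; words may also carry a point; substitutions act letterwise, respecting the point. $S$ is the left shift (it moves the point one place to the right), used on one-sided and two-sided sequences, and on pointed words or pointed one-sided sequences as long as the point does not move beyond an end. An $\epsilon$ at an end indicates that the object stops there. $\pi(\dots s_{-1}.s_0s_1\dots)=s_0s_1\dots$. Sequence spaces carry the product topology. **Minimal sets.** Let $\alpha=\lim_k\Lambda^{(k)}(3)$ (right infinite), $\beta=\lim_k\Lambda^{(2k)}(1)$ and $\hat\beta=\lim_k\Lambda^{(2k)}(2)$ (left infinite; limits read from the right end), $t=\beta.\alpha$, $\hat t=\hat\beta.\alpha$. $\Delta_{\mathbf n}$ is the closure of $\{S^j(t):j\in\mathbb Z\}$ in $\{1,2,3\}^{\mathbb Z}$; $\Delta^+_{\mathbf n}$ is the closure of $\{S^j(\alpha):j\ge0\}$ in the space of right infinite sequences, and equals $\pi(\Delta_{\mathbf n})$. $\Delta^+_{\mathbf n}$ has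 the lexicographic order with $1<2<3$. **Path space.** $\mathcal P$ is the set of sequences $\Gamma=(u_i,a_i,v_i)_{i\ge0}$ with $a_i\in\{1,2,3\}$, $u_i,v_i$ possibly empty words, and $\Lambda_{n_{i+1}}(a_{i+1})=u_ia_iv_i$ for all $i\ge0$. Write $\Gamma_i=(u_i,a_i,v_i)$. Put $$\mathcal W(\Gamma)=\dots\Lambda^{(2)}(u_2)\Lambda^{(1)}(u_1)u_0.a_0v_0\Lambda^{(1)}(v_1)\Lambda^{(2)}(v_2)\dots$$ Two paths are tail equivalent if they agree from some index on. $\mathcal S_1,\mathcal S_{\hat1},\mathcal S_2$ are the tail equivalence classes of $\Gamma_\beta=(31^{n_1},1,\epsilon),\prod_{i\ge1}\big((\epsilon,2,\epsilon),(31^{n_{2i+1}},1,\epsilon)\big)$, $\Gamma_{\hat\beta}=\prod_{i\ge1}\big((\epsilon,2,\epsilon),(31^{n_{2i}},1,\epsilon)\big)$, $\Gamma_\alpha=\prod_{i\ge1}(\epsilon,3,1^{n_i})$ (products denote concatenation of edge labels), and $\mathcal N=\mathcal P\setminus(\mathcal S_1\cup\mathcal S_{\hat1}\cup\mathcal S_2)$. $\mathcal W(\Gamma)$ is bi-infinite exactly for $\Gamma\in\mathcal N$; for $\Gamma\in\mathcal S_1$, $\mathcal W(\Gamma)=S^j(\beta.\epsilon)$ with a unique $j<0$; for $\Gamma\in\mathcal S_{\hat1}$, $\mathcal W(\Gamma)=S^j(\hat\beta.\epsilon)$ with a unique $j<0$; for $\Gamma\in\mathcal S_2$, $\mathcal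 W(\Gamma)=S^j(\epsilon.\alpha)$ with a unique $j\ge0$. Define $H:\mathcal P\to\Delta^+_{\mathbf n}$ by $H(\Gamma)=\pi(\mathcal W(\Gamma))$ on $\mathcal N$, $H(\Gamma)=\pi(S^j(t))$ on $\mathcal S_1$ and $\mathcal S_2$, $H(\Gamma)=\pi(S^j(\hat t))$ on $\mathcal S_{\hat1}$, with the indicated $j$. $H$ is a bijection (indeed a homeomorphism). **Projection.** $A_n=\begin{pmatrix}0&n+1&n\\1&0&0\\0&1&1\end{pmatrix}$, $A^{(k)}=A_{n_1}\cdots A_{n_k}$, $\mathcal C_{-,-,+}=\{x\in\mathbb R^3:x_1<0,x_2<0,x_3>0\}$. $\vec\ell=(\ell_1,\ell_2,\ell_3)\in\mathcal C_{-,-,+}$ is the unit vector such that $(A^{(k)})^{-T}w/\|(A^{(k)})^{-T}w\|_2\to\vec\ell$ for every $w\in\mathcal C_{-,-,+}$ (it exists; $-T$ is inverse transpose). For a finite word $w$, $\phi(w)=\sum_{a=1}^3\ell_a|w|_a$, with $|w|_a$ the number of letters $a$ in $w$. $\Psi_L:\mathcal P\to\mathbb R$, $\Psi_L(\Gamma)=\phi(u_0)+\sum_{j\ge1}\phi(\Lambda^{(j)}(u_j))$ (a convergent series). $\Upsilon^+=\Psi_L\circ H^{-1}:\Delta^+_{\mathbf n}\to[0,\infty)$, and $\Upsilon_1^+=\Upsilon^+/(\ell_3-\ell_2)$, which takes values in $I=[0,1]$. **ITM.** For $0<\mu_1<\mu_2<1$, $T_{\mu_1,\mu_2}:I\to I$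 is $x\mapsto x+1-\mu_1$ on $[0,\mu_1)$, $x\mapsto x-\mu_1$ on $[\mu_1,\mu_2)$, $x\mapsto x-\mu_2$ on $[\mu_2,1]$. $T_{\mathbf n}=T_{\mu_1,\mu_2}$ with $\mu_1=-\ell_2/(\ell_3-\ell_2)$, $\mu_2=-\ell_1/(\ell_3-\ell_2)$. For these parameters $T^m(\mu_1),T^m(\mu_2),T^m(0)\notin\{\mu_1,\mu_2\}$ for all $m>0$. Let $D=\bigcup_{j=1,2}\bigcup_{i\ge0}T_{\mathbf n}^{-i}(\mu_j)$ and $\tilde I=I\sqcup\{\tilde y:y\in D\}$, where $\tilde y$ is a second copy of $y$; extend the order of $I$ by placing $\tilde y$ immediately after $y$; give $\tilde I$ the order topology. $\tilde T_{\mathbf n}:\tilde I\to\tilde I$ is the natural continuous extension: $\tilde T_{\mathbf n}=T_{\mathbf n}$ on $I\setminus\{\mu_1,\mu_2\}$; $\tilde T_{\mathbf n}(\tilde y)=\widetilde{T_{\mathbf n}(y)}$ for $y\in D\setminus\{\mu_1,\mu_2\}$; $\tilde T_{\mathbf n}(\tilde\mu_1)=\tilde T_{\mathbf n}(\tilde\mu_2)=0$; and (left limits) $\tilde T_{\mathbf n}(\mu_1)=1$, $\tilde T_{\mathbf n}(\mu_2)=\mu_2-\mu_1\in I$. The extended attractor is $\tilde\Omega_{\mathbf n}=\bigcap_{i\ge0}\tilde T_{\mathbf n}^i(\tilde I)$. Put $\tilde I_3=[0,\mu_1]$, $\tilde I_2=[\tilde\mu_1,\mu_2]$, $\tilde I_1=[\tilde\mu_2,1]$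 (order intervals in $\tilde I$). The itinerary of $x$ is $s_0s_1\dots$ with $s_i=a$ iff $\tilde T_{\mathbf n}^i(x)\in\tilde I_a$. **Extended representation map.** Let $w=\mathcal W(\Gamma_{2max})$, $\hat w=\mathcal W(\Gamma_{3max})$, where $\Gamma_{2max}=\prod_{i\ge1}\big((\epsilon,2,\epsilon),(3,1,1^{n_{2i}})\big)$ and $\Gamma_{3max}=(\epsilon,3,1^{n_1+1}),\prod_{i\ge1}\big((\epsilon,2,\epsilon),(3,1,1^{n_{2i+1}})\big)$. For $j>0$ one has $\Upsilon_1^+\pi S^{-j}(\hat t)=\Upsilon_1^+\pi S^{-j+1}(\hat w)=:y_j\in D$ and $\Upsilon_1^+\pi S^{-j}(t)=\Upsilon_1^+\pi S^{-j+1}(w)=:z_j\in D$. Define $\tilde\Upsilon^+:\Delta^+_{\mathbf n}\to\tilde I$ by $\tilde\Upsilon^+(\pi S^{-j}(\hat t))=\tilde y_j$, $\tilde\Upsilon^+(\pi S^{-j+1}(\hat w))=y_j$, $\tilde\Upsilon^+(\pi S^{-j}(t))=\tilde z_j$, $\tilde\Upsilon^+(\pi S^{-j+1}(w))=z_j$ for $j>0$, and $\tilde\Upsilon^+=\Upsilon_1^+$ at all other points. Let $\tilde\Upsilon=\tilde\Upsilon^+\circ\pi:\Delta_{\mathbf n}\to\tilde I$. *)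

(* Defs.v *)
From HB Require Import structures.
From mathcomp Require Import all_boot all_order all_algebra.
From mathcomp Require Import all_classical all_reals all_analysis.

Set Implicit Arguments.
Unset Strict Implicit.
Unset Printing Implicit Defensive.

Import Order.TTheory GRing.Theory Num.Theory.
Import numFieldNormedType.Exports.

Local Open Scope classical_set_scope.
Local Open Scope ring_scope.

(* The alphabet {1,2,3} is 'I_3, the letter a being stored as a - 1; the
   order of 'I_3 is then 1 < 2 < 3. *)
Notation letter := 'I_3.
Definition L1 : letter := @Ordinal 3 0 isT.
Definition L2 : letter := @Ordinal 3 1 isT.
Definition L3 : letter := @Ordinal 3 2 isT.

Definition word := seq letter.

(* Sequence spaces, with the product topology. *)
Notation seqN := {ptws nat -> discrete_topology letter}.
Notation seqZ := {ptws int -> discrete_topology letter}.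

(* Pointed words and pointed, possibly one-sided, sequences: the letter
   immediately to the right of the point has index 0, the letter immediately to
   its left has index -1, and None marks the positions beyond an end. *)
Definition pseq := int -> option letter.

(* [shiftZ j] is the power S^j of the left shift. *)
Definition shiftZ (A : Type) (j : int) (x : int -> A) : int -> A :=
  fun i => x (i + j).
Definition shiftN (j : nat) (s : seqN) : seqN := fun i => s (i + j)%N.

Definition projN (x : int -> letter) : seqN := fun i => x (Posz i).

(* [Negz i] is the integer -(i+1), so [joinZ b a] is the pointed sequence
   ... b_1 b_0 . a_0 a_1 ..., where the left half b is read from the point. *)
Definition joinZ (A : Type) (b a : nat -> A) : int -> A :=
  fun i => match i with Posz p => a p | Negz p => b p end.

(* Only applied to sequences without missing letters, where the default L1 is
   irrelevant. *)
Definition fill (I : Type) (x : I -> option letter) : I -> letter :=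
  fun i => odflt L1 (x i).

(* Letterwise limit of a sequence of words, read from the left end. The value
   None at p means that the limit stops before p. *)
Definition lim_word (w : nat -> word) : nat -> option letter :=
  fun p => xget None [set o | \forall k \near \oo, onth (w k) p = o].

Definition lex_lt (s s' : seqN) : Prop :=
  exists k : nat, (forall i, (i < k)%N -> s i = s' i) /\ (s k < s' k)%N.

Definition Lambda1 (m : nat) (a : letter) : word :=
  if a == L1 then [:: L2]
  else if a == L2 then L3 :: nseq m.+1 L1
  else L3 :: nseq m L1.
Definition Lambda (m : nat) (w : word) : word := flatten (map (Lambda1 m) w).

(* The sequence (n_1, n_2, ...) is a function n on nat whose value at 0 is
   never used. *)
Fixpoint LambdaK (n : nat -> nat) (k : nat) (w : word) : word :=
  if k is k'.+1 then LambdaK n k' (Lambda (n k) w) else w.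

Section MinimalSets.
Context (n : nat -> nat).

Definition alpha : nat -> letter :=
  fill (lim_word (fun k => LambdaK n k [:: L3])).
(* Left infinite sequences are read from their right end. *)
Definition beta : nat -> letter :=
  fill (lim_word (fun k => rev (LambdaK n (2 * k) [:: L1]))).
Definition beta_hat : nat -> letter :=
  fill (lim_word (fun k => rev (LambdaK n (2 * k) [:: L2]))).

Definition t_seq : seqZ := joinZ beta alpha.
Definition t_hat : seqZ := joinZ beta_hat alpha.

Definition Delta : set seqZ :=
  closure [set x : seqZ | exists j : int, x = shiftZ j t_seq].
Definition DeltaP : set seqN :=
  closure [set s : seqN | exists j : nat, s = shiftN j alpha].

End MinimalSets.

Section Paths.
Context (n : nat -> nat).

Definition edge : Type := (word * letter * word)%type.
Definition edge_u (e : edge) : word := e.1.1.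
Definition edge_a (e : edge) : letter := e.1.2.
Definition edge_v (e : edge) : word := e.2.

Definition is_path (G : nat -> edge) : Prop :=
  forall i, Lambda (n i.+1) [:: edge_a (G i.+1)]
            = edge_u (G i) ++ edge_a (G i) :: edge_v (G i).

Definition tail_eq (G G' : nat -> edge) : Prop :=
  exists N, forall i, (N <= i)%N -> G i = G' i.

Definition W (G : nat -> edge) : pseq :=
  joinZ
    (lim_word (fun N =>
       flatten (mkseq (fun j => rev (LambdaK n j (edge_u (G j)))) N)))
    (lim_word (fun N =>
       edge_a (G 0%N) ::
         flatten (mkseq (fun j => LambdaK n j (edge_v (G j))) N))).

Definition G_beta (k : nat) : edge :=
  if odd k then ([::], L2, [::]) else (L3 :: nseq (n k.+1) L1, L1, [::]).
Definition G_beta_hat (k : nat) : edge :=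
  if odd k then (L3 :: nseq (n k.+1) L1, L1, [::]) else ([::], L2, [::]).
Definition G_alpha (k : nat) : edge := ([::], L3, nseq (n k.+1) L1).
Definition G_2max (k : nat) : edge :=
  if odd k then ([:: L3], L1, nseq (n k.+1) L1) else ([::], L2, [::]).
Definition G_3max (k : nat) : edge :=
  if k == 0%N then ([::], L3, nseq (n 1%N).+1 L1)
  else if odd k then ([::], L2, [::])
  else ([:: L3], L1, nseq (n k.+1) L1).

Definition S1 : set (nat -> edge) :=
  [set G | is_path G /\ tail_eq G G_beta].
Definition S1_hat : set (nat -> edge) :=
  [set G | is_path G /\ tail_eq G G_beta_hat].
Definition S2 : set (nat -> edge) :=
  [set G | is_path G /\ tail_eq G G_alpha].

Definition eps : nat -> option letter := fun=> None.
Definition beta_eps : pseq := joinZ (Some \o beta n) eps.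
Definition beta_hat_eps : pseq := joinZ (Some \o beta_hat n) eps.
Definition eps_alpha : pseq := joinZ eps (Some \o alpha n).

Definition H (G : nat -> edge) : seqN :=
  if `[< S1 G >] then
    projN (shiftZ (xget 0 [set j | j < 0 /\ W G = shiftZ j beta_eps]) (t_seq n))
  else if `[< S1_hat G >] then
    projN (shiftZ (xget 0 [set j | j < 0 /\ W G = shiftZ j beta_hat_eps])
                 (t_hat n))
  else if `[< S2 G >] then
    projN (shiftZ (xget 0 [set j | 0 <= j /\ W G = shiftZ j eps_alpha]) (t_seq n))
  else projN (fill (W G)).

Definition H_inv (s : seqN) : nat -> edge :=
  xget G_alpha [set G | is_path G /\ H G = s].

Definition w_seq : seqZ := fill (W G_2max).
Definition w_hat : seqZ := fill (W G_3max).

End Paths.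

Section Projection.
Context (R : realType) (n : nat -> nat).

Definition A_mx (m : nat) : 'M[R]_3 :=
  \matrix_(i, j)
    nth 0 (nth [::] [:: [:: 0; m.+1%:R; m%:R];
                        [:: 1; 0; 0];
                        [:: 0; 1; 1]] i) j.
Fixpoint A_prod (k : nat) : 'M[R]_3 :=
  if k is k'.+1 then A_prod k' *m A_mx (n k) else 1%:M.

Definition C_mmp : set 'cV[R]_3 :=
  [set x | [/\ x L1 0 < 0, x L2 0 < 0 & 0 < x L3 0]].

Definition norm2 (x : 'cV[R]_3) : R := Num.sqrt (\sum_(i < 3) x i 0 ^+ 2).

Definition is_ell (l : 'cV[R]_3) : Prop :=
  [/\ C_mmp l,
      norm2 l = 1 &
      forall w, C_mmp w ->
        (fun k : nat => let x := (invmx (A_prod k))^T *m w in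
                        (norm2 x)^-1 *: x) @ \oo --> l].
Definition ell : 'cV[R]_3 := xget 0 is_ell.

Definition phi (w : word) : R :=
  \sum_(a < 3) ell a 0 * (count_mem a w)%:R.

(* The term of index 0 is phi(u_0). *)
Definition Psi_L (G : nat -> edge) : R :=
  limn (series (fun j => phi (LambdaK n j (edge_u (G j))))).

Definition UpsilonP (s : seqN) : R := Psi_L (H_inv n s).
Definition Upsilon1 (s : seqN) : R := UpsilonP s / (ell L3 0 - ell L2 0).

Definition mu1 : R := - ell L2 0 / (ell L3 0 - ell L2 0).
Definition mu2 : R := - ell L1 0 / (ell L3 0 - ell L2 0).

End Projection.

Section ITM.
Context (R : realType) (m1 m2 : R).

Definition T_itm (x : R) : R :=
  if x < m1 then x + 1 - m1 else if x < m2 then x - m1 else x - m2.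

Definition D_itm : set R :=
  [set y | (0 <= y <= 1) /\
           exists i, iter i T_itm y = m1 \/ iter i T_itm y = m2].

(* A point y of I is the pair (y, false) and the second copy of a point y of D
   is (y, true); in the lexicographic order of R * bool the latter is placed
   immediately after the former. *)
Definition in_Itilde (p : (R *l bool)%type) : bool :=
  (0 <= p.1 <= 1) && (p.2 ==> `[< D_itm p.1 >]).

Record Itilde := MkItilde { Ival : (R *l bool)%type; _ : in_Itilde Ival }.

HB.instance Definition _ := [isSub for Ival].
HB.instance Definition _ := [Choice of Itilde by <:].
HB.instance Definition _ :=
  [SubChoice_isSubOrder of Itilde by <: with ring_display].
HB.instance Definition _ :=
  OrderTopological.copy Itilde (order_topology Itilde).

Fact zero_in_Itilde : in_Itilde (0, false).
Proof. by rewrite /in_Itilde /= lexx ler01. Qed.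

(* [pt y] is the point y of I and [dup y] is its second copy; both are the
   junk value 0 if y is not in I, respectively not in D. *)
Definition pt (y : R) : Itilde := insubd (MkItilde zero_in_Itilde) (y, false).
Definition dup (y : R) : Itilde := insubd (MkItilde zero_in_Itilde) (y, true).

Definition T_tilde (p : Itilde) : Itilde :=
  let: (y, b) := Ival p in
  if b then
    (if (y == m1) || (y == m2) then pt 0 else dup (T_itm y))
  else if y == m1 then pt 1
  else if y == m2 then pt (m2 - m1)
  else pt (T_itm y).

Definition Omega : set Itilde :=
  \bigcap_(i : nat) (iter i T_tilde @` [set: Itilde]).

Definition I_part (a : letter) : set Itilde :=
  if a == L1 then `[dup m2, pt 1]%classic
  else if a == L2 then `[dup m1, pt m2]%classic
  else `[pt 0, pt m1]%classic.

Definition is_itinerary (x : Itilde) (s : seqN) : Prop :=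
  forall (i : nat) (a : letter), s i = a <-> I_part a (iter i T_tilde x).

End ITM.

Section Representation.
Context (R : realType) (n : nat -> nat).

Local Notation ItildeN := (Itilde (mu1 R n) (mu2 R n)).

Definition T_tildeN : ItildeN -> ItildeN := @T_tilde R (mu1 R n) (mu2 R n).
Definition OmegaN : set ItildeN := @Omega R (mu1 R n) (mu2 R n).

Definition y_pt (j : nat) : R :=
  Upsilon1 R n (projN (shiftZ (- j%:Z) (t_hat n))).
Definition z_pt (j : nat) : R :=
  Upsilon1 R n (projN (shiftZ (- j%:Z) (t_seq n))).

(* The index j > 0 with s = pi (S^(e - j) x), if any. *)
Definition back_index (x : seqZ) (e : int) (s : seqN) : option nat :=
  xget None [set o | exists2 j : nat,
    (0 < j)%N /\ s = projN (shiftZ (e - j%:Z) x) & o = Some j].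

Definition UpsilonTP (s : seqN) : ItildeN :=
  if back_index (t_hat n) 0 s is Some j then dup _ _ (y_pt j)
  else if back_index (w_hat n) 1 s is Some j then pt _ _ (y_pt j)
  else if back_index (t_seq n) 0 s is Some j then dup _ _ (z_pt j)
  else if back_index (w_seq n) 1 s is Some j then pt _ _ (z_pt j)
  else pt _ _ (Upsilon1 R n s).

Definition UpsilonT (x : seqZ) : ItildeN := UpsilonTP (projN x).

End Representation.

Arguments OmegaN R n x : clear implicits.
Arguments T_tildeN R n p : clear implicits.
Arguments UpsilonTP R n s : clear implicits.
Arguments UpsilonT R n x : clear implicits.

Definition homeomorphism_on (X Y : topologicalType) (A : set X) (B : set Y)
    (f : X -> Y) : Prop :=
  [/\ set_bij A B f,
      {within A, continuous f} &
      exists g : Y -> X,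
        {in A, cancel f g} /\ {within B, continuous g}].

Definition topological_conjugacy (X Y : topologicalType) (A : set X) (B : set Y)
    (S : X -> X) (T : Y -> Y) (f : X -> Y) : Prop :=
  homeomorphism_on A B f /\ (forall x, A x -> f (S x) = T (f x)).

Definition topological_semiconjugacy (X Y : topologicalType) (A : set X)
    (B : set Y) (S : X -> X) (T : Y -> Y) (f : X -> Y) : Prop :=
  [/\ f @` A = B,
      {within A, continuous f} &
      forall x, A x -> f (S x) = T (f x)].

(* Main.v *)
(* Weigh a word w by psi w = phi w / (ell_3 - ell_2), so that the positive
   numbers p_k = - psi (Lambda^k 1), q_k = - psi (Lambda^k 2) and
   r_k = psi (Lambda^k 3) satisfy q_k = p_{k+1}, p_k = q_{k+1} + r_{k+1} and
   r_k = n_{k+1} p_k + r_{k+1}. The number x attached to a path is determined by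
   the right infinite word s of the path alone: it is the only x for which all
   sums x + psi (prefix of s) are nonnegative with lower limit 0. This yields
   the equivariance with respect to the shift, and, together with the ranges of
   x for a given first letter, the itineraries and the order reversal. A point
   of Delta^+ is sent to a second copy exactly when one of its proper shifts is
   alpha, the only word of value 0; such points come from the two pasts beta and
   beta-hat of alpha.

   For the surjectivity onto the attractor, let tau_k be the extended map whose
   three translations are - p_k, - q_k and r_k. The first return map of tau_k to
   the points whose letter is not 1 is tau_{k+1}, and the itinerary of a point up
   to its return is the image under Lambda_{n_{k+1}} of its letter for
   tau_{k+1}. A point of the attractor thus defines a letter and an edge at each
   level, hence a path, whose value is the point. Injectivity of the shift away
   from alpha, which also determines the fibres over the two-sided minimal set,
   follows by comparing two preimages through all levels, where their
   discrepancy is bounded by p_k, which tends to 0. *)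
Require Import Defs.
From mathcomp Require Import all_boot all_order all_algebra.
From mathcomp Require Import all_classical all_reals all_analysis.
From mathcomp Require Import zify ring lra.

Import Order.TTheory GRing.Theory Num.Theory.
Import numFieldNormedType.Exports.

Set Implicit Arguments.
Unset Strict Implicit.
Unset Printing Implicit Defensive.

Local Open Scope classical_set_scope.
Local Open Scope ring_scope.

(** The overview takes for granted that p_k, q_k, r_k are positive. Since [ell] is a chosen vector,
    its existence has to be proved first: in the coordinates (- x1, - x2, x3) the inverse transposes
    are nonnegative matrices, and three consecutive ones multiply to a matrix lying entrywise
    between a rank one matrix and 3 times it. This contracts ratios of coordinates by 2/3 uniformly,
    although the n_k may be unbounded. Nonnegativity at every level passes to the limit from the
    approximants, and the recursions make it strict.

    In the coding, the delicate classes are S1 and S1-hat: their right words are finite, and [H]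
    appends alpha, of which the edges know nothing. There the sum over the finite word is exactly 0,
    the value of alpha, and the compactness argument that produces paths must show that the
    approximating sequences continue with alpha too.

    In the order topology, upper and lower bounds are treated separately: at a doubled value one
    side is controlled by the uniqueness of alpha as a word of value 0, the other by the maximality
    of a value for its letter. *)

Lemma letterP (a : letter) : [\/ a = L1, a = L2 | a = L3].
Proof.
by case: a => -[|[|[|//]]] h; [constructor 1|constructor 2|constructor 3];
  apply/val_inj.
Qed.

(** * Images of words and the shapes of the edges *)

Lemma Lambda_cat m w w' : Lambda m (w ++ w') = Lambda m w ++ Lambda m w'.
Proof. by rewrite /Lambda map_cat flatten_cat. Qed.

Lemma Lambda_letter m a :
  Lambda m [:: a]
    = if a == L1 then [:: L2] else L3 :: nseq (m + (a == L2)) L1.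
Proof.
by case: (letterP a) => ->; rewrite /Lambda /Lambda1 /= ?cats0 ?addn0 ?addn1.
Qed.

Lemma LambdaK_cat n k w w' :
  LambdaK n k (w ++ w') = LambdaK n k w ++ LambdaK n k w'.
Proof. by elim: k w w' => //= k IH w w'; rewrite Lambda_cat IH. Qed.

Lemma LambdaK_cons n k a w :
  LambdaK n k (a :: w) = LambdaK n k [:: a] ++ LambdaK n k w.
Proof. by rewrite -cat1s LambdaK_cat. Qed.

Lemma LambdaK_nil n k : LambdaK n k [::] = [::].
Proof. by elim: k. Qed.

Lemma size_Lambda m w : (size w <= size (Lambda m w))%N.
Proof.
elim: w => // a w IH; rewrite -cat1s Lambda_cat size_cat Lambda_letter.
by rewrite size_cat; case: ifP => _ /=; lia.
Qed.

Lemma size_LambdaK n k w : (size w <= size (LambdaK n k w))%N.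
Proof. by elim: k w => //= k IH w; apply: leq_trans (IH _); exact: size_Lambda. Qed.

(** The possible edges below the upper letter [a]. The images of 2 and 3 differ by one final 1 only,
    so the constructors with [a != L1] cover both, the boolean [a == L2] counting the extra 1. *)
Inductive edge_spec (m : nat) : letter -> word -> letter -> word -> Prop :=
| Edge2 : edge_spec m L1 [::] L2 [::]
| Edge3 a of a != L1 : edge_spec m a [::] L3 (nseq (m + (a == L2)) L1)
| Edge1 a i of a != L1 & (i < m + (a == L2))%N :
    edge_spec m a (L3 :: nseq i L1) L1 (nseq (m + (a == L2) - i.+1) L1).

Lemma edgeP m a u b v : Lambda m [:: a] = u ++ b :: v -> edge_spec m a u b v.
Proof.
rewrite Lambda_letter; case: eqP => [->|/eqP a1].
  by case: u => [[<- <-]|c [|//]]; first exact: Edge2.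
case: u => [[<- <-]|c u] /=; first exact: Edge3.
case=> <- E; have ltu : (size u < m + (a == L2))%N.
  by move/(congr1 size): E; rewrite size_nseq size_cat /=; lia.
have -> : u = nseq (size u) L1.
  move: (congr1 (take (size u)) E).
  rewrite take_size_cat // take_nseq; last exact: ltnW.
  by move=> {1}<-.
have Ed : nseq (m + (a == L2) - size u) L1 = b :: v.
  by rewrite -drop_nseq E drop_size_cat.
move: Ed; rewrite -(subnSK ltu) /= => -[<- <-].
exact: Edge1.
Qed.

(** * Letterwise limits of words *)

Section LimWord.

Lemma lim_word_near (w : nat -> word) p o :
  (\forall k \near \oo, onth (w k) p = o) -> lim_word w p = o.
Proof.
move=> ho; rewrite /lim_word; case: xgetP => [x _ /= hx|/(_ o)//].
have [k [/= <- <-]] := @filter_ex _ \oo _ _ (filterI hx ho); first by [].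
Qed.

Lemma prefix_mono (w : nat -> word) :
    (forall k, prefix (w k) (w k.+1)) ->
  forall k l, (k <= l)%N -> prefix (w k) (w l).
Proof.
move=> wS k l /subnK <-; elim: (l - k)%N => [|d IH]; first exact: prefix_refl.
exact: prefix_trans IH (wS _).
Qed.

Lemma onth_prefix (u v : word) p :
  prefix u v -> (p < size u)%N -> onth v p = onth u p.
Proof.
by move=> /prefixP[t ->] lt_p; rewrite !onthE map_cat nth_cat size_map lt_p.
Qed.

Lemma lim_word_prefix (w : nat -> word) : (forall k, prefix (w k) (w k.+1)) ->
  forall k p, (p < size (w k))%N -> lim_word w p = onth (w k) p.
Proof.
move=> wS k p lt_p; apply: lim_word_near; exists k => // l /= kl.
exact: onth_prefix (prefix_mono wS kl) lt_p.
Qed.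

Lemma lim_word_None (w : nat -> word) p :
  (forall k, (size (w k) <= p)%N) -> lim_word w p = None.
Proof.
move=> h; apply: lim_word_near; near=> k.
by rewrite onthE nth_default // size_map h.
Unshelve. all: by end_near. Qed.

Lemma mkseq_lim_word (w : nat -> word) k :
    (forall j, prefix (w j) (w j.+1)) ->
  mkseq (fill (lim_word w)) (size (w k)) = w k.
Proof.
move=> wS; apply: (@eq_from_nth _ L1); rewrite ?size_mkseq // => i lt_i.
rewrite nth_mkseq // /fill (lim_word_prefix wS lt_i) onthE.
by rewrite (nth_map L1).
Qed.

End LimWord.

Lemma take_mkseq (T : Type) (s : nat -> T) j k :
  (j <= k)%N -> take j (mkseq s k) = mkseq s j.
Proof. by move=> jk; rewrite /mkseq -map_take take_iota (minn_idPl jk). Qed.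

(** * Finite stages of a path *)

Section Paths.
Context (n : nat -> nat).

(** Finite stages of the two halves of [W]. The left one is kept in reading order, so that the two
    fit together in [path_split]. *)
Fixpoint leftU (G : nat -> edge) (k : nat) : word :=
  if k is k'.+1 then LambdaK n k' (edge_u (G k')) ++ leftU G k' else [::].
Fixpoint rightV (G : nat -> edge) (k : nat) : word :=
  if k is k'.+1 then rightV G k' ++ LambdaK n k' (edge_v (G k')) else [::].

Lemma leftUE G k :
  flatten (mkseq (fun j => rev (LambdaK n j (edge_u (G j)))) k)
    = rev (leftU G k).
Proof.
elim: k => // k IH; rewrite mkseqS -cats1 flatten_cat /= cats0 rev_cat -IH.
by [].
Qed.

Lemma rightVE G k :
  flatten (mkseq (fun j => LambdaK n j (edge_v (G j))) k) = rightV G k.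
Proof.
elim: k => // k IH; rewrite mkseqS -cats1 flatten_cat /= cats0 -IH.
by [].
Qed.

Definition path_upto (G : nat -> edge) (N : nat) : Prop :=
  forall i, (i < N)%N -> Lambda (n i.+1) [:: edge_a (G i.+1)]
                          = edge_u (G i) ++ edge_a (G i) :: edge_v (G i).

Lemma path_uptoW G N : is_path n G -> path_upto G N.
Proof. by move=> pG i _; exact: pG. Qed.

Lemma path_split G N : path_upto G N ->
  LambdaK n N [:: edge_a (G N)] = leftU G N ++ edge_a (G 0%N) :: rightV G N.
Proof.
elim: N => //= N IH pG.
rewrite (pG N) // -cat1s !LambdaK_cat IH; last by move=> i iN; exact/pG/ltnW.
by rewrite -!catA.
Qed.

Lemma LambdaK_block N w j : (j < size (LambdaK n N w))%N ->
  exists u b v, w = u ++ b :: v /\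
    (size (LambdaK n N u) <= j < size (LambdaK n N u) + size (LambdaK n N [:: b]))%N.
Proof.
elim: w j => [|a w IH] j; first by rewrite LambdaK_nil.
rewrite LambdaK_cons size_cat => jlt.
have [ja|ja] := ltnP j (size (LambdaK n N [:: a])).
  by exists [::], a, w; rewrite LambdaK_nil.
have [|u [b [v [-> hj]]]] := IH (j - size (LambdaK n N [:: a]))%N; first lia.
exists (a :: u), b, v; split => //.
by rewrite LambdaK_cons size_cat; lia.
Qed.

(** Position [j] lies in the image of one letter of the word below a_N; that letter gives the edge
    just below level N, and the offset inside its image is treated at the next lower level. Thus the
    marked letter can be moved anywhere inside the image of a_N without changing the path from N
    on. *)
Lemma address G N j : (j < size (LambdaK n N [:: edge_a (G N)]))%N ->
  exists G', [/\ forall i, (N <= i)%N -> G' i = G i, path_upto G' N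
                & size (leftU G' N) = j].
Proof.
elim: N G j => [|N IH] G j /=.
  by case: j => // _; exists G; split.
move=> /LambdaK_block[u [b [v [E /andP[uj jb]]]]].
pose G1 i := if i == N then (u, b, v) else G i.
have G1N : G1 N = (u, b, v) by rewrite /G1 eqxx.
have [|G' [G'G pG' sG']] := IH G1 (j - size (LambdaK n N u))%N.
  by rewrite G1N /edge_a /=; lia.
exists G'; split.
- by move=> i Ni; rewrite G'G ?(ltnW Ni) // /G1 gtn_eqF.
- move=> i; rewrite ltnS leq_eqVlt => /orP[/eqP->|]; last exact: pG'.
  by rewrite !G'G // G1N /G1 gtn_eqF.
- by rewrite G'G // G1N /= size_cat sG' subnKC.
Qed.

Lemma splice_path G G' N : is_path n G ->
  (forall i, (N <= i)%N -> G' i = G i) -> path_upto G' N -> is_path n G'.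
Proof.
move=> pG G'G pG' i; have [/pG'//|Ni] := ltnP i N.
by rewrite !G'G // ltnW.
Qed.

End Paths.

(** * The limit words alpha, beta and beta-hat *)

Section Limits.
Context (n : nat -> nat).
Hypothesis n_pos : forall k : nat, (0 < k)%N -> (0 < n k)%N.

Lemma prefix_LambdaK3 k : prefix (LambdaK n k [:: L3]) (LambdaK n k.+1 [:: L3]).
Proof.
by rewrite /= Lambda_letter /= (LambdaK_cons _ _ _ (nseq _ _)) prefix_prefix.
Qed.

Lemma size_LambdaK3 k : (k < size (LambdaK n k [:: L3]))%N.
Proof.
elim: k => // k IH; rewrite /= Lambda_letter /= LambdaK_cons size_cat.
apply: leq_ltn_trans IH _; rewrite -addn1 leq_add2l addn0.
by apply: leq_trans (size_LambdaK _ _ _); rewrite size_nseq n_pos.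
Qed.

(** The loss of one in [k.-1] comes from the letter 1, whose first image is the single letter 2. *)
Lemma size_LambdaK_unbounded k a : (k.-1 <= size (LambdaK n k [:: a]))%N.
Proof.
have h2 j : (j <= size (LambdaK n j [:: L2]))%N.
  case: j => // j; rewrite /= Lambda_letter /= LambdaK_cons size_cat.
  by apply: leq_trans (size_LambdaK3 j) _; rewrite leq_addr.
case: (letterP a) => ->; last 1 first.
- by apply: leq_trans (leq_pred _) (ltnW (size_LambdaK3 k)).
- case: k => // k /=; rewrite Lambda_letter /=; exact: h2.
- exact: leq_trans (leq_pred _) (h2 k).
Qed.

Lemma alphaE k :
  mkseq (alpha n) (size (LambdaK n k [:: L3])) = LambdaK n k [:: L3].
Proof. by rewrite /alpha mkseq_lim_word //; exact: prefix_LambdaK3. Qed.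

(** The image of 1 is 2 and the image of 2 ends in 1, so the last letters of iterated images
    alternate. Images extend each other to the left only along levels of one parity. *)
Lemma beta_mono k : prefix (rev (LambdaK n (2 * k) [:: L1]))
                           (rev (LambdaK n (2 * k.+1) [:: L1])).
Proof.
rewrite mulnS add2n /= Lambda_letter /= Lambda_letter /=.
have -> : nseq (n (2 * k).+1 + 1) L1 = nseq (n (2 * k).+1) L1 ++ [:: L1].
  by rewrite nseqD.
by rewrite -cat_cons LambdaK_cat rev_cat prefix_prefix.
Qed.

Lemma beta_hat_mono k : prefix (rev (LambdaK n (2 * k) [:: L2]))
                           (rev (LambdaK n (2 * k.+1) [:: L2])).
Proof.
rewrite mulnS add2n /= Lambda_letter /=.
have -> : nseq (n (2 * k).+2 + 1) L1 = nseq (n (2 * k).+2) L1 ++ [:: L1].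
  by rewrite nseqD.
rewrite -cat_cons Lambda_cat [Lambda _ [:: L1]]Lambda_letter /=.
by rewrite -cat_cons LambdaK_cat rev_cat prefix_prefix.
Qed.

Lemma betaE k : mkseq (beta n) (size (LambdaK n (2 * k) [:: L1]))
  = rev (LambdaK n (2 * k) [:: L1]).
Proof.
rewrite -[size _]size_rev /beta.
exact: (mkseq_lim_word (w := fun k => rev (LambdaK n (2 * k) [:: L1])) _ beta_mono).
Qed.

Lemma beta_hatE k : mkseq (beta_hat n) (size (LambdaK n (2 * k) [:: L2]))
  = rev (LambdaK n (2 * k) [:: L2]).
Proof.
rewrite -[size _]size_rev /beta_hat.
exact: (mkseq_lim_word (w := fun k => rev (LambdaK n (2 * k) [:: L2])) _ beta_hat_mono).
Qed.

Lemma beta0 : beta n 0%N = L1.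
Proof. by have [] := betaE 0. Qed.

Lemma beta_hat0 : beta_hat n 0%N = L2.
Proof. by have [] := beta_hatE 0. Qed.

End Limits.

(** * The sequence represented by a path *)

Section RepresentedSequences.
Context (n : nat -> nat).
Hypothesis n_pos : forall k : nat, (0 < k)%N -> (0 < n k)%N.

Definition rightW (G : nat -> edge) (N : nat) : word :=
  edge_a (G 0%N) :: rightV n G N.

Lemma rightW_mono G N : prefix (rightW G N) (rightW G N.+1).
Proof. by rewrite /rightW -[_ :: rightV n G N.+1]cat_cons prefix_prefix. Qed.

Lemma leftU_mono G N : prefix (rev (leftU n G N)) (rev (leftU n G N.+1)).
Proof. by rewrite /= rev_cat prefix_prefix. Qed.

Lemma W_right G (i : nat) : W n G i%:Z = lim_word (rightW G) i.
Proof.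
rewrite /W /=; congr (lim_word _ _); apply/funext => N.
by rewrite rightVE.
Qed.

Lemma W_left G (i : nat) :
  W n G (Negz i) = lim_word (fun N => rev (leftU n G N)) i.
Proof.
rewrite /W /=; congr (lim_word _ _); apply/funext => N.
by rewrite leftUE.
Qed.

Lemma W_rightE G N i : (i < size (rightW G N))%N ->
  W n G i%:Z = Some (nth L1 (rightW G N) i).
Proof.
move=> iN; rewrite W_right (lim_word_prefix (rightW_mono G) iN) onthE.
by rewrite (nth_map L1).
Qed.

Lemma W_leftE G N i : (i < size (leftU n G N))%N ->
  W n G (Negz i) = Some (nth L1 (rev (leftU n G N)) i).
Proof.
rewrite -size_rev => iN; rewrite W_left.
by rewrite (lim_word_prefix (leftU_mono G) iN) onthE (nth_map L1).
Qed.

Lemma prefix_rightW G N M : (N <= M)%N -> prefix (rightW G N) (rightW G M).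
Proof. exact: (prefix_mono (rightW_mono G)). Qed.

Lemma size_rightW_mono G N M : (N <= M)%N ->
  (size (rightW G N) <= size (rightW G M))%N.
Proof. by move=> /(prefix_rightW G)/size_prefix. Qed.

Lemma size_leftU_mono G N M : (N <= M)%N ->
  (size (leftU n G N) <= size (leftU n G M))%N.
Proof.
move=> /(prefix_mono (leftU_mono G))/size_prefix.
by rewrite !size_rev.
Qed.

Lemma mkseq_rightW G (s : nat -> letter) N :
  (forall i, (i < size (rightW G N))%N -> W n G i%:Z = Some (s i)) ->
  mkseq s (size (rightW G N)) = rightW G N.
Proof.
move=> h; apply: (@eq_from_nth _ L1); rewrite ?size_mkseq // => i iN.
rewrite nth_mkseq //.
by have := h i iN; rewrite (W_rightE iN) => -[].
Qed.

Lemma path_edge G k : is_path n G ->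
  edge_spec (n k.+1) (edge_a (G k.+1)) (edge_u (G k)) (edge_a (G k)) (edge_v (G k)).
Proof. by move=> pG; apply: edgeP; exact: pG. Qed.

Lemma edge_eta (e : edge) : e = (edge_u e, edge_a e, edge_v e).
Proof. by case: e => -[]. Qed.

Lemma G_beta_path : is_path n (G_beta n).
Proof.
move=> i; rewrite /G_beta /=; case: (odd i) => /=; rewrite Lambda_letter //=.
by rewrite nseqD.
Qed.

Lemma G_beta_hat_path : is_path n (G_beta_hat n).
Proof.
move=> i; rewrite /G_beta_hat /=; case: (odd i) => /=; rewrite Lambda_letter //=.
by rewrite nseqD.
Qed.

Lemma G_alpha_path : is_path n (G_alpha n).
Proof. by move=> i; rewrite Lambda_letter /= addn0. Qed.

Lemma tail_eqP G G' : tail_eq G G' ->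
  exists M, forall i, (2 * M <= i)%N -> G i = G' i.
Proof. by move=> [N h]; exists N => i Ni; apply: h; lia. Qed.

Lemma beta_a k : edge_a (G_beta n (2 * k)) = L1.
Proof. by rewrite /G_beta oddM. Qed.

Lemma beta_hat_a k : edge_a (G_beta_hat n (2 * k)) = L2.
Proof. by rewrite /G_beta_hat oddM. Qed.

Lemma beta_v k : edge_v (G_beta n k) = [::].
Proof. by rewrite /G_beta; case: odd. Qed.

Lemma beta_hat_v k : edge_v (G_beta_hat n k) = [::].
Proof. by rewrite /G_beta_hat; case: odd. Qed.

Lemma tail_eq_a G A B : tail_eq G A -> tail_eq G B ->
  exists k, edge_a (A (2 * k)) = edge_a (B (2 * k)).
Proof.
move=> /tail_eqP[M hM] /tail_eqP[N hN]; exists (maxn M N).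
by rewrite -hM -?hN //; lia.
Qed.

Lemma S1_not_S1_hat G : S1 n G -> ~ S1_hat n G.
Proof.
by move=> [_ h1] [_ /(tail_eq_a h1)[k]]; rewrite beta_a beta_hat_a.
Qed.

Lemma S1_not_S2 G : S1 n G -> ~ S2 n G.
Proof. by move=> [_ h1] [_ /(tail_eq_a h1)[k]]; rewrite beta_a. Qed.

Lemma S1_hat_not_S2 G : S1_hat n G -> ~ S2 n G.
Proof. by move=> [_ h1] [_ /(tail_eq_a h1)[k]]; rewrite beta_hat_a. Qed.

Section FiniteRight.
Context (b : nat -> letter) (c : letter) (Gb : nat -> edge).
Hypothesis bE : forall K, mkseq b (size (LambdaK n (2 * K) [:: c]))
                          = rev (LambdaK n (2 * K) [:: c]).
Hypothesis Gb_a : forall K, edge_a (Gb (2 * K)) = c.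
Hypothesis Gb_v : forall K, edge_v (Gb K) = [::].

Let b_eps : pseq := joinZ (Some \o b) eps.

(** Once all v are empty the right half stops growing, and for large K the image of [c] at level 2K
    is a growing left half followed by this fixed word. Read from its right end it is an initial
    part of [b], so the point sits [size (rightW G (2 * M))] letters before the end. *)
Lemma W_finite G M : is_path n G -> (forall i, (2 * M <= i)%N -> G i = Gb i) ->
  W n G = shiftZ (- (size (rightW G (2 * M)))%:Z) b_eps
  /\ forall N, (2 * M <= N)%N -> rightW G N = rightW G (2 * M).
Proof.
move=> pG hM.
have cstW N : (2 * M <= N)%N -> rightW G N = rightW G (2 * M).
  move=> /subnKC <-; elim: (N - 2 * M)%N => [|d IH]; first by rewrite addn0.
  rewrite addnS /rightW /= (hM (2 * M + d)%N) ?leq_addr // Gb_v LambdaK_nil cats0.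
  exact: IH.
split => //.
have splitK K : (M <= K)%N ->
    rev (LambdaK n (2 * K) [:: c])
      = rev (rightW G (2 * M)) ++ rev (leftU n G (2 * K)).
  move=> MK; have := path_split (path_uptoW (N := 2 * K) pG).
  rewrite hM ?Gb_a; last lia.
  move=> ->; rewrite -/(rightW G (2 * K)) cstW ?rev_cat //; lia.
have nthb K i : (M <= K)%N -> (i < size (LambdaK n (2 * K) [:: c]))%N ->
    b i = nth L1 (rev (rightW G (2 * M)) ++ rev (leftU n G (2 * K))) i.
  by move=> MK iK; rewrite -splitK // -bE nth_mkseq.
set L := size (rightW G (2 * M)) in nthb *.
apply/funext => -[p|q]; rewrite /shiftZ.
- have [pL|Lp] := ltnP p L.
    have -> : (p%:Z + - L%:Z) = Negz (L - p.+1) by lia.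
    rewrite (W_rightE pL) /= (nthb M) //; last first.
      by rewrite -size_rev splitK // size_cat size_rev -/L; lia.
    rewrite nth_cat size_rev -/L ifT; last lia.
    by rewrite nth_rev -/L; [congr (Some (nth _ _ _)); lia|lia].
  have -> : (p%:Z + - L%:Z) = (p - L)%N%:Z by lia.
  rewrite W_right lim_word_None // => k.
  apply: leq_trans (size_rightW_mono G (leq_addr (2 * M) k)) _.
  by rewrite cstW // leq_addl.
- have -> : (Negz q + - L%:Z) = Negz (q + L)%N by lia.
  pose K := (M + q + L + 2)%N.
  have qK : (q + L < size (LambdaK n (2 * K) [:: c]))%N.
    by apply: leq_trans (size_LambdaK_unbounded n_pos (2 * K) c); rewrite /K; lia.
  rewrite [RHS]/= (nthb K) //; last by rewrite /K; lia.
  rewrite nth_cat size_rev -/L ifF; last lia.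
  rewrite addnK -/(W n G (Negz q)) (@W_leftE _ (2 * K)) //.
  move: qK; rewrite -size_rev splitK; last by rewrite /K; lia.
  by rewrite size_cat !size_rev -/L; lia.
Qed.

Lemma shiftZ_eps_inj (i j : int) :
  shiftZ i b_eps = shiftZ j b_eps -> i = j.
Proof.
have None_ge0 (k : int) : b_eps k = None <-> 0 <= k by case: k.
move=> E; apply: le_anti.
have hi := congr1 (fun f => f (- i)) E; have hj := congr1 (fun f => f (- j)) E.
move: hi hj; rewrite /shiftZ /= !addNr => hi hj.
have /None_ge0 : b_eps (- i + j) = None by rewrite -hi.
have /None_ge0 : b_eps (- j + i) = None by rewrite hj.
lia.
Qed.

Lemma joinZ_neg (a : nat -> letter) (L p : nat) : (p < L)%N ->
  joinZ b a (p%:Z + - L%:Z) = b (L - p.+1)%N.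
Proof. by move=> pL; have -> : p%:Z + - L%:Z = Negz (L - p.+1) by lia. Qed.

Lemma projN_shiftZ_finite G M (j : int) (a : nat -> letter) :
    is_path n G -> (forall i, (2 * M <= i)%N -> G i = Gb i) ->
    j < 0 /\ W n G = shiftZ j b_eps ->
  let L := size (rightW G (2 * M)) in
  let s := projN (shiftZ j (joinZ b a)) in
  [/\ j = - L%:Z, forall N, mkseq s (size (rightW G N)) = rightW G N
    & forall i, s (i + L)%N = a i].
Proof.
move=> pG hM [j0 Wj] L s.
have [WL cst] := W_finite pG hM.
have jL : j = - L%:Z by apply: shiftZ_eps_inj; rewrite -Wj.
split=> //.
- move=> N; apply: mkseq_rightW => i iN.
  have iL : (i < L)%N.
    apply: leq_trans iN _; have [NM|/ltnW/cst->//] := leqP N (2 * M).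
    exact: size_rightW_mono.
  rewrite WL /s /projN /shiftZ jL joinZ_neg //.
  by have -> : i%:Z + - L%:Z = Negz (L - i.+1) by lia.
- move=> i; rewrite /s /projN /shiftZ jL.
  by have -> : (i + L)%N%:Z + - L%:Z = i by lia.
Qed.

End FiniteRight.
Lemma H_S1 G : S1 n G -> exists L M : nat,
  [/\ (0 < L)%N, H n G = projN (shiftZ (- L%:Z) (t_seq n)),
      forall N, (M <= N)%N -> size (rightW G N) = L,
      forall N, mkseq (H n G) (size (rightW G N)) = rightW G N
    & forall i, H n G (i + L)%N = alpha n i].
Proof.
move=> SG; have [pG /tail_eqP[M hM]] := SG.
have [WL cst] := W_finite (betaE n) beta_a beta_v pG hM.
rewrite /H asboolT //.
case: xgetP => [j _ hj|/(_ (- (size (rightW G (2 * M)))%:Z))[]]; last first.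
  by split => //; rewrite /rightW /=; lia.
have [jL h1 h2] := projN_shiftZ_finite (betaE n) beta_a beta_v (alpha n) pG hM hj.
exists (size (rightW G (2 * M))), (2 * M)%N; split => //.
- by rewrite jL.
- by move=> N /cst->.
Qed.

Lemma H_S1_hat G : S1_hat n G -> exists L M : nat,
  [/\ (0 < L)%N, H n G = projN (shiftZ (- L%:Z) (t_hat n)),
      forall N, (M <= N)%N -> size (rightW G N) = L,
      forall N, mkseq (H n G) (size (rightW G N)) = rightW G N
    & forall i, H n G (i + L)%N = alpha n i].
Proof.
move=> SG; have [pG /tail_eqP[M hM]] := SG.
have [WL cst] := W_finite (beta_hatE n) beta_hat_a beta_hat_v pG hM.
have nS1 : ~ S1 n G by move=> /S1_not_S1_hat.
rewrite /H asboolF // asboolT //.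
case: xgetP => [j _ hj|/(_ (- (size (rightW G (2 * M)))%:Z))[]]; last first.
  by split => //; rewrite /rightW /=; lia.
have [jL h1 h2] := projN_shiftZ_finite (beta_hatE n) beta_hat_a beta_hat_v (alpha n) pG hM hj.
exists (size (rightW G (2 * M))), (2 * M)%N; split => //.
- by rewrite jL.
- by move=> N /cst->.
Qed.

Lemma W_S2 G N : is_path n G -> (forall i, (N <= i)%N -> G i = G_alpha n i) ->
  W n G = shiftZ (size (leftU n G N))%:Z (eps_alpha n).
Proof.
move=> pG hN.
have cstU k : (N <= k)%N -> leftU n G k = leftU n G N.
  move=> /subnKC <-; elim: (k - N)%N => [|d IH]; first by rewrite addn0.
  by rewrite addnS /= (hN (N + d)%N) ?leq_addr // LambdaK_nil /= IH.
set J := size (leftU n G N).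
have splitK k : (N <= k)%N ->
    LambdaK n k [:: L3] = leftU n G N ++ rightW G k.
  move=> Nk; have := path_split (path_uptoW (N := k) pG).
  by rewrite hN // cstU.
have alphan k i : (N <= k)%N -> (i < size (LambdaK n k [:: L3]))%N ->
    alpha n i = nth L1 (leftU n G N ++ rightW G k) i.
  by move=> Nk ik; rewrite -splitK // -alphaE nth_mkseq.
apply/funext => -[p|q]; rewrite /shiftZ.
- have -> : p%:Z + J%:Z = (p + J)%N%:Z by lia.
  pose k := (N + p + J)%N.
  have pk : (p + J < size (LambdaK n k [:: L3]))%N.
    by apply: leq_trans (size_LambdaK3 n_pos k); rewrite /k; lia.
  have Nk : (N <= k)%N by rewrite /k; lia.
  rewrite (@W_rightE _ k); last by move: pk; rewrite splitK // size_cat -/J; lia.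
  rewrite /= (alphan k) // nth_cat -/J ifF; last lia.
  by rewrite addnK.
- have [qJ|Jq] := ltnP q J.
    have -> : Negz q + J%:Z = (J - q.+1)%N%:Z by lia.
    rewrite (@W_leftE _ N) //= (alphan N) //; last first.
      by rewrite splitK // size_cat -/J; lia.
    by rewrite nth_rev // nth_cat -/J ifT //; lia.
  have -> : Negz q + J%:Z = Negz (q - J) by lia.
  rewrite W_left lim_word_None // => k; rewrite size_rev.
  apply: leq_trans (size_leftU_mono G (leq_addl N k)) _.
  by rewrite cstU // leq_addr.
Qed.

Lemma H_S2 G : S2 n G -> exists J : nat,
  [/\ H n G = shiftN J (alpha n), (forall i : nat, W n G i%:Z = Some (H n G i))
    & exists M, forall N, (M <= N)%N -> size (leftU n G N) = J].
Proof.
move=> SG; have [pG [N hN]] := SG.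
have WG := W_S2 pG hN; set J := size (leftU n G N) in WG.
have nS1 : ~ S1 n G by move=> /S1_not_S2.
have nS1h : ~ S1_hat n G by move=> /S1_hat_not_S2.
exists J; rewrite /H asboolF // asboolF // asboolT //.
case: xgetP => [j _ [j0 Wj]|/(_ J%:Z)[]]; last by split.
case: j j0 Wj => // j _ Wj; have E (i : nat) : W n G i%:Z = Some (alpha n (i + j)%N).
  by rewrite Wj.
split => //.
- apply/funext => i; have := E i; rewrite WG => -[h]; symmetry.
  exact: h.
- exists N => k /subnKC <-; elim: (k - N)%N => [|d IH]; first by rewrite addn0.
  by rewrite addnS /= (hN (N + d)%N) ?leq_addr // LambdaK_nil /= IH.
Qed.

Lemma edge_v_nil m a u b v : (0 < m)%N -> edge_spec m a u b v -> v = [::] ->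
  (a = L1 /\ b = L2 /\ u = [::])
  \/ [/\ a != L1, b = L1 & u = L3 :: nseq (m + (a == L2)).-1 L1].
Proof.
move=> m0 [|{}a a1|{}a i a1 im] /(congr1 size); rewrite ?size_nseq /=.
- by left.
- lia.
- by move=> h; right; split => //; congr (_ :: nseq _ _); lia.
Qed.

Lemma edge_u_nil m a u b v : edge_spec m a u b v -> u = [::] ->
  (a = L1 /\ b = L2 /\ v = [::])
  \/ [/\ a != L1, b = L3 & v = nseq (m + (a == L2)) L1].
Proof.
by move=> [|{}a a1|{}a i a1 im] // _; [left|right].
Qed.

(** An empty v says that a letter is the last one in the image of the letter above it. This excludes
    3, which n_k > 0 makes a 1 follow; hence 1 and 2 alternate, and the parity of the levels
    carrying 1 separates the two classes. *)
Lemma finite_right G : is_path n G ->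
  (exists K, forall k, (K <= k)%N -> edge_v (G k) = [::]) ->
  S1 n G \/ S1_hat n G.
Proof.
move=> pG [K hK].
have E k : (K <= k)%N ->
    (edge_a (G k.+1) = L1 /\ G k = ([::], L2, [::]))
    \/ (edge_a (G k.+1) != L1 /\ G k = (L3 :: nseq (n k.+1) L1, L1, [::])).
  move=> Kk; have /edge_v_nil := path_edge k pG.
  case=> [||[-> [a2 u0]]|[h1 a1 u]]; [exact: n_pos|exact: hK| |].
    by left; split => //; rewrite [G k]edge_eta u0 a2 hK.
  right; split => //; rewrite [G k]edge_eta u a1 hK //.
  case: (edge_a _ =P L2) => [_|/eqP h2]; first by rewrite addn1.
  have /edge_v_nil := path_edge k.+1 pG.
  case=> [||[_ [a2 _]]|[_ a1' _]]; [exact: n_pos|exact/hK/leqW| |].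
    by rewrite a2 in h2.
  by rewrite a1' in h1.
have step k : (K <= k)%N -> edge_a (G k.+1) = if edge_a (G k) == L1 then L2 else L1.
  move=> Kk; case: (E k Kk) => -[h ->] /=; first by rewrite h.
  by case: (E k.+1 (leqW Kk)) h => -[_ ->].
have par i : edge_a (G (2 * K + i)%N) =
    if odd i (+) (edge_a (G (2 * K)) == L1) then L1 else L2.
  elim: i => [|i IH].
    rewrite addn0 /=.
    have KK : (K <= 2 * K)%N by lia.
    by case: (E _ KK) => -[_ ->].
  rewrite addnS step; last lia.
  by rewrite IH /=; case: (odd i); case: (edge_a (G (2 * K)) == L1).
have Ga k : (K <= k)%N ->
    G k = if edge_a (G k) == L1 then (L3 :: nseq (n k.+1) L1, L1, [::]) else ([::], L2, [::]).
  by move=> Kk; case: (E k Kk) => -[_ ->].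
have [a1|a1] := boolP (edge_a (G (2 * K)) == L1).
- left; split => //; exists (2 * K)%N => i Ki; rewrite Ga; last lia.
  move: (par (i - 2 * K)%N); rewrite subnKC // a1 => ->.
  rewrite /G_beta oddB // oddM /=.
  by case: (odd i).
- right; split => //; exists (2 * K)%N => i Ki; rewrite Ga; last lia.
  move: (par (i - 2 * K)%N); rewrite subnKC // (negbTE a1) => ->.
  rewrite /G_beta_hat oddB // oddM /=.
  by case: (odd i).
Qed.

Lemma unbounded_right G K : is_path n G -> ~ S1 n G -> ~ S1_hat n G ->
  exists N, (K < size (rightW G N))%N.
Proof.
move=> pG nS1 nS1h; elim: K => [|K [N IH]]; first by exists 0%N.
have [k [Nk vk]] : exists k, (N <= k)%N /\ edge_v (G k) <> [::].
  apply: contrapT => h; case: (finite_right pG) => //; exists N => k Nk.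
  by apply: contrapT => vk; apply: h; exists k.
exists k.+1; rewrite /rightW /= size_cat -/(rightW G k).
have := size_rightW_mono G Nk; have := size_LambdaK n k (edge_v (G k)).
by case: (edge_v (G k)) vk => //= a v _; rewrite /rightW /=; move: IH; rewrite /rightW /=; lia.
Qed.

(** An empty u says that a letter is the first one in the image of the letter above it. The letter 1
    is never first, and 2 is first only below 1; so eventually only 3 remains. *)
Lemma finite_left G : is_path n G ->
  (exists K, forall k, (K <= k)%N -> edge_u (G k) = [::]) -> S2 n G.
Proof.
move=> pG [K hK]; split => //; exists K.
have a23 k : (K <= k)%N -> edge_a (G k) != L1.
  by move=> Kk; have /edge_u_nil[|[_ [->]]|[_ ->]] := path_edge k pG; first exact: hK.
move=> k Kk; rewrite [G k]edge_eta /G_alpha.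
have /edge_u_nil[|[a1 _]|[_ -> ->]] := path_edge k pG; first exact: hK.
  by have := a23 _ (leqW Kk); rewrite a1.
congr (_, _, nseq _ _); first exact: hK.
have /edge_u_nil[|[a1 _]|[_ -> _]] := path_edge k.+1 pG; first exact/hK/leqW.
  by have := a23 _ (leqW (leqW Kk)); rewrite a1.
by rewrite addn0.
Qed.

Lemma unbounded_left G K : is_path n G -> ~ S2 n G ->
  exists N, (K < size (leftU n G N))%N.
Proof.
move=> pG nS2; have H k : exists j, (k <= j)%N /\ edge_u (G j) <> [::].
  apply: contrapT => h; apply: nS2; apply: finite_left => //; exists k => j kj.
  by apply: contrapT => uj; apply: h; exists j.
have step N : exists M, (size (leftU n G N) < size (leftU n G M))%N.
  have [k [Nk uk]] := H N; exists k.+1; rewrite /= size_cat.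
  have := size_leftU_mono G Nk; have := size_LambdaK n k (edge_u (G k)).
  by case: (edge_u (G k)) uk => //= a v _; lia.
elim: K => [|K [N IH]].
  by have [M] := step 0%N; exists M; lia.
by have [M] := step N; exists M; lia.
Qed.

Lemma H_prefix G N : is_path n G ->
  mkseq (H n G) (size (rightW G N)) = rightW G N.
Proof.
move=> pG; have [SG|nS1] := pselect (S1 n G).
  by have [L [M []]] := H_S1 SG.
have [SG|nS1h] := pselect (S1_hat n G).
  by have [L [M []]] := H_S1_hat SG.
apply: mkseq_rightW => i _.
have [SG|nS2] := pselect (S2 n G).
  by have [J []] := H_S2 SG.
rewrite /H !asboolF // /projN /fill.
have [K iK] := unbounded_right i pG nS1 nS1h.
by rewrite (W_rightE iK).
Qed.

Lemma H0 G : is_path n G -> H n G 0%N = edge_a (G 0%N).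
Proof. by move=> /(H_prefix 0) []. Qed.

Lemma splice_size_leftU G N j : is_path n G ->
    (j < size (LambdaK n N [:: edge_a (G N)]))%N ->
  exists G', [/\ is_path n G', forall i, (N <= i)%N -> G' i = G i
                & size (leftU n G' N) = j].
Proof.
move=> pG /address[G' [h1 h2 h3]]; exists G'; split => //.
exact: splice_path pG h1 h2.
Qed.

(** The marked letter of [G_alpha] is moved to position [j] inside the image of 3 at level [j],
    which has more than [j] letters. *)
Lemma S2_shift_alpha j : exists2 G, S2 n G & H n G = shiftN j (alpha n).
Proof.
have [G [pG hG sG]] := splice_size_leftU G_alpha_path (size_LambdaK3 n_pos j).
have SG : S2 n G by split => //; exists j.
exists G => //; have [J [-> _ [M hM]]] := H_S2 SG.
suff -> : J = j by [].
rewrite -[J](hM (j + M)%N) ?leq_addl // -{2}sG.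
elim: M {hM} => [|d IH]; first by rewrite addn0.
by rewrite addnS /= (hG (j + d)%N) ?leq_addr // LambdaK_nil.
Qed.

End RepresentedSequences.

(** * Weights, bounds on tails, and the value of a sequence *)

Section Values.
Context (R : realType) (n : nat -> nat) (g : letter -> R).
Hypothesis n_pos : forall k : nat, (0 < k)%N -> (0 < n k)%N.

Definition wsum (w : word) : R := \sum_(a <- w) g a.
Definition pp k := - wsum (LambdaK n k [:: L1]).
Definition qq k := - wsum (LambdaK n k [:: L2]).
Definition rr k := wsum (LambdaK n k [:: L3]).

Lemma wsum_cat w w' : wsum (w ++ w') = wsum w + wsum w'.
Proof. by rewrite /wsum big_cat. Qed.

Lemma wsum_nil : wsum [::] = 0.
Proof. by rewrite /wsum big_nil. Qed.

Lemma wsum_nseq k i : wsum (LambdaK n k (nseq i L1)) = - (pp k *+ i).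
Proof.
elim: i => [|i IH]; first by rewrite LambdaK_nil wsum_nil mulr0n oppr0.
by rewrite /= LambdaK_cons wsum_cat IH mulrS opprD opprK.
Qed.

Lemma wsum_3nseq k i : wsum (LambdaK n k (L3 :: nseq i L1)) = rr k - pp k *+ i.
Proof. by rewrite LambdaK_cons wsum_cat wsum_nseq. Qed.

Lemma qqE k : qq k = pp k.+1.
Proof. by rewrite /qq /pp /= Lambda_letter. Qed.

Lemma rrE k : rr k = pp k *+ n k.+1 + rr k.+1.
Proof.
by rewrite {2}/rr /= Lambda_letter /= wsum_3nseq addn0 addrC subrK.
Qed.

Lemma ppE k : pp k = qq k.+1 + rr k.+1.
Proof.
rewrite {1}/qq /= Lambda_letter /= wsum_3nseq rrE addn1 mulrS.
lra.
Qed.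

Hypothesis pp_gt0 : forall k, 0 < pp k.
Hypothesis qq_gt0 : forall k, 0 < qq k.
Hypothesis rr_gt0 : forall k, 0 < rr k.

Lemma pp_muln_ge k i j : (i <= j)%N -> pp k *+ i <= pp k *+ j.
Proof. by move=> ij; rewrite ler_wpMn2l // ltW. Qed.

Lemma pp_muln_ge1 k i : (0 < i)%N -> pp k <= pp k *+ i.
Proof. exact: (@pp_muln_ge k 1). Qed.

Lemma pp_le_rr k : pp k + rr k.+1 <= rr k.
Proof. by rewrite [X in _ <= X]rrE lerD2r; exact/pp_muln_ge1/n_pos. Qed.

Lemma qq_lt_pp k : qq k < pp k.
Proof.
have := ppE k; have := ppE k.+1; have := qqE k; have := qqE k.+1.
have := rr_gt0 k.+1; have := pp_le_rr k.+1; have := rr_gt0 k.+2.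
by have := qq_gt0 k.+1; lra.
Qed.

(** From r_k >= p_k + r_{k+1}, where n_{k+1} >= 1 enters, and p_k >= r_{k+1}. *)
Lemma rr_half k : rr k.+1 <= rr k / 2.
Proof.
have := pp_le_rr k; have := ppE k; have := qq_gt0 k.+1; have := rr_gt0 k.+1.
lra.
Qed.

Lemma rr_decr k l : (k <= l)%N -> rr l <= rr k.
Proof.
move=> /subnKC <-; elim: (l - k)%N => [|d IH]; first by rewrite addn0.
by rewrite addnS; have := rr_half (k + d); have := rr_gt0 (k + d); lra.
Qed.

Lemma rr_small e : 0 < e -> exists N, forall k, (N <= k)%N -> rr k < e.
Proof.
move=> e0; suff [N hN] : exists N, rr N < e.
  by exists N => k /rr_decr/le_lt_trans; apply.
have rrk k : rr k * (k.+1)%:R <= rr 0.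
  elim: k => [|k IH]; first by rewrite mulr1.
  apply: le_trans IH; rewrite -[k.+2%:R]natr1.
  have := rr_half k; have := rr_gt0 k.
  have k1 : 1 <= (k.+1)%:R :> R by rewrite ler1n.
  have := rr_gt0 k.+1; nra.
pose N := (Num.truncn (rr 0 / e)).
exists N; have := rrk N; have N1 : rr 0 / e < (N.+1)%:R.
  by rewrite truncnS_gt // divr_ge0 ?ltW // -/(rr 0).
have N0 : 0 < (N.+1)%:R :> R by [].
move: N1; rewrite ltr_pdivrMr // => N1 h.
have : rr N * N.+1%:R < e * N.+1%:R by rewrite (le_lt_trans h) // mulrC.
by rewrite ltr_pM2r.
Qed.

(** Stands in for explicit limits: identities between values are obtained by bounding a difference
    that is constant along the levels by a multiple of r_k. *)
Lemma le0_rr x C : (forall N, exists k, (N <= k)%N /\ x <= C * rr k) -> x <= 0.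
Proof.
move=> h; rewrite leNgt; apply/negP => x0.
have C1 : 0 < `|C| + 1 by rewrite ltr_wpDl.
have [N hN] := rr_small (divr_gt0 x0 C1).
have [k [/hN + xk]] := h N; rewrite ltr_pdivlMr // => rk.
have := ler_norm C; have := rr_gt0 k; nra.
Qed.

(* The extreme values of the tail [Y G k] below over all paths [G] whose letter
   at level [k] is [a]. *)
Definition lo k (a : letter) := if a == L1 then pp k else if a == L2 then qq k else 0.
Definition hi k (a : letter) :=
  if a == L1 then qq k + rr k else if a == L2 then pp k else qq k.

Lemma lo_ge0 k a : 0 <= lo k a.
Proof. by rewrite /lo; case: ifP => _; [exact/ltW|case: ifP => _ //; exact/ltW]. Qed.

Lemma lo_le_pp k a : lo k a <= pp k.
Proof.
by have := qq_lt_pp k; have := pp_gt0 k; rewrite /lo; case: ifP => _ //; case: ifP => _; lra.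
Qed.

Lemma hi_ge0 k a : 0 <= hi k a.
Proof.
have := pp_gt0 k; have := qq_gt0 k; have := rr_gt0 k.
by rewrite /hi; case: ifP => _; [|case: ifP => _]; lra.
Qed.

Lemma hi_le k a : hi k a <= qq k + rr k.
Proof.
have := pp_le_rr k; have := rr_gt0 k.+1; have := qq_gt0 k; have := rr_gt0 k.
by rewrite /hi; case: ifP => _; [|case: ifP => _]; lra.
Qed.

Lemma hi_le_rr k a : hi k a <= 2 * rr k.
Proof.
have := hi_le k a; have := qq_lt_pp k; have := pp_le_rr k; have := rr_gt0 k.+1.
lra.
Qed.

Definition cG (G : nat -> edge) k := wsum (LambdaK n k (edge_u (G k))).

Lemma edge_to2 m a u b v : edge_spec m a u b v -> b = L2 -> a = L1 /\ u = [::].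
Proof. by case. Qed.

Lemma edge_to1 m a u b v : edge_spec m a u b v -> b = L1 ->
  a != L1 /\ exists i, (i < m + (a == L2))%N /\ u = L3 :: nseq i L1.
Proof. by case=> // {}a i a1 im _; split => //; exists i. Qed.

(** One edge turns the bounds at level k + 1 into those at level k, which is the induction step for
    all bounds on tails. The last clause lists the edges that a path of maximal value can follow. *)
Lemma edge_wt k a u b v : edge_spec (n k.+1) a u b v ->
  let c := wsum (LambdaK n k u) in
  [/\ 0 <= c, (u = [::]) \/ 0 < c,
      lo k b <= c + lo k.+1 a, c + hi k.+1 a <= hi k b
    & c + hi k.+1 a = hi k b -> [\/ b = L1 /\ u = [:: L3] /\ a = L2,
       b = L2 /\ a = L1 | b = L3 /\ a = L2]].
Proof.
have := pp_gt0 k; have := qq_gt0 k; have := rr_gt0 k.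
have := pp_gt0 k.+1; have := qq_gt0 k.+1; have := rr_gt0 k.+1.
have := ppE k; have := qqE k; have := qq_lt_pp k; have := qq_lt_pp k.+1.
move=> h1 h2 h3 h4 h5 h6 h7 h8 h9 h10.
case=> [|{}a a1|{}a i a1 im] c.
- have -> : c = 0 by rewrite /c LambdaK_nil wsum_nil.
  rewrite /lo /hi /=; split => //; [by left|lra|lra|].
  by move=> _; constructor 2.
- have -> : c = 0 by rewrite /c LambdaK_nil wsum_nil.
  rewrite /lo /hi /= (negbTE a1); split => //; first by left.
  + by case: ifP => _; lra.
  + by case: ifP => _; lra.
  + by case: eqP => [-> _|_]; [constructor 3|lra].
- have -> : c = rr k - pp k *+ i by rewrite /c wsum_3nseq.
  have rk := rrE k.
  have im' : pp k *+ i + pp k *+ (~~ (a == L2)) <= pp k *+ n k.+1.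
    by rewrite -mulrnDr pp_muln_ge //; move: im; case: (a == L2) => /=; lia.
  rewrite /lo /hi /= (negbTE a1); split.
  + by move: im'; case: (a == L2) => /=; rewrite ?mulr1n ?mulr0n; lra.
  + by right; move: im'; case: (a == L2) => /=; rewrite ?mulr1n ?mulr0n; lra.
  + by move: im'; case: (a == L2) => /=; rewrite ?mulr1n ?mulr0n; lra.
  + have : 0 <= pp k *+ i by rewrite mulrn_wge0 // ltW.
    by case: (a == L2) => /=; lra.
  + case: i {c} im im' => [|i] im im'.
      by case: eqP => [->|_] /=; [constructor 1|rewrite mulr0n; lra].
    have := @pp_muln_ge1 k i.+1 isT.
    by case: (a == L2) => /=; lra.
Qed.

Section OnePath.
Context (G : nat -> edge) (pG : is_path n G).

Lemma wsum_leftU k : wsum (leftU n G k) = \sum_(j < k) cG G j.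
Proof.
by elim: k => [|k IH]; rewrite ?big_ord0 ?wsum_nil // big_ord_recr /= wsum_cat IH addrC.
Qed.

Lemma wsum_leftUS k : wsum (leftU n G k.+1) = wsum (leftU n G k) + cG G k.
Proof. by rewrite /= wsum_cat addrC. Qed.

Lemma cG_ge0 k : 0 <= cG G k.
Proof. by have [] := edge_wt (path_edge k pG). Qed.

(** Induction on [d] by [edge_wt]. The finite sum omits the tail from level k + d on, whose own
    lower bound [lo] is at most p_{k+d}; hence the correction on the left. *)
Lemma partial_bounds k d :
  lo k (edge_a (G k)) - pp (k + d) <= wsum (leftU n G (k + d)) - wsum (leftU n G k)
  <= hi k (edge_a (G k)).
Proof.
elim: d k => [|d IH] k.
  by rewrite addn0 subrr subr_le0 lo_le_pp hi_ge0.
have := IH k.+1; rewrite addSnnS wsum_leftUS.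
have [_ _] := edge_wt (path_edge k pG); rewrite -/(cG G k) => h1 h2 _ /andP[h3 h4].
by apply/andP; split; lra.
Qed.

Definition Psi := limn (series (cG G)).

Lemma seriesE : series (cG G) = (fun k => wsum (leftU n G k)).
Proof. by apply/funext => k; rewrite wsum_leftU /series /= big_mkord. Qed.

Lemma leftU_ndecr : nondecreasing_seq (fun k => wsum (leftU n G k)).
Proof.
apply/nondecreasing_seqP => k; rewrite wsum_leftUS lerDl; exact: cG_ge0.
Qed.

Lemma leftU_cvg : cvgn (fun k => wsum (leftU n G k)).
Proof.
apply: nondecreasing_is_cvgn leftU_ndecr _.
exists (hi 0 (edge_a (G 0%N))) => _ [k _ <-].
by have /andP[_] := partial_bounds 0 k; rewrite wsum_nil subr0.
Qed.

Lemma leftU_le_Psi k : wsum (leftU n G k) <= Psi.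
Proof.
rewrite /Psi seriesE.
exact: (nondecreasing_cvgn_le leftU_ndecr leftU_cvg).
Qed.

Definition Y k := Psi - wsum (leftU n G k).

Lemma Y0 : Y 0 = Psi.
Proof. by rewrite /Y wsum_nil subr0. Qed.

Lemma Y_step k : Y k = cG G k + Y k.+1.
Proof. by rewrite /Y wsum_leftUS; lra. Qed.

Lemma Y_hi k : Y k <= hi k (edge_a (G k)).
Proof.
rewrite /Y lerBlDl /Psi seriesE; apply: limr_le; first exact: leftU_cvg.
near=> N; have kN : (k <= N)%N by near: N; exact: nbhs_infty_ge.
by have := partial_bounds k (N - k)%N; rewrite subnKC // !lerBlDl => /andP[].
Unshelve. all: by end_near. Qed.

Lemma Y_lo k : lo k (edge_a (G k)) <= Y k.
Proof.
rewrite -subr_le0; apply: (@le0_rr _ 1) => N; exists (k + N)%N.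
split; first exact: leq_addl.
have /andP[h _] := partial_bounds k N; have := leftU_le_Psi (k + N).
have := pp_le_rr (k + N); have := rr_gt0 (k + N).+1.
by rewrite /Y; lra.
Qed.

Lemma Y_ge0 k : 0 <= Y k.
Proof. exact: le_trans (lo_ge0 _ _) (Y_lo k). Qed.

Lemma Y_le_rr k : Y k <= 2 * rr k.
Proof. exact: le_trans (Y_hi k) (hi_le_rr _ _). Qed.

Lemma Psi_eq0_leftU : Psi = 0 -> S2 n G /\ forall k, leftU n G k = [::].
Proof.
move=> P0; have u0 k : edge_u (G k) = [::].
  have [_ [//|c0] _ _ _] := edge_wt (path_edge k pG).
  have := Y_ge0 k.+1; have := leftU_le_Psi k.+1; rewrite wsum_leftUS P0.
  have : 0 <= wsum (leftU n G k).
    by have := leftU_ndecr (leq0n k); rewrite wsum_nil.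
  by move: c0; rewrite -/(cG G k) => c0 p0 h1 h2; exfalso; lra.
split; first by apply: (finite_left pG); exists 0%N.
by elim=> //= k ->; rewrite u0 LambdaK_nil.
Qed.

Lemma Psi_eq0_H : Psi = 0 -> H n G = alpha n.
Proof.
move=> /Psi_eq0_leftU[SG U0]; have [J [-> _ [M hM]]] := H_S2 n_pos SG.
rewrite -(hM M) // U0 /=; apply/funext => i; by rewrite /shiftN addn0.
Qed.

(* Along a path maximizing Psi among those with the same first letter, the gap
   [hi - Y] is nonincreasing and starts at 0. *)
Lemma max_path_tail : Psi = hi 0 (edge_a (G 0%N)) ->
  forall K, exists k, [/\ (K <= k)%N, edge_u (G k) = [:: L3] & edge_a (G k) = L1].
Proof.
move=> PE.
have Ymax k : Y k = hi k (edge_a (G k)).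
  elim: k => [|k IH]; first by rewrite Y0.
  have [_ _ _ h _] := edge_wt (path_edge k pG).
  have := Y_step k; have := Y_hi k.+1; move: h; rewrite -/(cG G k); lra.
have st k : [\/ edge_a (G k) = L1 /\ edge_u (G k) = [:: L3] /\ edge_a (G k.+1) = L2,
   edge_a (G k) = L2 /\ edge_a (G k.+1) = L1 |
   edge_a (G k) = L3 /\ edge_a (G k.+1) = L2].
  have [_ _ _ _] := edge_wt (path_edge k pG); apply.
  by rewrite -!Ymax -/(cG G k) -Y_step.
have a1u k : edge_a (G k) = L1 -> edge_u (G k) = [:: L3].
  by case: (st k) => [[_ [//]]|[-> //]|[-> //]].
move=> K; case: (st K) => [[h [u _]]|[_ h]|[_ h]].
- by exists K.
- by exists K.+1; split => //; exact: a1u.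
- have h2 : edge_a (G K.+2) = L1.
    by case: (st K.+1); rewrite h => -[] // _ [].
  by exists K.+2; split; rewrite ?a1u // ltnW.
Qed.

(** A maximal path has edges with marked letter 1 and u = 3 at arbitrarily high levels. In [G_beta]
    and [G_beta_hat] the letter 1 comes with u = 3 1^n, n > 0, and in [G_alpha] it does not
    occur. *)
Lemma max_path_not : Psi = hi 0 (edge_a (G 0%N)) ->
  [/\ ~ S1 n G, ~ S1_hat n G & ~ S2 n G].
Proof.
move=> /max_path_tail h; split=> -[_ [K hK]].
- have [k [/hK -> ]] := h K; rewrite /G_beta; case: odd => //=.
  by have := n_pos (ltn0Sn k); case: (n k.+1).
- have [k [/hK -> ]] := h K; rewrite /G_beta_hat; case: odd => //=.
  by have := n_pos (ltn0Sn k); case: (n k.+1).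
- by have [k [/hK -> ]] := h K.
Qed.

(** Under this hypothesis the gap [hi - Y] is the same at all levels, while it is at most 2 r_k at
    level k. *)
Lemma step_max_Psi :
  (forall k, cG G k + hi k.+1 (edge_a (G k.+1)) = hi k (edge_a (G k))) ->
  Psi = hi 0 (edge_a (G 0%N)).
Proof.
move=> st; apply: le_anti; rewrite -{1}Y0 Y_hi /= -subr_le0.
have gap k : hi 0 (edge_a (G 0%N)) - Psi = hi k (edge_a (G k)) - Y k.
  elim: k => [|k ->]; first by rewrite Y0.
  by have := st k; have := Y_step k; lra.
apply: (@le0_rr _ 2) => N; exists N; split => //; rewrite (gap N).
by have := Y_ge0 N; have := hi_le_rr N (edge_a (G N)); lra.
Qed.

Lemma step_min_Y M :
  (forall k, (M <= k)%N -> cG G k + lo k.+1 (edge_a (G k.+1)) = lo k (edge_a (G k))) ->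
  Y M = lo M (edge_a (G M)).
Proof.
move=> st; apply: le_anti; rewrite Y_lo andbT -subr_le0.
have gap d : Y M - lo M (edge_a (G M)) = Y (M + d) - lo (M + d) (edge_a (G (M + d)%N)).
  elim: d => [|d ->]; first by rewrite addn0.
  by have := st (M + d)%N (leq_addr _ _); have := Y_step (M + d); rewrite -addnS; lra.
apply: (@le0_rr _ 2) => N; exists (M + N)%N; split; first exact: leq_addl.
rewrite (gap N).
by have := Y_le_rr (M + N); have := lo_ge0 (M + N) (edge_a (G (M + N)%N)); lra.
Qed.

End OnePath.

Definition wt k a := wsum (LambdaK n k [:: a]).

Lemma wt_le k a : wt k a <= rr k.
Proof.
have := pp_gt0 k; have := qq_gt0 k; have := rr_gt0 k.
by case: (letterP a) => ->; rewrite /wt /pp /qq /rr; lra.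
Qed.

Lemma wt_ge k a : - pp k <= wt k a.
Proof.
have := pp_gt0 k; have := qq_lt_pp k; have := rr_gt0 k.
by case: (letterP a) => ->; rewrite /wt /pp /qq /rr; lra.
Qed.

(** Along the image of a letter the lowest partial sum occurs at the end for 1 and 2, and is at
    least 0 for 3. By induction: a proper prefix consists of complete images of letters and a prefix
    of one more image, and the running weights over the word of level k go up by r_k first and then
    down in steps p_k. *)
Lemma prefix_LambdaK k a w : prefix w (LambdaK n k [:: a]) ->
  (if a == L3 then 0 else wt k a) <= wsum w.
Proof.
elim: k a w => [|k IH] a w.
  case: w => [|b [|]] /=.
  - move=> _; rewrite wsum_nil; case: ifP => // a3; have := pp_gt0 0; have := qq_gt0 0.
    by case: (letterP a) a3 => -> //; rewrite /wt /pp /qq /=; lra.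
  - rewrite andbT => /eqP ->; case: eqP => [->|//]; exact/ltW/(rr_gt0 0).
  - by move=> c w; rewrite andbF.
move=> /prefixP[t].
have [/[dup] wS|] := ltnP (size w) (size (LambdaK n k.+1 [:: a])); last first.
  move=> sw E; have t0 : t = [::].
    by move/(congr1 size): E sw; rewrite size_cat; case: t => //= *; lia.
  rewrite t0 cats0 in E; rewrite -E -/(wt k.+1 a).
  by case: eqP => [->|//]; exact/ltW/(rr_gt0 k.+1).
rewrite {1}[LambdaK _ _ _]/= => /LambdaK_block[u [b [v [E /andP[uw wb]]]]].
rewrite [LambdaK _ _ _]/= E -cat1s !LambdaK_cat => Ew.
have Eu : w = LambdaK n k u ++ drop (size (LambdaK n k u)) w.
  rewrite -{1}(cat_take_drop (size (LambdaK n k u)) w); congr (_ ++ _).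
  move: (congr1 (take (size (LambdaK n k u))) Ew).
  by rewrite (takel_cat t uw) take_size_cat // => <-.
set w' := drop _ w in Eu.
have pw' : prefix w' (LambdaK n k [:: b]).
  rewrite Eu -catA in Ew; move/eqP: Ew; rewrite eqseq_cat // eqxx /= => /eqP Ew.
  have sw' : (size w' <= size (LambdaK n k [:: b]))%N by rewrite size_drop; lia.
  apply/prefixP; exists (take (size (LambdaK n k [:: b]) - size w') t).
  move: (congr1 (take (size (LambdaK n k [:: b]))) Ew).
  by rewrite take_size_cat // take_cat ltnNge sw'.
have := IH _ _ pw'; rewrite Eu wsum_cat.
have := pp_gt0 k.+1; have := qq_gt0 k.+1; have := rr_gt0 k.+1.
have := ppE k; have := qqE k; have := rrE k.
have w1 j : wt j L1 = - pp j by rewrite /pp opprK.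
have w2 j : wt j L2 = - qq j by rewrite /qq opprK.
have := edgeP E; case=> [|{}a' a1|{}a' i a1 im].
- by rewrite LambdaK_nil wsum_nil /= w1 w2; lra.
- rewrite LambdaK_nil wsum_nil /=; case: (letterP a') a1 => -> //=; rewrite ?w2; lra.
- rewrite wsum_3nseq /= w1.
  have im' : pp k *+ i + pp k *+ 1 <= pp k *+ n k.+1 + pp k *+ (a' == L2).
    by rewrite -!mulrnDr pp_muln_ge //; lia.
  move: im'; case: (letterP a') a1 => -> //= _; rewrite ?mulr1n ?mulr0n ?w2; lra.
Qed.

Lemma prefix_LambdaK_ge k a w : prefix w (LambdaK n k [:: a]) -> - pp k <= wsum w.
Proof.
move=> /prefix_LambdaK; apply: le_trans; case: ifP => _; last exact: wt_ge.
by rewrite oppr_le0 ltW.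
Qed.

(* The value of [s]: the partial sums of the weights along [s], started at [x],
   stay nonnegative and have lower limit 0. *)
Definition Val (s : nat -> letter) (x : R) : Prop :=
  (forall k, 0 <= x + wsum (mkseq s k)) /\
  forall e K, 0 < e -> exists k, (K <= k)%N /\ x + wsum (mkseq s k) < e.

(** If x > y, all sums started at x are at least x - y > 0, because those started at y are
    nonnegative; their lower limit is then not 0. *)
Lemma Val_le s x y : Val s x -> Val s y -> x <= y.
Proof.
move=> [_ hx] [hy _]; rewrite leNgt; apply/negP => yx.
have d0 : 0 < x - y by rewrite subr_gt0.
by have [k [_]] := hx _ 0%N d0; have := hy k; lra.
Qed.

Lemma Val_uniq s x y : Val s x -> Val s y -> x = y.
Proof. by move=> hx hy; apply: le_anti; rewrite !(Val_le (s := s)). Qed.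

Lemma mkseqD_shift (s : nat -> letter) i k :
  mkseq s (i + k) = mkseq s i ++ mkseq (fun j => s (i + j)%N) k.
Proof. by rewrite /mkseq iotaD map_cat add0n -{2}[i]addn0 iotaDl -map_comp. Qed.

Lemma Val_shift s x i : Val s x ->
  Val (fun j => s (i + j)%N) (x + wsum (mkseq s i)).
Proof.
move=> [h1 h2]; split.
  by move=> k; rewrite -addrA -wsum_cat -mkseqD_shift.
move=> e K e0; have [k [Kk hk]] := h2 e (i + K)%N e0.
exists (k - i)%N; split; first lia.
by rewrite -addrA -wsum_cat -mkseqD_shift subnKC //; lia.
Qed.

Lemma Val_alpha : Val (alpha n) 0.
Proof.
split=> [k|e K e0].
  rewrite add0r.
  have pk : prefix (mkseq (alpha n) k) (LambdaK n k [:: L3]).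
    have sk := ltnW (size_LambdaK3 n_pos k).
    rewrite -(alphaE n) -(take_mkseq _ sk); exact: prefix_take.
  by have := prefix_LambdaK pk.
have [N hN] := rr_small e0; exists (size (LambdaK n (N + K) [:: L3])); split.
  by have := size_LambdaK3 n_pos (N + K); lia.
by rewrite add0r alphaE; apply: hN; rewrite leq_addr.
Qed.

Lemma Y_tail_le G G' N : is_path n G -> is_path n G' ->
  (forall k, (N <= k)%N -> G k = G' k) -> Y G N <= Y G' N.
Proof.
move=> pG pG' E; rewrite -subr_le0; apply: (@le0_rr _ 2) => M; exists (N + M)%N.
split; first exact: leq_addl.
have -> : Y G N - Y G' N = Y G (N + M) - Y G' (N + M).
  elim: M => [|M ->]; first by rewrite addn0.
  by rewrite addnS Y_step [Y G' (N + M)]Y_step /cG E ?leq_addr //; lra.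
by have := Y_le_rr pG (N + M); have := Y_ge0 pG' (N + M); lra.
Qed.

Section ValPath.
Context (G : nat -> edge) (pG : is_path n G).
Let s := H n G.

Lemma wsum_path N : wsum (leftU n G N) + wsum (rightW n G N) = wt N (edge_a (G N)).
Proof. by rewrite -wsum_cat -(path_split (path_uptoW (N := N) pG)). Qed.

(** Psi is the weight of the left half at stage N plus the tail [Y G N], and the two halves together
    weigh as much as the image of a_N. So the sum equals the tail plus one weight of level N, both
    of order r_N. *)
Lemma Psi_prefix_lt N : `|Psi G + wsum (rightW n G N)| <= 3 * rr N.
Proof.
have E : Psi G + wsum (rightW n G N) = Y G N + wt N (edge_a (G N)).
  by have := wsum_path N; rewrite /Y; lra.
have := Y_ge0 pG N; have := Y_le_rr pG N; have := wt_le N (edge_a (G N)).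
have := wt_ge N (edge_a (G N)); have := pp_le_rr N; have := rr_gt0 N.+1; have := rr_gt0 N.
by rewrite E ler_norml => *; apply/andP; split; lra.
Qed.

(** Put after the left half, the prefix gives a prefix of the image of a_N, to which
    [prefix_LambdaK_ge] applies; the left half weighs at most Psi. *)
Lemma Psi_mkseq_ge N k : (k <= size (rightW n G N))%N ->
  - rr N <= Psi G + wsum (mkseq s k).
Proof.
move=> kN; have := leftU_le_Psi pG N.
have : - pp N <= wsum (leftU n G N ++ mkseq s k).
  apply: (@prefix_LambdaK_ge N (edge_a (G N))).
  rewrite (path_split (path_uptoW (N := N) pG)) -/(rightW n G N).
  rewrite -(H_prefix n_pos N pG) -(take_mkseq _ kN) -{2}(cat_take_drop k (mkseq _ _)).
  by rewrite catA prefix_prefix.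
rewrite wsum_cat; have := pp_le_rr N; have := rr_gt0 N.+1; lra.
Qed.

Lemma Psi_mkseq_ge0 k :
  (forall M, exists N, (M <= N)%N /\ (k <= size (rightW n G N))%N) ->
  0 <= Psi G + wsum (mkseq s k).
Proof.
move=> h; rewrite -oppr_le0; apply: (@le0_rr _ 1) => M.
have [N [MN kN]] := h M; exists N; split => //.
by have := Psi_mkseq_ge kN; lra.
Qed.

Lemma Val_H_infinite : ~ S1 n G -> ~ S1_hat n G -> Val s (Psi G).
Proof.
move=> nS1 nS1h; split=> [k|e K e0].
  apply: Psi_mkseq_ge0 => M.
  have [N kN] := unbounded_right n_pos k pG nS1 nS1h.
  exists (maxn M N); rewrite leq_maxl; split => //.
  exact: leq_trans (ltnW kN) (size_rightW_mono _ _ (leq_maxr _ _)).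
have [N0 KN] := unbounded_right n_pos K pG nS1 nS1h.
have e3 : 0 < e / 3 by rewrite divr_gt0.
have [N hN] := rr_small e3; set N1 := maxn N N0.
exists (size (rightW n G N1)); split.
  exact: leq_trans (ltnW KN) (size_rightW_mono _ _ (leq_maxr _ _)).
rewrite H_prefix //; apply: le_lt_trans (ler_norm _) _.
apply: le_lt_trans (Psi_prefix_lt _) _.
by have := hN N1 (leq_maxl _ _); lra.
Qed.

(** The finite word is the stage N word for all large N, so by [Psi_prefix_lt] the sum over it is
    exactly 0; from there on the sums are those of alpha started at 0. *)
Lemma Val_H_finite L M : (forall N, (M <= N)%N -> size (rightW n G N) = L) ->
  (forall i, s (i + L)%N = alpha n i) -> Val s (Psi G).
Proof.
move=> hL hs.
have sL : Psi G + wsum (mkseq s L) = 0.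
  apply/eqP; rewrite -normr_le0; apply: (@le0_rr _ 3) => N; exists (M + N)%N.
  split; first exact: leq_addl.
  by rewrite -(hL (M + N)%N) ?leq_addr // H_prefix // Psi_prefix_lt.
have sLk k : Psi G + wsum (mkseq s (L + k)) = wsum (mkseq (alpha n) k).
  rewrite mkseqD_shift wsum_cat addrA sL add0r; congr (wsum _).
  by apply: eq_mkseq => i; rewrite addnC hs.
have [a1 a2] := Val_alpha; split=> [k|e K e0].
  have [kL|/ltnW Lk] := leqP k L.
    apply: Psi_mkseq_ge0 => K; exists (M + K)%N; split; first exact: leq_addl.
    by rewrite hL // leq_addr.
  by rewrite -(subnKC Lk) sLk; have := a1 (k - L)%N; rewrite add0r.
have [k [Kk hk]] := a2 e K e0.
exists (L + k)%N; split; first by rewrite (leq_trans Kk) // leq_addl.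
by rewrite sLk -[wsum _]add0r.
Qed.

Lemma Val_H : Val s (Psi G).
Proof.
have [SG|nS1] := pselect (S1 n G).
  by have [L [M [_ _ hL _ hs]]] := H_S1 n_pos SG; exact: Val_H_finite hL hs.
have [SG|nS1h] := pselect (S1_hat n G).
  by have [L [M [_ _ hL _ hs]]] := H_S1_hat n_pos SG; exact: Val_H_finite hL hs.
exact: Val_H_infinite.
Qed.

End ValPath.

(** The sum over the stage N word brings Psi G to within 3 r_N of 0, while the same sum started at
    Psi G' is nonnegative. The length [K] bounds that word for all paths at once. *)
Lemma Psi_continuous e : 0 < e -> exists K, forall G G',
  is_path n G -> is_path n G' -> mkseq (H n G) K = mkseq (H n G') K ->
  Psi G - Psi G' < e.
Proof.
move=> e0; have e3 : 0 < e / 3 by rewrite divr_gt0.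
have [N hN] := rr_small e3.
exists (\max_(a : letter) size (LambdaK n N [:: a])) => G G' pG pG' E.
have sN : (size (rightW n G N) <= \max_(a : letter) size (LambdaK n N [:: a]))%N.
  apply: leq_trans (leq_bigmax (edge_a (G N))).
  by rewrite (path_split (path_uptoW (N := N) pG)) size_cat leq_addl.
have := Psi_prefix_lt pG N; have [/(_ (size (rightW n G N))) + _] := Val_H pG'.
rewrite -(take_mkseq (H n G') sN) -E take_mkseq // H_prefix //.
have := hN N (leqnn _); rewrite ler_norml => h1 h2 /andP[h3 h4]; lra.
Qed.

(** If alpha reappeared after i letters, moving the marked letter i places to the right inside the
    image of a_N would give a path with the same tail and value 0. Such a path has empty left
    halves, but this one has at least i letters on the left. *)
Lemma no_return G i : is_path n G -> ~ S1 n G -> ~ S1_hat n G -> (0 < i)%N ->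
  ~ (forall j, H n G (i + j)%N = alpha n j).
Proof.
move=> pG nS1 nS1h i0 hi.
have z : Psi G + wsum (mkseq (H n G) i) = 0.
  apply: (Val_uniq (s := alpha n)); last exact: Val_alpha.
  have -> : alpha n = fun j => H n G (i + j)%N by apply/funext => j; rewrite hi.
  exact/Val_shift/Val_H.
have [N iN] := unbounded_right n_pos i pG nS1 nS1h.
have sp := path_split (path_uptoW (N := N) pG).
have [|G' [pG' G'G sG']] := @splice_size_leftU n G N (size (leftU n G N) + i)%N pG.
  by rewrite sp size_cat ltn_add2l.
have aN : edge_a (G' N) = edge_a (G N) by rewrite G'G.
have UE : leftU n G' N = leftU n G N ++ mkseq (H n G) i.
  have sp' := path_split (path_uptoW (N := N) pG').
  have -> : leftU n G' N = take (size (leftU n G N) + i)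
      (leftU n G' N ++ edge_a (G' 0%N) :: rightV n G' N).
    by rewrite take_size_cat.
  rewrite -sp' aN sp -/(rightW n G N) take_cat ltnNge leq_addr /= addKn -(H_prefix n_pos N pG).
  by rewrite take_mkseq // ltnW.
have YE : Y G' N = Y G N.
  by apply: le_anti; rewrite !Y_tail_le // => k /G'G.
have P0 : Psi G' = 0.
  by move: YE z; rewrite /Y UE wsum_cat; lra.
have [_ /(_ N) U0] := Psi_eq0_leftU pG' P0.
by move: sG'; rewrite U0 /=; lia.
Qed.

(* Two points of the minimal set with the same image [y] under the translation
   map, one leaving from the letter 1 and one from the letter 2, give such a
   pair at every level, so that [y] is at most [pp k] for all [k]. *)
Lemma two_preimages y : 0 <= y ->
    (exists G G', [/\ is_path n G /\ is_path n G',
       edge_a (G 0%N) = L1 /\ edge_a (G' 0%N) = L2,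
       Y G 0 = y + pp 0 & Y G' 0 = y + qq 0]) ->
  y = 0.
Proof.
move=> y0 [G1 [G2 [[p1 p2] [a1 a2] Y1 Y2]]].
have key k : (exists G G', [/\ is_path n G /\ is_path n G',
       edge_a (G k) = L1 /\ edge_a (G' k) = L2,
       Y G k = y + pp k & Y G' k = y + qq k]) .
  elim: k => [|k [G [G' [[p p'] [a a'] E E']]]]; first by exists G1, G2.
  have [b' u'] := edge_to2 (path_edge k p') a'.
  have [b [i [im u]]] := edge_to1 (path_edge k p) a.
  have EY' : Y G' k.+1 = y + pp k.+1.
    by have := Y_step G' k; rewrite E' /cG u' LambdaK_nil wsum_nil qqE; lra.
  have yle : y <= pp k - qq k by have := Y_hi p' k; rewrite a' /hi /= E'; lra.
  have := Y_step G k; rewrite E /cG u wsum_3nseq => ES.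
  have := rrE k; have := ppE k; have := qqE k; have := qq_lt_pp k.+1.
  have := Y_ge0 p k.+1; have := rr_gt0 k.+1; move=> h1 h2 h3 h4 h5 h6.
  (* For i < n_{k+1} the equation [ES] gives y >= r_{k+1}, while [yle] gives y <= p_k - q_k =
     r_{k+1} - (p_{k+1} - q_{k+1}) < r_{k+1}. *)
  have [ilt|ige] := ltnP i (n k.+1).
    have : pp k *+ i + pp k *+ 1 <= pp k *+ n k.+1.
      by rewrite -mulrnDr pp_muln_ge // addn1.
    by rewrite mulr1n; lra.
  have iE : i = n k.+1 by move: im; case: (_ == L2); lia.
  have b2 : edge_a (G k.+1) = L2.
    by apply/eqP; move: im; rewrite iE; case: (_ == L2); lia.
  (* The roles are exchanged: the path leaving from 2 has letter 1 one level up, and the other one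
     has letter 2. *)
  exists G', G; split => //; move: ES; rewrite iE; lra.
apply: le_anti; rewrite y0 andbT; apply: (@le0_rr _ 1) => N; exists N; split => //.
have [G [G' [[p p'] [a a'] E E']]] := key N.
have := Y_hi p' N; rewrite a' /hi /= E'; have := qq_gt0 N; have := pp_le_rr N.
by have := rr_gt0 N.+1; lra.
Qed.

End Values.

Lemma cvg_mxP (T : topologicalType) m k (U : Type) (F : set_system U)
    (f : U -> 'M[T]_(m, k)) (M : 'M[T]_(m, k)) : Filter F ->
  (forall i j, (fun x => f x i j) @ F --> M i j) -> f @ F --> M.
Proof.
move=> FF h A [P M_P sPA].
have : F (fun x => forall ij : 'I_m * 'I_k, P ij.1 ij.2 (f x ij.1 ij.2)).
  by apply: filter_forall => -[i j]; apply: h; exact: M_P.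
move=> FP; rewrite nbhs_filterE /fmap /=; move: FP; apply: filterS => x hx.
by apply: sPA => i j; exact: (hx (i, j)).
Qed.

(** * Contraction of the positive cone *)

Section ProjectiveLimit.
Context (R : realType) (n : nat -> nat).
Hypothesis n_pos : forall k : nat, (0 < k)%N -> (0 < n k)%N.

(* A triple (a, b, c) stands for the functional a p + b q + c r on the
   coordinates (p, q, r) = (- x1, - x2, x3), in which the inverse transpose of
   [A_mx m] is the nonnegative matrix (p, q, r) |-> (q + r, p, m q + (m+1) r);
   [pull m] is composition with that matrix. *)
Definition pull (m : nat) (f : R * R * R) : R * R * R :=
  let: (a, b, c) := f in (b, a + m%:R * c, a + m.+1%:R * c).

Fixpoint coef (f : R * R * R) (N : nat) : R * R * R :=
  if N is N'.+1 then pull (n N) (coef f N') else f.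

Definition app (f : R * R * R) (w : R * R * R) : R :=
  f.1.1 * w.1.1 + f.1.2 * w.1.2 + f.2 * w.2.

Definition le3 (f f' : R * R * R) : Prop :=
  [/\ f.1.1 <= f'.1.1, f.1.2 <= f'.1.2 & f.2 <= f'.2].

Definition lin3 (s t : R) (f f' : R * R * R) : R * R * R :=
  (s * f.1.1 + t * f'.1.1, s * f.1.2 + t * f'.1.2, s * f.2 + t * f'.2).

Lemma pull_lin m s t f f' : pull m (lin3 s t f f') = lin3 s t (pull m f) (pull m f').
Proof.
by case: f => -[a b] c; case: f' => -[a' b'] c'; rewrite /lin3 /=; congr (_, _, _); ring.
Qed.

Lemma pull_ge0 m f : le3 (0, 0, 0) f -> le3 (0, 0, 0) (pull m f).
Proof.
case: f => -[a b] c [/= a0 b0 c0]; split => //=.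
  by rewrite addr_ge0 // mulr_ge0.
by rewrite addr_ge0 // mulr_ge0.
Qed.

(** The first coordinate after three pulls is the pairing of the functional with this vector; the
    other two are, up to a factor between 1 and 3, its multiples by n_{N+3} and n_{N+3} + 1. Three
    is the least number of factors whose product has no zero entry. *)
Definition wvec (N : nat) : R * R * R :=
  ((n N.+2)%:R, 1, ((n N.+1)%:R + 1) * (n N.+2)%:R).

Lemma wvec_gt0 N : [/\ 0 < (wvec N).1.1, 0 < (wvec N).1.2 & 0 < (wvec N).2].
Proof.
have n2 : 0 < (n N.+2)%:R :> R by rewrite ltr0n n_pos.
by split => //=; rewrite mulr_gt0 // ltr_wpDl.
Qed.

Lemma three_steps N f : le3 (0, 0, 0) f ->
  let g := pull (n N.+3) (pull (n N.+2) (pull (n N.+1) f)) in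
  let x := app f (wvec N) in
  [/\ x <= g.1.1 <= 3 * x,
      (n N.+3)%:R * x <= g.1.2 <= 3 * ((n N.+3)%:R * x)
    & (n N.+3).+1%:R * x <= g.2 <= 3 * ((n N.+3).+1%:R * x)].
Proof.
case: f => -[x y] z [/= x0 y0 z0].
rewrite /app /= -[(n N.+1).+1%:R]natr1 -[(n N.+2).+1%:R]natr1 -[(n N.+3).+1%:R]natr1.
have : 1 <= (n N.+1)%:R :> R by rewrite ler1n n_pos.
have : 1 <= (n N.+2)%:R :> R by rewrite ler1n n_pos.
have : 1 <= (n N.+3)%:R :> R by rewrite ler1n n_pos.
move: (n N.+1)%:R (n N.+2)%:R (n N.+3)%:R => c a b b1 a1 c1.
have key (t : R) : 1 <= t -> t * (x * a + y * 1 + z * ((c + 1) * a)) <=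
    x + c * z + t * (y + (a + 1) * (x + (c + 1) * z)) <=
    3 * (t * (x * a + y * 1 + z * ((c + 1) * a))).
  move=> t1.
  have ax : 0 <= (t - 1) * x by rewrite mulr_ge0 // subr_ge0.
  have az : 0 <= (t - 1) * z by rewrite mulr_ge0 // subr_ge0.
  have aty : 0 <= t * y by rewrite mulr_ge0 // (le_trans ler01).
  have atx : 0 <= t * (a - 1) * x.
    by rewrite !mulr_ge0 // ?subr_ge0 // (le_trans ler01).
  have atz : 0 <= t * (a - 1) * z.
    by rewrite !mulr_ge0 // ?subr_ge0 // (le_trans ler01).
  have atcz : 0 <= t * (a - 1) * (c * z).
    by rewrite !mulr_ge0 // ?subr_ge0 // (le_trans ler01).
  have acz : 0 <= (t - 1) * (c * z).
    by rewrite !mulr_ge0 // ?subr_ge0 // (le_trans ler01).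
  have cz : 0 <= c * z by rewrite !mulr_ge0 // (le_trans ler01).
  by apply/andP; split; nra.
split.
- have a0 : 0 <= a by lra.
  have c0 : 0 <= c + 1 by lra.
  have : 0 <= a * x by rewrite mulr_ge0.
  have : 0 <= a * (c + 1) * z by rewrite !mulr_ge0.
  by move=> h1 h2; apply/andP; split; nra.
- exact: key b b1.
- have b1' : 1 <= b + 1 by lra.
  have /andP[h1 h2] := key _ b1'; apply/andP; split; nra.
Qed.

Definition e1 : R * R * R := (1, 0, 0).
Definition e2 : R * R * R := (0, 1, 0).
Definition e3 : R * R * R := (0, 0, 1).

Lemma coef_ge0 f N : le3 (0, 0, 0) f -> le3 (0, 0, 0) (coef f N).
Proof. by move=> f0; elim: N => //= N IH; exact: pull_ge0. Qed.

Lemma app_lin s t f f' w : app (lin3 s t f f') w = s * app f w + t * app f' w.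
Proof. by rewrite /app /lin3 /=; ring. Qed.

Lemma app_ge0 f w : le3 (0, 0, 0) f -> le3 (0, 0, 0) w -> 0 <= app f w.
Proof. by move=> [/= ? ? ?] [/= ? ? ?]; rewrite /app !addr_ge0 // mulr_ge0. Qed.

Definition pos3 (w : R * R * R) : Prop := [/\ 0 < w.1.1, 0 < w.1.2 & 0 < w.2].

Lemma pos3_ge0 w : pos3 w -> le3 (0, 0, 0) w.
Proof. by move=> [? ? ?]; split; exact: ltW. Qed.

Definition push (m : nat) (w : R * R * R) : R * R * R :=
  (w.1.2 + w.2, w.1.1, m%:R * w.1.2 + m.+1%:R * w.2).

Lemma app_pull m f w : app (pull m f) w = app f (push m w).
Proof. by case: f => -[a b] c; rewrite /app /push /=; ring. Qed.

Lemma push_pos m w : pos3 w -> pos3 (push m w).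
Proof.
move=> [w1 w2 w3]; split => //=; first exact: addr_gt0.
by rewrite ltr_wpDl ?mulr_gt0 // mulr_ge0 // ltW.
Qed.

Lemma app_coef_gt0 f N w : pos3 f \/ f \in [:: e1; e2; e3] -> pos3 w ->
  0 < app (coef f N) w.
Proof.
move=> hf; elim: N w => [|N IH] w wp /=; last by rewrite app_pull IH //; exact: push_pos.
case: wp => w1 w2 w3; rewrite /app.
case: hf => [[f1 f2 f3]|]; first by rewrite !addr_gt0 // mulr_gt0.
by rewrite !inE => /or3P[] /eqP -> /=; rewrite ?mul1r ?mul0r ?addr0 ?add0r.
Qed.

(** Coordinatewise bounds of [coef f N] by multiples of [coef e2 N], written as nonnegativity of two
    functionals because [pull] is linear and preserves nonnegativity. *)
Definition ratio_in (f : R * R * R) N lo hi : Prop :=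
  le3 (0, 0, 0) (lin3 1 (- lo) (coef f N) (coef e2 N)) /\
  le3 (0, 0, 0) (lin3 hi (- 1) (coef e2 N) (coef f N)).

Lemma ratio_in_app f N lo hi w : ratio_in f N lo hi -> pos3 w ->
  lo * app (coef e2 N) w <= app (coef f N) w <= hi * app (coef e2 N) w.
Proof.
move=> [h1 h2] /pos3_ge0 wp; have := app_ge0 h1 wp; have := app_ge0 h2 wp.
by rewrite !app_lin => ? ?; apply/andP; split; lra.
Qed.

Lemma ratio_inS f N lo hi : ratio_in f N lo hi -> ratio_in f N.+1 lo hi.
Proof.
by move=> [h1 h2]; split; rewrite /= -pull_lin; exact: pull_ge0.
Qed.

Lemma ratio_inD f N M lo hi : (N <= M)%N -> ratio_in f N lo hi -> ratio_in f M lo hi.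
Proof.
move=> /subnKC <- h; elim: (M - N)%N => [|d IH]; first by rewrite addn0.
by rewrite addnS; exact: ratio_inS.
Qed.

Lemma ratio_in_contract f N lo hi : ratio_in f N lo hi -> exists lo' hi',
  [/\ lo <= lo', hi' - lo' <= 2 / 3 * (hi - lo) & ratio_in f N.+3 lo' hi'].
Proof.
move=> [h1 h2].
pose v := wvec N; have vp : pos3 v := wvec_gt0 N.
pose x := app (lin3 1 (- lo) (coef f N) (coef e2 N)) v.
pose y := app (lin3 hi (- 1) (coef e2 N) (coef f N)) v.
pose z := app (coef e2 N) v.
have x0 : 0 <= x by apply: app_ge0 => //; exact: pos3_ge0.
have y0 : 0 <= y by apply: app_ge0 => //; exact: pos3_ge0.
have z0 : 0 < z by apply: app_coef_gt0 => //; right; rewrite !inE eqxx orbT.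
have xyz : x + y = (hi - lo) * z by rewrite /x /y !app_lin -/z; ring.
have ge2 : le3 (0, 0, 0) (coef e2 N) by apply: coef_ge0; split.
have [a1 a2 a3] := three_steps N h1.
have [b1 b2 b3] := three_steps N h2.
have [c1 c2 c3] := three_steps N ge2.
rewrite !pull_lin -/v -/x in a1 a2 a3.
rewrite !pull_lin -/v -/y in b1 b2 b3.
rewrite -/v -/z in c1 c2 c3.
(* After three steps the lower slack is at least x times the vector (1, n_{N+3}, n_{N+3} + 1), and
   [coef e2] is at most 3 z times it; so [lo] can be raised by x / (3 z), and likewise [hi] lowered
   by y / (3 z). As x + y = (hi - lo) z, the total gain is a third of the width. *)
exists (lo + x / (3 * z)), (hi - y / (3 * z)).
have z3 : 0 < 3 * z by rewrite mulr_gt0.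
have xz0 : 0 <= x / (3 * z) by rewrite divr_ge0 // ltW.
have yz0 : 0 <= y / (3 * z) by rewrite divr_ge0 // ltW.
have xE : x = x / (3 * z) * (3 * z) by rewrite divfK // gt_eqF.
have yE : y = y / (3 * z) * (3 * z) by rewrite divfK // gt_eqF.
split.
- by rewrite lerDl.
- have -> : hi - y / (3 * z) - (lo + x / (3 * z)) = (hi - lo) - (x + y) / (3 * z).
    by move: (3 * z)^-1 => i; ring.
  have -> : (x + y) / (3 * z) = (hi - lo) / 3.
    by rewrite xyz; field; rewrite gt_eqF.
  lra.
- move: a1 a2 a3 b1 b2 b3 c1 c2 c3.
  rewrite /ratio_in /=.
  move: (pull _ (pull _ (pull _ (coef f N)))) => [[p1 p2] p3].
  move: (pull _ (pull _ (pull _ (coef e2 N)))) => [[q1 q2] q3].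
  rewrite /lin3 /=.
  move: (x / (3 * z)) (y / (3 * z)) xz0 yz0 xE yE => X Y0' X0 Y0 -> ->.
  have s1 : 0 <= (n N.+3)%:R :> R by [].
  have s2 : 0 <= (n N.+3).+1%:R :> R by [].
  move: (n N.+3)%:R (n N.+3).+1%:R s1 s2 => s s' s1 s2.
  move=> /andP[a1 _] /andP[a2 _] /andP[a3 _] /andP[b1 _] /andP[b2 _] /andP[b3 _].
  move=> /andP[_ c1] /andP[_ c2] /andP[_ c3].
  split; split => /=.
  + by have := ler_wpM2l X0 c1; lra.
  + by have := ler_wpM2l X0 c2; lra.
  + by have := ler_wpM2l X0 c3; lra.
  + by have := ler_wpM2l Y0 c1; lra.
  + by have := ler_wpM2l Y0 c2; lra.
  + by have := ler_wpM2l Y0 c3; lra.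
Qed.

(** As [app e2 (wvec 0)] is 1, [three_steps] compares both functionals at level 3 with multiples of
    the same vector (1, n_3, n_3 + 1). *)
Lemma ratio_in_base f : f \in [:: e1; e2; e3] ->
  exists lo hi, 0 < lo /\ ratio_in f 3 lo hi.
Proof.
move=> hf.
have f0 : le3 (0, 0, 0) f.
  by move: hf; rewrite !inE => /or3P[] /eqP -> /=; split => /=.
have x0 : 0 < app f (wvec 0) by apply: (@app_coef_gt0 f 0); [right|exact: wvec_gt0].
have e20 : le3 (0, 0, 0) e2 by split.
have [a1 a2 a3] := three_steps 0 f0.
have [c1 c2 c3] := three_steps 0 e20.
have z1 : app e2 (wvec 0) = 1 by rewrite /app /= !mul0r mul1r addr0 add0r.
rewrite z1 in c1 c2 c3.
exists (app f (wvec 0) / 3), (3 * app f (wvec 0)); split; first by rewrite divr_gt0.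
move: a1 a2 a3 c1 c2 c3; rewrite /ratio_in.
rewrite -[coef f 3]/(pull (n 3) (pull (n 2) (pull (n 1%N) f))).
rewrite -[coef e2 3]/(pull (n 3) (pull (n 2) (pull (n 1%N) e2))).
move: (app f (wvec 0)) x0 => x x0.
move: (pull _ (pull _ (pull _ f))) => [[p1 p2] p3].
move: (pull _ (pull _ (pull _ e2))) => [[q1 q2] q3].
rewrite /lin3 /= !mulr1.
have s1 : 0 <= (n 3)%:R :> R by [].
have s2 : 0 <= (n 3).+1%:R :> R by [].
move: (n 3)%:R (n 3).+1%:R s1 s2 => s s' s1 s2.
move=> /andP[a1 a1'] /andP[a2 a2'] /andP[a3 a3'].
move=> /andP[c1 c1'] /andP[c2 c2'] /andP[c3 c3'].
have x3 : 0 <= x / 3 by rewrite divr_ge0 // ltW.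
split; split => /=.
- by have := ler_wpM2l x3 c1'; lra.
- by have := ler_wpM2l x3 c2'; lra.
- by have := ler_wpM2l x3 c3'; lra.
- by have := ler_wpM2l (ltW x0) c1; lra.
- by have := ler_wpM2l (ltW x0) c2; lra.
- by have := ler_wpM2l (ltW x0) c3; lra.
Qed.

Definition coef_ratio f (N : nat) w := app (coef f N) w / app (coef e2 N) w.

Lemma ratio_in_ratio f N lo hi w : ratio_in f N lo hi -> pos3 w ->
  lo <= coef_ratio f N w <= hi.
Proof.
move=> /ratio_in_app h wp; have /andP[h1 h2] := h w wp.
have z0 : 0 < app (coef e2 N) w by apply: app_coef_gt0 => //; right; rewrite !inE eqxx orbT.
by rewrite /coef_ratio ler_pdivlMr // h1 ler_pdivrMr.
Qed.

Lemma ratio_in_small f e : f \in [:: e1; e2; e3] -> 0 < e ->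
  exists N lo hi, ratio_in f N lo hi /\ hi - lo < e.
Proof.
move=> hf e0; have [lo [hi [_ h]]] := ratio_in_base hf.
have key k : exists N lo' hi', ratio_in f N lo' hi' /\ hi' - lo' <= (hi - lo) * (2 / 3) ^+ k.
  elim: k => [|k [N [l' [h' [hr hle]]]]].
    by exists 3%N, lo, hi; rewrite expr0 mulr1.
  have [l2 [h2 [_ hle2 hr2]]] := ratio_in_contract hr.
  exists N.+3, l2, h2; split => //; apply: le_trans hle2 _.
  by rewrite exprS mulrCA ler_pM2l // divr_gt0.
have : (fun k => (hi - lo) * (2 / 3) ^+ k) @ \oo --> (hi - lo) * 0.
  apply: cvgM; first exact: cvg_cst.
  by apply: cvg_expr; rewrite ger0_norm; lra.
rewrite mulr0 => /cvgrPdist_lt/(_ _ e0)[K _ /(_ K (leqnn K))] /=.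
rewrite sub0r normrN => hK.
have [N [l' [h' [hr hle]]]] := key K.
exists N, l', h'; split => //; apply: le_lt_trans hle _.
exact: le_lt_trans (ler_norm _) hK.
Qed.

(** The limit is the supremum of all admissible lower bounds, which does not involve [w]. *)
Lemma ratio_cvg f : f \in [:: e1; e2; e3] -> exists2 rho : R, 0 < rho &
  forall w, pos3 w -> (fun N => coef_ratio f N w) @ \oo --> (rho : R^o).
Proof.
move=> hf; pose A := [set lo | exists N hi, ratio_in f N lo hi].
pose w0 : R * R * R := (1, 1, 1).
have w0p : pos3 w0 by split.
have AB lo N hi M lo' hi' : ratio_in f N lo hi -> ratio_in f M lo' hi' -> lo <= hi'.
  move=> /(ratio_inD (leq_maxl N M)) h1 /(ratio_inD (leq_maxr N M)) h2.
  have /andP[a1 _] := ratio_in_ratio h1 w0p.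
  by have /andP[_ a2] := ratio_in_ratio h2 w0p; exact: le_trans a1 a2.
have [lo0 [hi0 [lo00 h0]]] := ratio_in_base hf.
have supA : has_sup A.
  split; first by exists lo0, 3%N, hi0.
  by exists hi0 => lo [N [hi h]]; exact: AB h h0.
have rhoP N lo hi : ratio_in f N lo hi -> lo <= sup A <= hi.
  move=> h; apply/andP; split; first by apply: ub_le_sup; [case: supA|exists N, hi].
  apply: ge_sup; first by case: supA.
  by move=> lo' [M [hi' h']]; exact: AB h' h.
exists (sup A).
  by have /andP[h _] := rhoP _ _ _ h0; exact: lt_le_trans h.
move=> w wp; apply/cvgrPdist_lt => e ep.
have [N [lo [hi [h hle]]]] := ratio_in_small hf ep.
exists N => // M /= NM.
have /andP[a1 a2] := rhoP _ _ _ h.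
have /andP[b1 b2] := ratio_in_ratio (ratio_inD NM h) wp.
by rewrite ltr_norml; apply/andP; split; lra.
Qed.

End ProjectiveLimit.

(** * The vector [ell] and the positivity of the weights *)

Section Ell.
Context (R : realType) (n : nat -> nat).
Hypothesis n_pos : forall k : nat, (0 < k)%N -> (0 < n k)%N.

Lemma sum_letter (F : letter -> R) : \sum_(a < 3) F a = F L1 + F L2 + F L3.
Proof.
rewrite !big_ord_recl big_ord0 addr0 addrA.
by congr (_ + _ + _); congr F; exact/val_inj.
Qed.

Definition Binv (m : nat) : 'M[R]_3 :=
  \matrix_(i, j)
    nth 0 (nth [::] [:: [:: 0; 1; -1];
                        [:: 1; 0; 0];
                        [:: 0; - m%:R; m.+1%:R]] i) j.

Lemma A_mx_Binv m : A_mx R m *m (Binv m)^T = 1%:M.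
Proof.
apply/matrixP => i j; rewrite !mxE sum_letter !mxE.
by case: (letterP i) => ->; case: (letterP j) => -> /=; rewrite -?natr1 /=; ring.
Qed.

Lemma A_mx_unit m : A_mx R m \in unitmx.
Proof. by have [] := mulmx1_unit (A_mx_Binv m). Qed.

Lemma invmx_A_mx m : (invmx (A_mx R m))^T = Binv m.
Proof.
rewrite -[Binv m]trmxK; congr trmx.
by rewrite -[LHS]mulmx1 -(A_mx_Binv m) mulmxA mulVmx ?A_mx_unit // mul1mx.
Qed.

Lemma A_prod_unit N : A_prod R n N \in unitmx.
Proof.
elim: N => [|N IH] /=; first exact: unitmx1.
by rewrite unitmx_mul IH A_mx_unit.
Qed.

Lemma invmx_A_prodS N :
  (invmx (A_prod R n N.+1))^T = (invmx (A_prod R n N))^T *m Binv (n N.+1).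
Proof.
rewrite -invmx_A_mx -trmx_mul; congr trmx.
set X := RHS; have E : A_prod R n N.+1 *m X = 1%:M.
  rewrite /= -mulmxA [A_mx _ _ *m _]mulmxA mulmxV ?A_mx_unit // mul1mx.
  by rewrite mulmxV ?A_prod_unit.
by rewrite -[LHS]mulmx1 -E mulmxA mulVmx ?A_prod_unit // mul1mx.
Qed.

Definition trip (w : 'cV[R]_3) : R * R * R := (- w L1 0, - w L2 0, w L3 0).

Lemma trip_Binv m w : trip (Binv m *m w) = push m (trip w).
Proof.
by rewrite /trip /push !mxE !sum_letter !mxE /=; congr (_, _, _); rewrite -?natr1; ring.
Qed.

Lemma coef_invmx N w : let x := (invmx (A_prod R n N))^T *m w in
  [/\ x L1 0 = - app (coef n (e1 R) N) (trip w),
      x L2 0 = - app (coef n (e2 R) N) (trip w)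
    & x L3 0 = app (coef n (e3 R) N) (trip w)].
Proof.
elim: N w => [|N IH] w /=.
  have -> : invmx (1%:M : 'M[R]_3) = 1%:M.
    by rewrite -[LHS]mul1mx mulmxV ?unitmx1.
  by rewrite trmx1 mul1mx /app /=; split; ring.
rewrite -/(A_prod R n N.+1) invmx_A_prodS -mulmxA.
have [-> -> ->] := IH (Binv (n N.+1) *m w).
by rewrite !app_pull trip_Binv.
Qed.

Lemma norm2E (x : 'cV[R]_3) :
  norm2 x = Num.sqrt (x L1 0 ^+ 2 + x L2 0 ^+ 2 + x L3 0 ^+ 2).
Proof. by rewrite /norm2 sum_letter. Qed.

Lemma norm2Z (c : R) x : 0 <= c -> norm2 (c *: x) = c * norm2 x.
Proof.
move=> c0; rewrite !norm2E !mxE !exprMn -!mulrDr sqrtrM ?sqr_ge0 //.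
by rewrite sqrtr_sqr ger0_norm.
Qed.

Lemma ex_is_ell : exists l, is_ell n (l : 'cV[R]_3).
Proof.
have e1in : e1 R \in [:: e1 R; e2 R; e3 R] by rewrite inE eqxx.
have e3in : e3 R \in [:: e1 R; e2 R; e3 R] by rewrite !inE eqxx !orbT.
have [r1 r10 h1] := ratio_cvg n_pos e1in.
have [r3 r30 h3] := ratio_cvg n_pos e3in.
pose y : 'cV[R]_3 := \col_i nth 0 [:: - r1; -1; r3] i.
have y1 : y L1 0 = - r1 by rewrite mxE.
have y2 : y L2 0 = - 1 by rewrite mxE.
have y3 : y L3 0 = r3 by rewrite mxE.
have ny : 0 < norm2 y.
  rewrite norm2E sqrtr_gt0 y1 y2 y3 !sqrrN expr1n.
  by have := sqr_ge0 r1; have := sqr_ge0 r3; lra.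
exists ((norm2 y)^-1 *: y); split.
- by split; rewrite !mxE /= ?pmulr_rlt0 ?pmulr_rgt0 ?invr_gt0 // ?oppr_lt0.
- by rewrite norm2Z ?invr_ge0 ?(ltW ny) // mulVf // gt_eqF.
move=> w [w1 w2 w3].
have wp : pos3 (trip w) by split => //=; rewrite oppr_gt0.
pose z N : 'cV[R]_3 := \col_i nth 0 [:: - coef_ratio n (e1 R) N (trip w); -1;
   coef_ratio n (e3 R) N (trip w)] i.
pose x N := (invmx (A_prod R n N))^T *m w.
pose c N := app (coef n (e2 R) N) (trip w).
have c0 N : 0 < c N.
  by apply: app_coef_gt0 => //; right; rewrite !inE eqxx orbT.
(* The positive factor [c N] cancels in the normalization; what remains are the ratios to the second
   coordinate, which converge. *)
have xz N : x N = c N *: z N.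
  have [x1 x2 x3] := coef_invmx N w.
  have cN : c N != 0 by rewrite gt_eqF.
  apply/colP => i; rewrite [RHS]mxE [z N _ _]mxE.
  case: (letterP i) => -> /=.
  - by rewrite {1}/x x1 /coef_ratio -/(c N) mulrN mulrCA mulfV // mulr1.
  - by rewrite {1}/x x2 -/(c N) mulrN1.
  - by rewrite {1}/x x3 /coef_ratio -/(c N) mulrCA mulfV // mulr1.
have zcvg i : (fun N => z N i 0) @ \oo --> y i 0.
  case: (letterP i) => ->; rewrite ?y1 ?y2 ?y3.
  - rewrite (_ : (fun N => _) = (fun N => - coef_ratio n (e1 R) N (trip w))).
      by apply: cvgN; exact: h1.
    by apply/funext => N; rewrite mxE.
  - rewrite (_ : (fun N => _) = cst (- 1)); first exact: cvg_cst.
    by apply/funext => N; rewrite mxE.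
  - rewrite (_ : (fun N => _) = (fun N => coef_ratio n (e3 R) N (trip w))).
      exact: h3.
    by apply/funext => N; rewrite mxE.
have ncvg : (fun N => norm2 (z N)) @ \oo --> norm2 y.
  rewrite norm2E; under eq_fun do rewrite norm2E.
  apply: continuous_cvg; first exact: sqrt_continuous.
  by apply: cvgD; [apply: cvgD|]; rewrite expr2; under eq_fun do rewrite expr2;
     apply: cvgM; exact: zcvg.
rewrite (_ : (fun N => _) = (fun N => (norm2 (z N))^-1 *: z N)); last first.
  apply/funext => N; rewrite /= -/(x N) xz norm2Z ?(ltW (c0 N)) // scalerA.
  congr (_ *: _); rewrite invfM mulrAC mulVf ?mul1r // gt_eqF //.
apply: cvg_mxP => i j; rewrite (ord1 j) mxE.
under eq_fun do rewrite mxE.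
apply: cvgM; last exact: zcvg.
by apply: cvgV => //; rewrite gt_eqF.
Qed.

Lemma is_ell_ell : is_ell n (ell R n).
Proof. by rewrite /ell; case: xgetP => // /(_ _) h; have [l /h] := ex_is_ell. Qed.

Definition vg (w : 'cV[R]_3) (a : letter) : R := w a 0.

Lemma wsum_A_prod w N a :
  wsum (vg w) (LambdaK n N [:: a]) = ((A_prod R n N)^T *m w) a 0.
Proof.
elim: N a => [|N IH] a.
  by rewrite /= trmx1 mul1mx /wsum big_cons big_nil addr0.
rewrite [A_prod R n N.+1]/= trmx_mul -mulmxA mxE sum_letter -!IH !mxE.
rewrite /= Lambda_letter.
case: (letterP a) => -> /=; rewrite ?addn0 ?addn1.
- by rewrite mul0r mul1r mul0r add0r addr0.
- by rewrite wsum_3nseq -[pp _ _ _ *+ _]mulr_natl /rr /pp; ring.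
- by rewrite wsum_3nseq -[pp _ _ _ *+ _]mulr_natl /rr /pp; ring.
Qed.

(** The recursions express the values at level j through those at level j + 1 with nonnegative
    coefficients. *)
Lemma pos_down (h : letter -> R) N :
  0 < pp n h N -> 0 < qq n h N -> 0 < rr n h N ->
  forall k, (k <= N)%N -> [/\ 0 < pp n h k, 0 < qq n h k & 0 < rr n h k].
Proof.
move=> p q r k kN; rewrite -(subKn kN); elim: (N - k)%N => [|d [IH1 IH2 IH3]].
  by rewrite subn0.
have [dN|Nd] := ltnP d N; last by rewrite (_ : N - d.+1 = N - d)%N //; lia.
move: IH1 IH2 IH3; rewrite -(subnSK dN); set j := (N - d.+1)%N => h1 h2 h3.
have pj : 0 < pp n h j by rewrite ppE addr_gt0.
by split => //; rewrite ?qqE // rrE ltr_wpDl // mulrn_wge0 // ltW.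
Qed.

(** The approximant [x N] is the weight vector whose p, q and r at level N are all 1; hence by
    [pos_down] they are positive at every level k <= N, and only the weak inequality survives the
    limit. *)
Lemma ell_nonneg k : [/\ 0 <= pp n (vg (ell R n)) k, 0 <= qq n (vg (ell R n)) k
  & 0 <= rr n (vg (ell R n)) k].
Proof.
have [_ _ lc] := is_ell_ell.
pose w : 'cV[R]_3 := \col_i nth 0 [:: -1; -1; 1] i.
have wC : C_mmp w by split; rewrite mxE /= ?oppr_lt0 ?ltr01.
pose x N := (invmx (A_prod R n N))^T *m w.
pose d N := (norm2 (x N))^-1.
have d0 N : 0 <= d N by rewrite invr_ge0 sqrtr_ge0.
have xpos N : (k <= N)%N -> [/\ 0 < pp n (vg (x N)) k, 0 < qq n (vg (x N)) k
   & 0 < rr n (vg (x N)) k].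
  have E a : wsum (vg (x N)) (LambdaK n N [:: a]) = w a 0.
    rewrite wsum_A_prod /x mulmxA -trmx_mul mulVmx ?A_prod_unit //.
    by rewrite trmx1 mul1mx.
  by apply: pos_down; rewrite /pp /qq /rr E mxE /= ?opprK.
have cv a : (fun N => d N * wsum (vg (x N)) (LambdaK n k [:: a])) @ \oo -->
    (wsum (vg (ell R n)) (LambdaK n k [:: a]) : R^o).
  rewrite wsum_A_prod mxE.
  rewrite (_ : (fun N => _) = fun N => \sum_b (A_prod R n k)^T a b * (d N *: x N) b 0).
    have cb b : (fun N => (A_prod R n k)^T a b * (d N *: x N) b 0) @ \oo -->
        (A_prod R n k)^T a b * ell R n b 0.
      apply: cvgM; first exact: cvg_cst.
      apply: (@cvg_comp _ _ _ (fun N => d N *: x N) (fun u : 'cV[R]_3 => u b 0)).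
        exact: (lc w wC).
      exact: coord_continuous.
    rewrite sum_letter; under eq_fun do rewrite sum_letter.
    by apply: cvgD; [apply: cvgD|]; exact: cb.
  apply/funext => N; rewrite wsum_A_prod mxE mulr_sumr.
  by apply: eq_bigr => b _; rewrite [X in _ = _ * X]mxE mulrCA.
have ge0 (c : R) a : (forall N, (k <= N)%N -> 0 <= c * wsum (vg (x N)) (LambdaK n k [:: a])) ->
    0 <= c * wsum (vg (ell R n)) (LambdaK n k [:: a]).
  move=> h; have cv' : (fun N => c * (d N * wsum (vg (x N)) (LambdaK n k [:: a]))) @ \oo -->
      (c * wsum (vg (ell R n)) (LambdaK n k [:: a]) : R^o).
    by apply: cvgM; [exact: cvg_cst|exact: cv].
  rewrite -(cvg_lim (@Rhausdorff R) cv'); apply: limr_ge.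
    by apply/cvg_ex; eexists; exact: cv'.
  by exists k => // N /= kN; rewrite mulrCA mulr_ge0 // h.
have pE h : pp n h k = -1 * wsum h (LambdaK n k [:: L1]) by rewrite mulN1r.
have qE h : qq n h k = -1 * wsum h (LambdaK n k [:: L2]) by rewrite mulN1r.
have rE h : rr n h k = 1 * wsum h (LambdaK n k [:: L3]) by rewrite mul1r.
by split; rewrite ?pE ?qE ?rE; apply: ge0 => N /xpos[];
   rewrite ?pE ?qE ?rE => /ltW ? /ltW ? /ltW ?.
Qed.

Lemma ell_pos k : [/\ 0 < pp n (vg (ell R n)) k, 0 < qq n (vg (ell R n)) k
  & 0 < rr n (vg (ell R n)) k].
Proof.
set h := vg _.
have rp j : pp n h j + rr n h j.+1 <= rr n h j.
  have [p0 _ _] := ell_nonneg j.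
  rewrite [X in _ <= X]rrE lerD2r -{1}[pp n h j]mulr1n.
  exact: ler_wpMn2l p0 _ _ (n_pos _).
elim: k => [|k [p q r]].
  have [[h1 h2 h3] _ _] := is_ell_ell.
  by rewrite /pp /qq /rr /= /wsum !big_seq1 !oppr_gt0.
have [p1 q1 r1] := ell_nonneg k.+1; have [p2 q2 r2] := ell_nonneg k.+2.
have [p3 q3 r3] := ell_nonneg k.+3; have [p4 q4 r4] := ell_nonneg k.+4.
have Q0 := qqE n h k; have Q1 := qqE n h k.+1; have Q2 := qqE n h k.+2.
have P1 := ppE n h k.+1; have P2 := ppE n h k.+2; have P3 := ppE n h k.+3.
have R1 := rp k.+1; have R2 := rp k.+2; have R3 := rp k.+3.
rewrite -/h in p1 q1 r1 p2 q2 r2 p3 q3 r3 p4 q4 r4.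
have pk1 : 0 < pp n h k.+1 by rewrite -Q0.
split => //; last by lra.
(* If q_{k+1} = p_{k+2} vanished, so would r_{k+3} and r_{k+2}, then p_{k+3} <= r_{k+3}, and finally
   p_{k+1} = q_{k+2} + r_{k+2} = p_{k+3} + r_{k+2}. *)
rewrite Q1 lt_neqAle p2 andbT eq_sym; apply/eqP => P20.
have := rrE n h k.+2; rewrite P20 mul0rn add0r => R2E.
by lra.
Qed.

Definition gell (a : letter) : R :=
  ell R n a 0 / (ell R n L3 0 - ell R n L2 0).

Lemma ell_denom : 0 < ell R n L3 0 - ell R n L2 0.
Proof. by have [[_ h2 h3] _ _] := is_ell_ell; rewrite subr_gt0 (lt_trans h2). Qed.

Lemma wsum_gell w : wsum gell w = wsum (vg (ell R n)) w / (ell R n L3 0 - ell R n L2 0).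
Proof. by rewrite /wsum big_distrl. Qed.

Lemma phi_wsum w : phi R n w = wsum (vg (ell R n)) w.
Proof.
elim: w => [|a w IH].
  by rewrite /phi /wsum big_nil big1 // => b _; rewrite mulr0.
rewrite /wsum big_cons -/(wsum _ _) -IH /phi -[vg _ a]mulr1.
rewrite (bigD1 a) //= eqxx natrD mulrDr -addrA; congr (_ + _).
rewrite [in RHS](bigD1 a) //=; congr (_ + _); apply: eq_bigr => b ba.
by rewrite eq_sym (negbTE ba).
Qed.

Lemma gell_pos k : [/\ 0 < pp n gell k, 0 < qq n gell k & 0 < rr n gell k].
Proof.
have [p q r] := ell_pos k; have d := ell_denom.
by rewrite /pp /qq /rr !wsum_gell -!mulNr; split; apply: divr_gt0.
Qed.

Lemma mu1E : mu1 R n = qq n gell 0.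
Proof. by rewrite /mu1 /qq /= wsum_gell /wsum big_seq1 mulNr. Qed.

Lemma mu2E : mu2 R n = pp n gell 0.
Proof. by rewrite /mu2 /pp /= wsum_gell /wsum big_seq1 mulNr. Qed.

Lemma qq_rr1 : qq n gell 0 + rr n gell 0 = 1.
Proof.
rewrite /qq /rr /= !wsum_gell /wsum !big_seq1 addrC -mulrBl divff //.
by rewrite gt_eqF // ell_denom.
Qed.

Lemma Psi_L_gell G : is_path n G ->
  Psi_L R n G / (ell R n L3 0 - ell R n L2 0) = Psi n gell G.
Proof.
move=> pG; set D := _ - _; have D0 : D != 0 by rewrite gt_eqF // ell_denom.
have gp k := let: And3 p _ _ := gell_pos k in p.
have gq k := let: And3 _ q _ := gell_pos k in q.
have gr k := let: And3 _ _ r := gell_pos k in r.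
have cv := leftU_cvg n_pos gp gq gr pG.
rewrite /Psi_L /Psi seriesE; apply: (canLR (mulfK D0)); symmetry.
rewrite (_ : series (fun j => _) = (fun k => D * wsum gell (leftU n G k))).
  rewrite mulrC; apply/esym/cvg_lim => //.
  by apply: cvgM; [exact: cvg_cst|exact: cv].
apply/funext => k; rewrite wsum_leftU mulr_sumr /series /= big_mkord.
apply: eq_bigr => j _; rewrite /cG wsum_gell phi_wsum -/D.
by rewrite mulrCA mulfV // mulr1.
Qed.

End Ell.

(** * Cylinder neighbourhoods of one-sided and two-sided sequences *)

Section Cylinders.
Context (I : choiceType) (P : nat -> seq I).
Hypothesis P_mono : forall K L, (K <= L)%N -> {subset P K <= P L}.
Hypothesis P_cover : forall i, exists K, i \in P K.

Lemma nbhs_cylinder (s : {ptws I -> discrete_topology letter}) U :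
  nbhs s U <-> exists K, forall x : {ptws I -> discrete_topology letter},
    (forall i, i \in P K -> x i = s i) -> U x.
Proof.
split.
- pose B K := [set x : {ptws I -> discrete_topology letter} |
                 forall i, i \in P K -> x i = s i].
  have FB : Filter (filter_from setT B).
    apply: filter_from_filter; first by exists 0%N.
    move=> i j _ _; exists (maxn i j) => // x Bx.
    by split => k /P_mono kP; apply: Bx; apply: kP; rewrite (leq_maxl, leq_maxr).
  suff : filter_from setT B --> s.
    by move=> h /h [K _ hK]; exists K => x hx; exact: hK.
  apply/cvg_sup => i A [V [[X oX <-] Xs XA]]; apply: (filterS XA).
  by have [K iK] := P_cover i; exists K => // x Bx; rewrite /= /proj Bx.
- move=> [K hK].
  have key (r : seq I) : nbhs s (fun x : {ptws I -> discrete_topology letter} =>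
      forall i, i \in r -> x i = s i).
    elim: r => [|i r IH]; first by apply: (filterS _ filterT) => x _ i.
    have hi : nbhs s (fun x : {ptws I -> discrete_topology letter} => x i = s i).
      have := @proj_continuous I (fun=> discrete_topology letter) i s.
      by move=> /(_ [set s i]); apply; exact: discrete_set1.
    apply: (filterS _ (filterI hi IH)) => x [xi hx] j.
    by rewrite inE => /orP[/eqP->|/hx].
  by apply: (filterS _ (key (P K))) => x; exact: hK.
Qed.

Lemma closure_cylinder (A : set {ptws I -> discrete_topology letter}) s :
  closure A s <-> forall K, exists2 x, A x & forall i, i \in P K -> x i = s i.
Proof.
split.
- move=> cA K; have [|x [Ax hx]] :=
    cA (fun x : {ptws I -> discrete_topology letter} => forall i, i \in P K -> x i = s i).
    by apply/nbhs_cylinder; exists K.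
  by exists x.
- move=> h U /nbhs_cylinder[K hK]; have [x Ax hx] := h K.
  by exists x; split => //; exact: hK.
Qed.

End Cylinders.

Lemma closure_seqN (A : set seqN) s :
  closure A s <-> forall K, exists2 x, A x & forall i, (i < K)%N -> x i = s i.
Proof.
rewrite (@closure_cylinder nat (fun K => iota 0 K)).
- by split=> h K; have [x Ax hx] := h K; exists x => // i;
    have := hx i; rewrite mem_iota.
- by move=> K L KL i; rewrite !mem_iota /= => /leq_trans; apply.
- by move=> i; exists i.+1; rewrite mem_iota /= add0n ltnSn.
Qed.

Lemma nbhs_seqN (s : seqN) U :
  nbhs s U <-> exists K, forall x : seqN, (forall i, (i < K)%N -> x i = s i) -> U x.
Proof.
rewrite (@nbhs_cylinder nat (fun K => iota 0 K)).
- by split=> -[K hK]; exists K => x hx; apply: hK => i;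
    have := hx i; rewrite mem_iota.
- by move=> K L KL i; rewrite !mem_iota /= => /leq_trans; apply.
- by move=> i; exists i.+1; rewrite mem_iota /= add0n ltnSn.
Qed.

Definition window (K : nat) : seq int := [seq i%:Z - K%:Z | i <- iota 0 (2 * K)].

Lemma mem_window K (i : int) : (i \in window K) = (- K%:Z <= i < K%:Z).
Proof.
apply/mapP/idP => [[j + ->]|/andP[h1 h2]]; first by rewrite mem_iota; lia.
by exists (absz (i + K%:Z)%R); rewrite ?mem_iota; lia.
Qed.

Lemma window_mono K L : (K <= L)%N -> {subset window K <= window L}.
Proof. by move=> KL i; rewrite !mem_window; lia. Qed.

Lemma window_cover i : exists K, i \in window K.
Proof. by exists (absz i).+1; rewrite mem_window; lia. Qed.

Lemma closure_seqZ (A : set seqZ) s :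
  closure A s <-> forall K : nat, exists2 x, A x &
     forall i : int, - K%:Z <= i < K%:Z -> x i = s i.
Proof.
rewrite (closure_cylinder window_mono window_cover).
by split=> h K; have [x Ax hx] := h K; exists x => // i;
    have := hx i; rewrite mem_window.
Qed.

Lemma nbhs_seqZ (s : seqZ) U :
  nbhs s U <-> exists K : nat, forall x : seqZ,
    (forall i : int, - K%:Z <= i < K%:Z -> x i = s i) -> U x.
Proof.
rewrite (nbhs_cylinder window_mono window_cover).
by split=> -[K hK]; exists K => x hx; apply: hK => i;
    have := hx i; rewrite mem_window.
Qed.

(** * The minimal sets as sets of sequences with factors in alpha, and their paths *)

Section Language.
Context (n : nat -> nat).
Hypothesis n_pos : forall k : nat, (0 < k)%N -> (0 < n k)%N.

Definition occurs (w : word) : Prop := exists N, infix w (LambdaK n N [:: L3]).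

Lemma infix_LambdaK k u v : infix u v -> infix (LambdaK n k u) (LambdaK n k v).
Proof. by move=> /infixP[p [q ->]]; rewrite !LambdaK_cat infix_infix. Qed.

Lemma LambdaK_shift k w : LambdaK n k.+1 w = LambdaK n k (Lambda (n k.+1) w).
Proof. by []. Qed.

Lemma occurs_infix u v : infix u v -> occurs v -> occurs u.
Proof. by move=> uv [N vN]; exists N; exact: infix_trans uv vN. Qed.

(** 23 is a factor of the image of 12, which is a factor of the image of 31, which is a factor of
    the image of 3; the last two use n > 0. With [occurs_13] this puts both pasts of alpha into the
    minimal set. *)
Lemma occurs_23 k : occurs (LambdaK n k [:: L2; L3]).
Proof.
have step m u v : infix u v -> infix (Lambda m u) (Lambda m v).
  by move=> /infixP[p [q ->]]; rewrite !Lambda_cat infix_infix.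
exists k.+3; rewrite !LambdaK_shift; apply: infix_LambdaK.
have i1 : infix [:: L2; L3] (Lambda (n k.+1) [:: L1; L2]).
  by rewrite -[[:: L1; L2]]cat1s Lambda_cat !Lambda_letter /= prefix0s.
have i2 : infix [:: L1; L2] (Lambda (n k.+2) [:: L3; L1]).
  rewrite -[[:: L3; L1]]cat1s Lambda_cat !Lambda_letter /= addn0.
  case: (n k.+2) (n_pos (ltn0Sn k.+1)) => // b _; apply/infixP.
  by exists (nseq b L1), [::]; rewrite -[b.+1]addn1 nseqD /= -catA.
have i3 : infix [:: L3; L1] (Lambda (n k.+3) [:: L3]).
  rewrite Lambda_letter /= addn0.
  by case: (n k.+3) (n_pos (ltn0Sn k.+2)) => // c _; rewrite /= prefix0s.
exact: infix_trans i1 (step _ _ _ (infix_trans i2 (step _ _ _ i3))).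
Qed.

Lemma occurs_13 k : occurs (LambdaK n k [:: L1; L3]).
Proof.
apply: occurs_infix (occurs_23 k.+1); rewrite LambdaK_shift; apply: infix_LambdaK.
rewrite -[[:: L2; L3]]cat1s Lambda_cat !Lambda_letter /= addn1.
apply/infixP; exists (nseq (n k.+1) L1), (nseq (n k.+1 + 0) L1).
by rewrite -[(n k.+1).+1]addn1 nseqD /= -catA.
Qed.

Lemma occurs_letter k a : occurs (LambdaK n k [:: a]).
Proof.
case: (letterP a) => ->.
- by apply: occurs_infix (occurs_13 k); apply: infix_LambdaK.
- by apply: occurs_infix (occurs_23 k); apply: infix_LambdaK.
- by exists k; exact: infix_refl.
Qed.

Lemma occurs_alpha w : occurs w -> exists m, forall i, (i < size w)%N ->
  alpha n (m + i)%N = nth L1 w i.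
Proof.
move=> [N /infixP[p [q E]]]; exists (size p) => i iw.
have iN : (size p + i < size (LambdaK n N [:: L3]))%N.
  by rewrite E !size_cat ltn_add2l ltn_addr.
rewrite -(nth_mkseq L1 (alpha n) iN) alphaE E nth_cat ltnNge leq_addr /= addKn.
by rewrite nth_cat iw.
Qed.

Lemma joinZ_word (b a : nat -> letter) (u v : word) :
  mkseq b (size u) = rev u -> mkseq a (size v) = v ->
  forall i, (i < size (u ++ v))%N ->
    joinZ b a (i%:Z - (size u)%:Z) = nth L1 (u ++ v) i.
Proof.
move=> bE aE i; rewrite size_cat nth_cat; have [iu _|ui iv] := ltnP i (size u).
  have -> : i%:Z - (size u)%:Z = Negz (size u - i.+1) by lia.
  have lt : (size u - i.+1 < size u)%N by lia.
  rewrite /= -(nth_mkseq L1 b lt) bE nth_rev //; congr nth; lia.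
have -> : i%:Z - (size u)%:Z = (i - size u)%N%:Z by lia.
have lt : (i - size u < size v)%N by lia.
by rewrite /= -(nth_mkseq L1 a lt) aE.
Qed.

Definition in_lang (x : seqZ) : Prop :=
  forall K : nat, exists m : nat, forall i, (i < 2 * K)%N ->
    x (i%:Z - K%:Z) = alpha n (m + i)%N.

Lemma in_lang_words (x : seqZ) : (forall K : nat, exists (w : word) (p : nat),
    [/\ occurs w, (K <= p)%N, (p + K <= size w)%N
      & forall i, (i < size w)%N -> x (i%:Z - p%:Z) = nth L1 w i]) ->
  in_lang x.
Proof.
move=> h K; have [w [p [/occurs_alpha[m hm] Kp pK hx]]] := h K.
exists (m + (p - K))%N => i iK; rewrite -addnA hm; last lia.
by rewrite -hx; [congr (x _); lia|lia].
Qed.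

Lemma joinZ_in_lang (b : nat -> letter) (c : letter) :
  (forall k, mkseq b (size (LambdaK n (2 * k) [:: c])) = rev (LambdaK n (2 * k) [:: c])) ->
  (forall k, occurs (LambdaK n k [:: c; L3])) -> in_lang (joinZ b (alpha n)).
Proof.
move=> bE oc; apply: in_lang_words => K; pose k := K.+1.
have sc := size_LambdaK_unbounded n_pos (2 * k) c.
have s3 := size_LambdaK3 n_pos (2 * k).
exists (LambdaK n (2 * k) [:: c; L3]), (size (LambdaK n (2 * k) [:: c])).
rewrite LambdaK_cons size_cat; split.
- by rewrite -LambdaK_cons.
- by apply: leq_trans sc; rewrite /k; lia.
- by rewrite leq_add2l; apply: leq_trans (ltnW s3); rewrite /k; lia.
- by move=> i; rewrite -size_cat; apply: joinZ_word => //; exact: alphaE.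
Qed.

Lemma t_in_lang : in_lang (t_seq n).
Proof. exact: joinZ_in_lang (betaE n) occurs_13. Qed.

Lemma t_hat_in_lang : in_lang (t_hat n).
Proof. exact: joinZ_in_lang (beta_hatE n) occurs_23. Qed.

Lemma in_lang_shift x j : in_lang x -> in_lang (shiftZ j x).
Proof.
move=> h K; have [m hm] := h (K + absz j)%N.
exists (m + absz (j + (absz j)%:Z)%R)%N => i iK.
by rewrite /shiftZ -addnA -hm; [congr (x _); lia|lia].
Qed.

Lemma DeltaE x : Delta n x <-> in_lang x.
Proof.
rewrite /Delta closure_seqZ; split.
- move=> h K; have [y [j ->] hy] := h K.
  have [m hm] := in_lang_shift j t_in_lang K.
  by exists m => i iK; rewrite -hm // hy //; lia.
- move=> h K; have [m hm] := h K.
  exists (shiftZ (m%:Z + K%:Z) (t_seq n)); first by exists (m%:Z + K%:Z).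
  move=> i iK; have ik : (absz (i + K%:Z)%R < 2 * K)%N by lia.
  have := hm _ ik; have -> : ((absz (i + K%:Z)%R)%:Z - K%:Z) = i by lia.
  move=> ->; rewrite /shiftZ.
  by have -> : i + (m%:Z + K%:Z) = (m + absz (i + K%:Z)%R)%N%:Z by lia.
Qed.

Lemma DeltaPE s : DeltaP n s <-> forall K, exists j, forall i, (i < K)%N ->
  s i = alpha n (j + i)%N.
Proof.
rewrite /DeltaP closure_seqN; split=> h K.
- have [x [j ->] hx] := h K; exists j => i iK.
  by rewrite -hx // /shiftN addnC.
- have [j hj] := h K; exists (shiftN j (alpha n)); first by exists j.
  by move=> i iK; rewrite hj // /shiftN addnC.
Qed.

Lemma Delta_shift x j : Delta n x -> Delta n (shiftZ j x).
Proof. by rewrite !DeltaE; exact: in_lang_shift. Qed.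

Lemma Delta_proj x : Delta n x -> DeltaP n (projN x).
Proof.
move=> /DeltaE h; apply/DeltaPE => K; have [m hm] := h K.
exists (m + K)%N => i iK; rewrite /projN -addnA -hm; last lia.
by congr (x _); lia.
Qed.

Lemma Delta_t : Delta n (t_seq n).
Proof. exact/DeltaE/t_in_lang. Qed.

Lemma Delta_t_hat : Delta n (t_hat n).
Proof. exact/DeltaE/t_hat_in_lang. Qed.

Lemma path_Delta G : is_path n G -> exists2 x, Delta n x & projN x = H n G.
Proof.
move=> pG; have [SG|nS1] := pselect (S1 n G).
  have [L [M [_ -> _ _ _]]] := H_S1 n_pos SG.
  by exists (shiftZ (- L%:Z) (t_seq n)) => //; exact/Delta_shift/Delta_t.
have [SG|nS1h] := pselect (S1_hat n G).
  have [L [M [_ -> _ _ _]]] := H_S1_hat n_pos SG.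
  by exists (shiftZ (- L%:Z) (t_hat n)) => //; exact/Delta_shift/Delta_t_hat.
have [SG|nS2] := pselect (S2 n G).
  have [J [-> _ _]] := H_S2 n_pos SG.
  exists (shiftZ J%:Z (t_seq n)); first exact/Delta_shift/Delta_t.
  by apply/funext => i; rewrite /projN /shiftZ /shiftN /=.
exists (fill (W n G)); last by rewrite /H !asboolF.
apply/DeltaE/in_lang_words => K.
have [N1 h1] := unbounded_left K pG nS2.
have [N2 h2] := unbounded_right n_pos K pG nS1 nS1h.
pose N := maxn N1 N2.
have sl := leq_trans h1 (size_leftU_mono n G (leq_maxl N1 N2)).
have sr := leq_trans h2 (size_rightW_mono n G (leq_maxr N1 N2)).
rewrite -/N in sl sr.
exists (leftU n G N ++ rightW n G N), (size (leftU n G N)); split.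
- by rewrite -(path_split (path_uptoW pG)); exact: occurs_letter.
- exact: ltnW.
- by rewrite size_cat leq_add2l ltnW.
- have -> : fill (W n G) = joinZ (fun i => odflt L1 (W n G (Negz i)))
                                 (fun i => odflt L1 (W n G i%:Z)).
    by apply/funext => -[].
  apply: joinZ_word.
    apply: (@eq_from_nth _ L1); rewrite ?size_mkseq ?size_rev // => i iN.
    by rewrite nth_mkseq // (W_leftE iN).
  by apply: mkseq_rightW => i iN; rewrite (W_rightE iN).
Qed.

Lemma path_DeltaP G : is_path n G -> DeltaP n (H n G).
Proof. by move=> /path_Delta[x Dx <-]; exact: Delta_proj. Qed.

(** The first nonempty v from level N on, at level M say, begins with 1, and the image of 1 at level
    M begins with the image of 3 at level M - 2, a prefix of alpha. So even a path of infinite word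
    reads alpha for a while after stage N. *)
Lemma H_after_rightW G N i : is_path n G -> ~ S1 n G -> ~ S1_hat n G ->
  (i.+1 < N)%N -> H n G (size (rightW n G N) + i)%N = alpha n i.
Proof.
move=> pG nS1 nS1h iN.
have ex : exists k, (N <= k)%N && (edge_v (G k) != [::]).
  apply: contrapT => h; case: (finite_right n_pos pG) => //; exists N => k Nk.
  by apply/eqP/negPn/negP => vk; apply: h; exists k; rewrite Nk.
case: (ex_minnP ex) => M /andP[NM vM] minM.
have cst : rightW n G M = rightW n G N.
  move: NM minM {vM}; move=> /subnKC <-; elim: (M - N)%N => [|d IH] minM; first by rewrite addn0.
  rewrite addnS /rightW /=; have -> : edge_v (G (N + d)%N) = [::].
    apply/eqP/negPn/negP => vd; have := minM (N + d)%N; rewrite leq_addr vd => /(_ isT).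
    by rewrite addnS ltnn.
  rewrite LambdaK_nil cats0; apply: IH => k hk; apply: ltnW; rewrite -addnS.
  exact: minM.
have := H_prefix n_pos M.+1 pG.
have -> : rightW n G M.+1 = rightW n G N ++ LambdaK n M (edge_v (G M)) by rewrite -cst.
have [c ->] : exists c, edge_v (G M) = L1 :: nseq c L1.
  have : exists c, edge_v (G M) = nseq c L1.
    by case: (path_edge M pG) => [|a _|a j _ _]; [exists 0%N|eexists|eexists].
  by move=> [[|c] vE]; rewrite vE // in vM *; exists c.
case: M NM {ex minM cst vM} => [|[|M]] NM; [lia|lia|].
have /prefixP[q ->] : prefix (LambdaK n M [:: L3]) (LambdaK n M.+2 (L1 :: nseq c L1)).
  rewrite (LambdaK_cons _ M.+2) /= Lambda_letter /= Lambda_letter /=.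
  by rewrite (LambdaK_cons _ _ _ (nseq _ _)) -catA prefix_prefix.
move=> E; have iM : (i < size (LambdaK n M [:: L3]))%N.
  by apply: leq_ltn_trans (size_LambdaK3 n_pos M); lia.
have := congr1 (fun w => nth L1 w (size (rightW n G N) + i)%N) E.
rewrite nth_mkseq; last by rewrite !size_cat ltn_add2l ltn_addr.
move=> ->; rewrite nth_cat ltnNge leq_addr /= addKn nth_cat iM.
by rewrite -alphaE nth_mkseq.
Qed.

Lemma ultra_finite (T : Type) (E : eqType) (U : set_system T) (f : T -> E) (r : seq E) :
  UltraFilter U -> (forall x, f x \in r) -> exists e, U [set x | f x = e].
Proof.
move=> UU; have PU : ProperFilter U by exact: ultra_proper.
move=> fr; have : U [set x | f x \in r] by apply: (filterS _ filterT) => x _; exact: fr.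
elim: r {fr} => [h|e r IH h].
  by have [x] := filter_ex h.
have [he|he] := in_ultra_setVsetC [set x | f x = e] UU; first by exists e.
apply: IH; apply: (filterS _ (filterI h he)) => x [/=].
by rewrite inE => /orP[/eqP|].
Qed.

Lemma edge_finite k : exists r : seq edge, forall G, is_path n G -> G k \in r.
Proof.
pose f (a : letter) (l : nat) : edge := let w := Lambda (n k.+1) [:: a] in
  (take l w, nth L1 w l, drop l.+1 w).
exists [seq f a l | a <- enum 'I_3, l <- iota 0 (size (Lambda (n k.+1) [:: a]))].
move=> G pG; apply/allpairsPdep; exists (edge_a (G k.+1)), (size (edge_u (G k))).
split; first by rewrite mem_enum.
  by rewrite mem_iota pG size_cat /=; lia.
rewrite /f pG take_size_cat // nth_cat ltnn subnn /= -cat_rcons drop_size_cat ?size_rcons //.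
exact: edge_eta.
Qed.

(* The paths of the shifts of [alpha] approximating [s] accumulate at a path,
   since each of their entries takes finitely many values. *)
Lemma DeltaP_path s : DeltaP n s -> exists2 G, is_path n G & H n G = s.
Proof.
move=> /DeltaPE h.
have /choice[GK hGK] : forall K, exists G, S2 n G /\ forall i, (i < K)%N -> H n G i = s i.
  move=> K; have [j hj] := h K; have [G SG HG] := S2_shift_alpha n_pos j.
  by exists G; split => // i iK; rewrite HG hj // /shiftN addnC.
have [U [UU sU]] := ultraFilterLemma (F := nbhs (\oo : set_system nat)) _.
have PU : ProperFilter U by exact: ultra_proper.
have pGK K : is_path n (GK K) by have [[]] := hGK K.
have /choice[G hG] : forall k, exists e, U [set K | GK K k = e].
  move=> k; have [r hr] := edge_finite k.
  by apply: (ultra_finite (r := r)) => // K; exact: hr.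
have agree N M : exists K, (M <= K)%N /\ forall k, (k < N)%N -> GK K k = G k.
  have : U [set K | (M <= K)%N /\ forall k : 'I_N, GK K k = G k].
    apply: filterI; first by apply: sU; exact: nbhs_infty_ge.
    by apply: filter_forall => k; exact: hG.
  move=> /filter_ex[K [MK hK]]; exists K; split => // k kN.
  exact: (hK (Ordinal kN)).
have pG : is_path n G.
  move=> i; have [K [_ hK]] := agree i.+2 0%N.
  by rewrite -!hK // pGK.
have rightE N K : (forall k, (k < N)%N -> GK K k = G k) -> (0 < N)%N ->
    rightW n (GK K) N = rightW n G N.
  move=> hK N0; rewrite /rightW hK //; congr (_ :: _).
  elim: N {N0} hK => //= N IH hK; rewrite hK // IH // => k kN.
  exact/hK/ltnW.
have small N i : (i < size (rightW n G N))%N -> s i = H n G i.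
  move=> iN; have iN1 := leq_trans iN (size_rightW_mono n G (leqnSn N)).
  have [K [iK hK]] := agree N.+1 i.+1.
  have [_ <-//] := hGK K.
  have := congr1 (fun w => nth L1 w i) (H_prefix n_pos N.+1 (pGK K)).
  have := congr1 (fun w => nth L1 w i) (H_prefix n_pos N.+1 pG).
  by rewrite rightE // !nth_mkseq // => -> ->.
have nK K : ~ S1 n (GK K) /\ ~ S1_hat n (GK K).
  have [SG _] := hGK K; split.
    by move=> /S1_not_S2; apply.
  by move=> /S1_hat_not_S2; apply.
(* The limit path may have a finite right word, which [H] continues with alpha. The approximating
   paths share its stage N word, and by [H_after_rightW] they read alpha after it as well. *)
have big L M : (forall N, (M <= N)%N -> size (rightW n G N) = L) ->
    (forall i, H n G (i + L)%N = alpha n i) -> H n G = s.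
  move=> hL HL; apply/funext => i; have [iL|Li] := ltnP i L.
    by rewrite -(@small M i) // hL.
  rewrite -(subnK Li) HL; set j := (i - L)%N.
  pose N := (M + j.+2)%N.
  have [K [iK hK]] := agree N (i.+1)%N.
  have [_ hs] := hGK K; have [n1 n2] := nK K.
  rewrite -hs; last by rewrite /j; lia.
  rewrite -(@H_after_rightW (GK K) N j) //; last by rewrite /N; lia.
  rewrite rightE // ?hL; [by rewrite addnC|by rewrite /N; lia|by rewrite /N; lia].
exists G => //; have [SG|nS1] := pselect (S1 n G).
  by have [L [M [_ _ hL _ HL]]] := H_S1 n_pos SG; exact: big hL HL.
have [SG|nS1h] := pselect (S1_hat n G).
  by have [L [M [_ _ hL _ HL]]] := H_S1_hat n_pos SG; exact: big hL HL.
apply/funext => i; have [N iN] := unbounded_right n_pos i pG nS1 nS1h.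
by rewrite -(@small N i).
Qed.

End Language.

(** * The pasts of w and w-hat *)

Section MaxPaths.
Context (n : nat -> nat).
Hypothesis n_pos : forall k : nat, (0 < k)%N -> (0 < n k)%N.

Lemma G_2max_path : is_path n (G_2max n).
Proof.
move=> i; rewrite /G_2max /=; case: (odd i) => /=; rewrite Lambda_letter //=.
by rewrite addn1.
Qed.

Lemma G_3max_path : is_path n (G_3max n).
Proof.
move=> [|i]; rewrite /G_3max /= Lambda_letter /=; first by rewrite addn1.
by case: (odd i) => //=; rewrite addn1.
Qed.

(** Two consecutive edges contribute the same word in both paths, since 3 1^n at level 2k is the
    image of the 3 standing at level 2k + 1. Hence w has the past of t without its last letter. *)
Lemma leftU_2max k : leftU n (G_2max n) (2 * k) = leftU n (G_beta n) (2 * k).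
Proof.
elim: k => // k IH; rewrite mulnS add2n /= -IH /G_2max /G_beta /= oddM /=.
by rewrite LambdaK_nil /= Lambda_letter addn0.
Qed.

Lemma leftU_3max k : leftU n (G_3max n) (2 * k).+1 = leftU n (G_beta_hat n) (2 * k).
Proof.
elim: k => // k IH; rewrite mulnS add2n -[leftU n (G_3max n) _.+1]/(
  LambdaK n (2 * k).+2 (edge_u (G_3max n (2 * k).+2)) ++
  LambdaK n (2 * k).+1 (edge_u (G_3max n (2 * k).+1)) ++ leftU n (G_3max n) (2 * k).+1).
rewrite IH /G_3max /G_beta_hat /= oddM /=.
by rewrite !LambdaK_nil /= Lambda_letter addn0.
Qed.

Lemma fill_W_left G (b : nat -> letter) c (d : nat) : 
  (forall k, mkseq b (size (LambdaK n (2 * k) [:: c])) = rev (LambdaK n (2 * k) [:: c])) ->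
  (forall k, LambdaK n (2 * k) [:: c] = leftU n G (2 * k + d) ++ [:: c]) ->
  forall i, fill (W n G) (Negz i) = b i.+1.
Proof.
move=> bE hU i; pose k := i.+2.
have sk := size_LambdaK_unbounded n_pos (2 * k) c.
have ik : (i.+1 < size (LambdaK n (2 * k) [:: c]))%N by apply: leq_trans sk; rewrite /k; lia.
rewrite -(nth_mkseq L1 b ik) bE hU rev_cat /=.
by rewrite /fill (@W_leftE _ _ (2 * k + d)) //; move: ik; rewrite hU size_cat /=; lia.
Qed.

Lemma w_seq_left i : w_seq n (Negz i) = t_seq n (Negz i.+1).
Proof.
apply: (@fill_W_left _ _ L1 0); first exact: betaE.
move=> k; have := path_split (path_uptoW (N := 2 * k) (G_beta_path n)).
have V0 j : rightV n (G_beta n) j = [::].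
  by elim: j => //= j ->; rewrite beta_v LambdaK_nil.
by rewrite beta_a V0 addn0 leftU_2max.
Qed.

Lemma w_hat_left i : w_hat n (Negz i) = t_hat n (Negz i.+1).
Proof.
apply: (@fill_W_left _ _ L2 1); first exact: beta_hatE.
move=> k; have := path_split (path_uptoW (N := 2 * k) (G_beta_hat_path n)).
have V0 j : rightV n (G_beta_hat n) j = [::].
  by elim: j => //= j ->; rewrite beta_hat_v LambdaK_nil.
by rewrite beta_hat_a V0 addn1 leftU_3max.
Qed.

End MaxPaths.

(** * The order of the extended interval in coordinates *)

Section ItildeOrder.
Context (R : realType) (m1 m2 : R).

Lemma Ival_pt y : 0 <= y <= 1 -> Ival (pt m1 m2 y) = (y, false).
Proof. by move=> y01; rewrite /pt insubdK // /in_Itilde unfold_in /= y01. Qed.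

Lemma Ival_dup y : 0 <= y <= 1 -> D_itm m1 m2 y -> Ival (dup m1 m2 y) = (y, true).
Proof.
move=> y01 Dy; rewrite /dup insubdK // unfold_in /in_Itilde /= y01 /=.
exact/asboolP.
Qed.

Lemma lt_Ival (x y : Itilde m1 m2) : (x < y) =
  ((Ival x).1 < (Ival y).1)
  || ((Ival x).1 == (Ival y).1) && (~~ (Ival x).2 && (Ival y).2).
Proof.
rewrite -[LHS]lt_val /=; case: (Ival x) (Ival y) => [a b] [c d].
rewrite ltEprodlexi /=; case: (ltgtP a c) => //= _.
by case: b d => -[].
Qed.

Lemma le_Ival (x y : Itilde m1 m2) : (x <= y) =
  ((Ival x).1 < (Ival y).1)
  || ((Ival x).1 == (Ival y).1) && ((Ival x).2 ==> (Ival y).2).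
Proof.
rewrite leNgt lt_Ival; case: (Ival x) (Ival y) => [a b] [c d] /=.
by rewrite [c == a]eq_sym; case: (ltgtP a c) => //= _; case: b d => -[].
Qed.

End ItildeOrder.

(** * Equivariance, order reversal and itineraries *)

Section Coding.
Context (R : realType) (n : nat -> nat).
Hypothesis n_pos : forall k : nat, (0 < k)%N -> (0 < n k)%N.

Local Notation g := (gell R n).
Local Notation m1 := (mu1 R n).
Local Notation m2 := (mu2 R n).

Lemma gell_pp_gt0 k : 0 < pp n g k. Proof. by have [] := gell_pos R n_pos k. Qed.
Lemma gell_qq_gt0 k : 0 < qq n g k. Proof. by have [] := gell_pos R n_pos k. Qed.
Lemma gell_rr_gt0 k : 0 < rr n g k. Proof. by have [] := gell_pos R n_pos k. Qed.

Let gp := gell_pp_gt0.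
Let gq := gell_qq_gt0.
Let gr := gell_rr_gt0.

Lemma mu_bounds : [/\ 0 < m1, m1 < m2, m2 < 1 & m2 <= 1 - m1].
Proof.
rewrite mu1E mu2E; have := qq_rr1 R n_pos; have := gq 0; have := gp 0; have := gr 1.
have := qq_lt_pp n_pos gp gq gr 0; have := pp_le_rr n_pos gp 0.
by split; lra.
Qed.

Lemma gL1 : g L1 = - m2.
Proof. by rewrite mu2E /pp opprK /wsum big_seq1. Qed.

Lemma gL2 : g L2 = - m1.
Proof. by rewrite mu1E /qq opprK /wsum big_seq1. Qed.

Lemma gL3 : g L3 = 1 - m1.
Proof.
rewrite -(qq_rr1 R n_pos) mu1E /rr /wsum big_seq1; ring.
Qed.

Definition height (s : seqN) : R := Upsilon1 R n s.

Lemma H_invP s : DeltaP n s -> is_path n (H_inv n s) /\ H n (H_inv n s) = s.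
Proof.
move=> /(DeltaP_path n_pos)[G pG HG]; rewrite /H_inv.
by case: xgetP => [? _ //|/(_ G)[]].
Qed.

Lemma height_Psi s : DeltaP n s -> height s = Psi n g (H_inv n s).
Proof. by move=> /H_invP[pG _]; rewrite -Psi_L_gell. Qed.

Lemma Val_height s : DeltaP n s -> Val g s (height s).
Proof.
move=> Ds; have [pG HG] := H_invP Ds.
by rewrite height_Psi // -{1}HG; exact: Val_H.
Qed.

(** Both sides satisfy [Val] for the same sequence, so the value does not depend on which path
    [H_inv] picks. *)
Lemma height_H G : is_path n G -> height (H n G) = Psi n g G.
Proof.
move=> pG; apply: (Val_uniq (g := g) (s := H n G)); last exact: Val_H.
exact/Val_height/path_DeltaP.
Qed.

Lemma DeltaP_shiftN s j : DeltaP n s -> DeltaP n (shiftN j s).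
Proof.
move=> /DeltaPE h; apply/DeltaPE => K; have [m hm] := h (K + j)%N.
exists (m + j)%N => i iK; rewrite /shiftN hm; last lia.
by congr alpha; lia.
Qed.

Lemma height_shift s : DeltaP n s -> height (shiftN 1 s) = height s + g (s 0%N).
Proof.
move=> Ds; apply: (Val_uniq (g := g) (s := shiftN 1 s)).
  exact/Val_height/DeltaP_shiftN.
have := Val_shift 1 (Val_height Ds).
rewrite /wsum big_seq1; congr Val; apply/funext => j.
by rewrite /shiftN addnC.
Qed.

Lemma height_range s : DeltaP n s -> lo n g 0 (s 0%N) <= height s <= hi n g 0 (s 0%N).
Proof.
move=> Ds; have [pG HG] := H_invP Ds.
rewrite height_Psi // -Y0 -{1 4}HG H0 //.
by rewrite Y_lo // Y_hi.
Qed.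

Lemma height_cases s : DeltaP n s ->
  [\/ [/\ s 0%N = L1, m2 <= height s & height s <= 1],
      [/\ s 0%N = L2, m1 <= height s & height s <= m2] |
      [/\ s 0%N = L3, 0 <= height s & height s <= m1]].
Proof.
move=> Ds; have := height_range Ds; rewrite /lo /hi qq_rr1 // -mu1E -mu2E.
by case: (letterP (s 0%N)) => -> /andP[h1 h2]; [constructor 1|constructor 2|constructor 3].
Qed.

Lemma height01 s : DeltaP n s -> 0 <= height s <= 1.
Proof.
have [h1 h2 h3 h4] := mu_bounds.
by move=> /height_cases[] [_ ? ?]; apply/andP; split; lra.
Qed.

Lemma DeltaP_alpha : DeltaP n (alpha n).
Proof. by apply/DeltaPE => K; exists 0%N. Qed.

Lemma height_alpha : height (alpha n) = 0.
Proof.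
apply: (Val_uniq (g := g) (s := alpha n)); last exact: Val_alpha.
exact/Val_height/DeltaP_alpha.
Qed.

Lemma height_eq0 s : DeltaP n s -> height s = 0 -> s = alpha n.
Proof.
move=> Ds; have [pG HG] := H_invP Ds.
by rewrite height_Psi // => /(Psi_eq0_H n_pos gp gq gr pG) <-.
Qed.

Definition hits_alpha (s : seqN) : Prop :=
  exists2 i, (0 < i)%N & shiftN i s = alpha n.

Lemma H_hits_alpha G : is_path n G -> hits_alpha (H n G) -> S1 n G \/ S1_hat n G.
Proof.
move=> pG [i i0 hi]; apply: contrapT => /not_orP[nS1 nS1h].
apply: (no_return n_pos gp gq gr pG nS1 nS1h i0) => j.
by rewrite -hi /shiftN addnC.
Qed.

Lemma hits_alphaP s : DeltaP n s -> hits_alpha s ->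
  (exists2 j, (0 < j)%N & s = projN (shiftZ (- j%:Z) (t_seq n)))
  \/ (exists2 j, (0 < j)%N & s = projN (shiftZ (- j%:Z) (t_hat n))).
Proof.
move=> Ds; have [pG <-] := H_invP Ds => /(H_hits_alpha pG)[SG|SG].
  by left; have [L [M [L0 -> _ _ _]]] := H_S1 n_pos SG; exists L.
by right; have [L [M [L0 -> _ _ _]]] := H_S1_hat n_pos SG; exists L.
Qed.

Lemma shiftN_projN_joinZ (b a : nat -> letter) j :
  shiftN j (projN (shiftZ (- j%:Z) (joinZ b a))) = a.
Proof.
apply/funext => i; rewrite /shiftN /projN /shiftZ.
by have -> : (i + j)%N%:Z + - j%:Z = i by lia.
Qed.

Lemma hits_t j : (0 < j)%N -> hits_alpha (projN (shiftZ (- j%:Z) (t_seq n))).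
Proof. by exists j => //; rewrite shiftN_projN_joinZ. Qed.

Lemma hits_t_hat j : (0 < j)%N -> hits_alpha (projN (shiftZ (- j%:Z) (t_hat n))).
Proof. by exists j => //; rewrite shiftN_projN_joinZ. Qed.

Lemma shiftN_shiftN i j (s : seqN) : shiftN i (shiftN j s) = shiftN (j + i) s.
Proof. by apply/funext => k; rewrite /shiftN -addnA [(i + j)%N]addnC. Qed.

Lemma shiftN0 (s : seqN) : shiftN 0 s = s.
Proof. by apply/funext => i; rewrite /shiftN addn0. Qed.

Lemma alpha_orbit_not_hits j : ~ hits_alpha (shiftN j (alpha n)).
Proof.
have [G SG <-] := S2_shift_alpha n_pos j; have [pG _] := SG.
by move=> /(H_hits_alpha pG)[/S1_not_S2|/S1_hat_not_S2]; apply.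
Qed.

Lemma alpha_not_hits : ~ hits_alpha (alpha n).
Proof. by rewrite -[alpha n]shiftN0; exact: alpha_orbit_not_hits. Qed.

Lemma hits_shift s : hits_alpha (shiftN 1 s) -> hits_alpha s.
Proof. by move=> [i i0]; rewrite shiftN_shiftN => hi; exists (1 + i)%N. Qed.

Lemma hits_shiftV s : hits_alpha s -> hits_alpha (shiftN 1 s) \/ shiftN 1 s = alpha n.
Proof.
move=> [[//|[|i]] _ hi]; [by right|left; exists i.+1 => //].
by rewrite shiftN_shiftN.
Qed.

(** Any path representing [s] has maximal value for its first letter, so by [max_path_not] it lies
    in none of the three tail classes; reaching alpha, or lying on its orbit, would give a path in
    one of them. *)
Lemma height_max s : DeltaP n s -> height s = hi n g 0 (s 0%N) ->
  ~ hits_alpha s /\ forall j, s <> shiftN j (alpha n).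
Proof.
move=> Ds hs.
have key G : is_path n G -> H n G = s -> [/\ ~ S1 n G, ~ S1_hat n G & ~ S2 n G].
  move=> pG HG; apply: (max_path_not n_pos gp gq gr pG).
  by rewrite -height_H // HG hs -HG H0.
split.
  have [pG HG] := H_invP Ds; have [n1 n2 _] := key _ pG HG.
  by rewrite -HG => /(H_hits_alpha pG)[].
move=> j sE; have [G SG HG] := S2_shift_alpha n_pos j.
by have [] := key G (proj1 SG); rewrite ?HG.
Qed.

Lemma hits_lt_max s : DeltaP n s -> hits_alpha s ->
  [\/ [/\ s 0%N = L1, m2 <= height s & height s < 1],
      [/\ s 0%N = L2, m1 <= height s & height s < m2] |
      [/\ s 0%N = L3, 0 <= height s & height s < m1]].
Proof.
move=> Ds hs.
have hne : height s != hi n g 0 (s 0%N).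
  by apply/eqP => /(height_max Ds)[].
have [[sE h1 h2]|[sE h1 h2]|[sE h1 h2]] := height_cases Ds;
  move: hne; rewrite sE /hi /= ?qq_rr1 -?mu1E -?mu2E // => hne.
- by constructor 1; split => //; rewrite lt_neqAle hne.
- by constructor 2; split => //; rewrite lt_neqAle hne.
- by constructor 3; split => //; rewrite lt_neqAle hne.
Qed.

Lemma hits_L2 s : DeltaP n s -> s 0%N = L2 -> height s = m1 -> hits_alpha s.
Proof.
move=> Ds s0 hs; exists 1%N => //; apply: height_eq0; first exact: DeltaP_shiftN.
by rewrite height_shift // s0 gL2 hs subrr.
Qed.

Lemma hits_L1 s : DeltaP n s -> s 0%N = L1 -> height s = m2 -> hits_alpha s.
Proof.
move=> Ds s0 hs; exists 1%N => //; apply: height_eq0; first exact: DeltaP_shiftN.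
by rewrite height_shift // s0 gL1 hs subrr.
Qed.

(** At m1 and m2 the map [T_itm] takes the right-hand branch. This agrees with the letter, since a
    sequence that reaches alpha never attains the upper end of the range of its letter. *)
Lemma T_itm_hits s : DeltaP n s -> hits_alpha s ->
  T_itm m1 m2 (height s) = height (shiftN 1 s).
Proof.
move=> Ds hs; have [b1 b2 b3 b4] := mu_bounds; rewrite height_shift // /T_itm.
have [[-> h1 h2]|[-> h1 h2]|[-> h1 h2]] := hits_lt_max Ds hs.
- rewrite gL1 !ltNge h1 (le_trans (ltW b2)) //.
- by rewrite gL2 h2 ltNge h1.
- by rewrite gL3 h2; ring.
Qed.

(** One step before alpha the value is - g of the letter read, hence m1 or m2; for the letter 3 it
    would be negative. Earlier values reach it under [T_itm] by [T_itm_hits]. *)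
Lemma D_itm_hits s : DeltaP n s -> hits_alpha s -> D_itm m1 m2 (height s).
Proof.
move=> Ds hs; split; first exact: height01.
have [i i0 hi] := hs; elim: i s Ds hs i0 hi => // i IH s Ds hs _ hi.
case: i IH hi => [|i] IH hi.
  exists 0%N => /=; have := height_shift Ds; rewrite hi height_alpha => h0.
  have [b1 b2 b3 b4] := mu_bounds.
  have [[sE _ _]|[sE _ _]|[sE h1 h2]] := height_cases Ds; move: h0; rewrite sE.
  - by rewrite gL1; right; lra.
  - by rewrite gL2; left; lra.
  - by rewrite gL3; lra.
have Ds1 := DeltaP_shiftN (j := 1) Ds.
have hi1 : shiftN i.+1 (shiftN 1 s) = alpha n by rewrite shiftN_shiftN.
have hs1 : hits_alpha (shiftN 1 s) by exists i.+1.
have [k hk] := IH _ Ds1 hs1 isT hi1.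
by exists k.+1; rewrite iterSr T_itm_hits.
Qed.

(** A uniform form of the five-branch definition of [UpsilonTP]. *)
Definition code (s : seqN) : Itilde m1 m2 :=
  if `[< hits_alpha s >] then dup m1 m2 (height s) else pt m1 m2 (height s).

Lemma Ival_code s : DeltaP n s -> Ival (code s) = (height s, `[< hits_alpha s >]).
Proof.
move=> Ds; have h01 := height01 Ds; rewrite /code.
case: asboolP => hs; first by rewrite Ival_dup //; exact: D_itm_hits.
by rewrite Ival_pt.
Qed.

Lemma back_index_spec x e s :
  (exists2 j, back_index x e s = Some j &
     (0 < j)%N /\ s = projN (shiftZ (e - j%:Z) x))
  \/ (back_index x e s = None /\
      forall j : nat, (0 < j)%N -> s <> projN (shiftZ (e - j%:Z) x)).
Proof.
rewrite /back_index; case: xgetP => [r _ [j [j0 hj] ->]|h]; first by left; exists j.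
by right; split => // j j0 hj; apply: (h (Some j)); exists j.
Qed.

Lemma DeltaP_t (j : int) : DeltaP n (projN (shiftZ j (t_seq n))).
Proof. exact/Delta_proj/Delta_shift/Delta_t. Qed.

Lemma DeltaP_t_hat (j : int) : DeltaP n (projN (shiftZ j (t_hat n))).
Proof. exact/Delta_proj/Delta_shift/Delta_t_hat. Qed.

(** Both sides change by the weight of the same letter at each step back, so equality at the first
    step propagates; [x] has the past of [y] without its last letter, which explains the offset
    1. *)
Lemma height_same_past (x y : seqZ) (j : nat) :
    (forall i, x (Negz i) = y (Negz i.+1)) ->
    (forall j : int, DeltaP n (projN (shiftZ j y))) ->
    height (projN x) = height (projN (shiftZ (-1) y)) ->
    DeltaP n (projN (shiftZ (1 - (j.+1)%:Z) x)) ->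
  height (projN (shiftZ (1 - (j.+1)%:Z) x)) = height (projN (shiftZ (- (j.+1)%:Z) y)).
Proof.
move=> xy Dy h0; elim: j => [|j IH] Dx.
  have -> : projN (shiftZ (1 - 1) x) = projN x by apply/funext => i; rewrite /projN /shiftZ addr0.
  exact: h0.
set s := projN _ in Dx *; set s' := projN _.
have sE : shiftN 1 s = projN (shiftZ (1 - (j.+1)%:Z) x).
  by apply/funext => i; rewrite /s /shiftN /projN /shiftZ; congr x; lia.
have sE' : shiftN 1 s' = projN (shiftZ (- (j.+1)%:Z) y).
  by apply/funext => i; rewrite /s' /shiftN /projN /shiftZ; congr y; lia.
have := height_shift Dx; have := height_shift (Dy (- (j.+2)%:Z)); rewrite -/s' sE' sE.
rewrite IH; last by rewrite -sE; exact: DeltaP_shiftN.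
have -> : s 0%N = s' 0%N.
  rewrite /s /s' /projN /shiftZ.
  have -> : Posz 0 + (1 - (j.+2)%:Z) = Negz j by lia.
  have -> : Posz 0 + (- (j.+2)%:Z) = Negz j.+1 by lia.
  exact: xy.
by lra.
Qed.

(** The orbit passes through [projN x], which neither lies on the orbit of alpha nor reaches alpha;
    so alpha can be met neither before nor after it. *)
Lemma not_hits_past_max (x : seqZ) (j : nat) :
    DeltaP n (projN x) -> height (projN x) = hi n g 0 (x 0) ->
  ~ hits_alpha (projN (shiftZ (1 - (j.+1)%:Z) x)).
Proof.
move=> Dx hx [i i0 hi]; have [h1 h2] := height_max Dx hx.
set s := projN (shiftZ _ _) in hi.
have sE : shiftN j s = projN x.
  by apply/funext => k; rewrite /s /shiftN /projN /shiftZ; congr x; lia.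
have [ij|ji] := leqP i j.
  by apply: (h2 (j - i)%N); rewrite -sE -(subnKC ij) -shiftN_shiftN hi addKn.
apply: h1; exists (i - j)%N; first by rewrite subn_gt0.
by rewrite -sE shiftN_shiftN subnKC // ltnW.
Qed.

Lemma Psi_3max : Psi n g (G_3max n) = hi n g 0 L3.
Proof.
apply: (step_max_Psi n_pos gp gq gr (G_3max_path n)) => -[|k].
  by rewrite /cG /G_3max /= wsum_nil add0r /hi /= qqE.
rewrite /cG /G_3max /=; case: (odd k) => /=; rewrite /hi /=.
  by rewrite qqE addrC.
by rewrite LambdaK_nil wsum_nil add0r -ppE.
Qed.

Lemma Psi_2max : Psi n g (G_2max n) = hi n g 0 L2.
Proof.
apply: (step_max_Psi n_pos gp gq gr (G_2max_path n)) => k.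
rewrite /cG /G_2max /=; case: (odd k) => /=; rewrite /hi /=.
  by rewrite qqE addrC.
by rewrite LambdaK_nil wsum_nil add0r -ppE.
Qed.

Lemma projN_w_hat : projN (w_hat n) = H n (G_3max n).
Proof.
have [n1 n2 n3] := max_path_not n_pos gp gq gr (G_3max_path n) Psi_3max.
by rewrite /H !asboolF.
Qed.

Lemma projN_w_seq : projN (w_seq n) = H n (G_2max n).
Proof.
have [n1 n2 n3] := max_path_not n_pos gp gq gr (G_2max_path n) Psi_2max.
by rewrite /H !asboolF.
Qed.

Lemma height_last (x : seqZ) : (forall j : int, DeltaP n (projN (shiftZ j x))) ->
  projN x = alpha n -> height (projN (shiftZ (-1) x)) = - g (x (Negz 0)).
Proof.
move=> Dx xa; have := height_shift (Dx (-1)).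
have -> : shiftN 1 (projN (shiftZ (-1) x)) = projN x.
  by apply/funext => i; rewrite /shiftN /projN /shiftZ; congr x; lia.
rewrite xa height_alpha.
have -> : projN (shiftZ (-1) x) 0%N = x (Negz 0) by [].
lra.
Qed.

(** Each branch is compared with [code] by itself: pasts of alpha reach alpha, and sequences from w
    or w-hat have the same value by [height_same_past] but do not reach it. [hits_alphaP] shows that
    no sequence reaching alpha is left for the remaining branches. *)
Lemma UpsilonTP_code s : DeltaP n s -> UpsilonTP R n s = code s.
Proof.
move=> Ds; rewrite /UpsilonTP.
have [[j -> [j0 sE]]|[-> no_t_hat]] := back_index_spec (t_hat n) 0 s.
  rewrite sub0r in sE; rewrite /code asboolT; last by rewrite sE; exact: hits_t_hat.
  by rewrite /y_pt -sE.
have [[j -> [j0 sE]]|[-> no_w_hat]] := back_index_spec (w_hat n) 1 s.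
  case: j j0 sE => // j _ sE; have hw : height (projN (w_hat n)) = m1.
    by rewrite projN_w_hat height_H ?Psi_3max ?mu1E //; exact: G_3max_path.
  have Dw : DeltaP n (projN (w_hat n)) by rewrite projN_w_hat; exact/path_DeltaP/G_3max_path.
  rewrite /code asboolF.
    rewrite /y_pt -/(height _) -(@height_same_past (w_hat n)) ?sE //.
    - exact: w_hat_left.
    - exact: DeltaP_t_hat.
    - rewrite hw height_last //; last exact: DeltaP_t_hat.
      by rewrite /t_hat /= beta_hat0 gL2 opprK.
    - by rewrite -sE.
  rewrite sE; apply: not_hits_past_max => //; rewrite hw.
  have -> : w_hat n 0 = L3 by
    rewrite -[LHS]/(projN (w_hat n) 0%N) projN_w_hat H0 //; exact: G_3max_path.
  by rewrite mu1E.
have [[j -> [j0 sE]]|[-> no_t]] := back_index_spec (t_seq n) 0 s.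
  rewrite sub0r in sE; rewrite /code asboolT; last by rewrite sE; exact: hits_t.
  by rewrite /z_pt -sE.
have nh : ~ hits_alpha s.
  move=> /(hits_alphaP Ds)[[j j0 sE]|[j j0 sE]].
    by apply: (no_t j j0); rewrite sub0r.
  by apply: (no_t_hat j j0); rewrite sub0r.
rewrite /code asboolF //.
have [[j -> [j0 sE]]|[-> _]] := back_index_spec (w_seq n) 1 s; last by [].
case: j j0 sE => // j _ sE.
rewrite /z_pt -/(height _) -(@height_same_past (w_seq n)) -?sE //.
- exact: w_seq_left.
- exact: DeltaP_t.
- rewrite projN_w_seq height_H ?Psi_2max; last exact: G_2max_path.
  rewrite height_last //; last exact: DeltaP_t.
  by rewrite /t_seq /= beta0 gL1 opprK mu2E.
Qed.

Lemma Ival_UpsilonTP s : DeltaP n s ->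
  Ival (UpsilonTP R n s) = (height s, `[< hits_alpha s >]).
Proof. by move=> Ds; rewrite UpsilonTP_code // Ival_code. Qed.

Lemma UpsilonTP_alpha : UpsilonTP R n (alpha n) = pt m1 m2 0.
Proof.
rewrite (UpsilonTP_code DeltaP_alpha) /code asboolF; last exact: alpha_not_hits.
by rewrite height_alpha.
Qed.

Lemma UpsilonTP_shift s : DeltaP n s ->
  UpsilonTP R n (shiftN 1 s) = T_tildeN R n (UpsilonTP R n s).
Proof.
move=> Ds; have [b1 b2 b3 b4] := mu_bounds; have Ds1 := DeltaP_shiftN (j := 1) Ds.
rewrite /T_tildeN /T_tilde (Ival_UpsilonTP Ds).
case: asboolP => hs.
  have hl := hits_lt_max Ds hs.
  case: ifPn => [/orP hm|/norP[/eqP n1 /eqP n2]].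
    suff -> : shiftN 1 s = alpha n by exact: UpsilonTP_alpha.
    apply: height_eq0 => //; rewrite height_shift //.
    case: hl hm => -[-> h1 h2] [/eqP hE|/eqP hE]; rewrite ?gL1 ?gL2 ?gL3; lra.
  rewrite UpsilonTP_code // /code asboolT; first by rewrite T_itm_hits.
  case: (hits_shiftV hs) => // h1; exfalso.
  have := height_shift Ds; rewrite h1 height_alpha.
  case: hl => -[-> h2 h3]; rewrite ?gL1 ?gL2 ?gL3 => h4.
  - by apply: n2; lra.
  - by apply: n1; lra.
  - lra.
rewrite UpsilonTP_code // /code asboolF; last by move=> /hits_shift.
rewrite height_shift //; case: (height_cases Ds) => -[sE h1 h2].
- have h3 : height s != m2 by apply/eqP => /(hits_L1 Ds sE).
  rewrite (negbTE h3) gt_eqF; last by lra.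
  rewrite /T_itm !ltNge h1 (le_trans (ltW b2)) //= sE gL1 //.
- have h3 : height s != m1 by apply/eqP => /(hits_L2 Ds sE).
  rewrite (negbTE h3) sE gL2; case: eqP => [-> //|/eqP h4].
  by rewrite /T_itm ltNge h1 /= lt_neqAle h4 h2.
- rewrite sE gL3; case: eqP => [->|/eqP h3]; first by congr pt; ring.
  rewrite lt_eqF; last by lra.
  by rewrite /T_itm lt_neqAle h3 h2 /=; congr pt; ring.
Qed.

Lemma UpsilonTP_iter s j : DeltaP n s ->
  UpsilonTP R n (shiftN j s) = iter j (T_tildeN R n) (UpsilonTP R n s).
Proof.
move=> Ds; elim: j => [|j IH]; first by rewrite shiftN0.
by rewrite iterS -IH -UpsilonTP_shift ?shiftN_shiftN ?addn1 //; exact: DeltaP_shiftN.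
Qed.

(** At the first difference the ranges of the two letters meet at most in m1 or m2. In a tie the
    smaller letter is at the bottom of its range, so [s] reaches alpha next, while [s'] is at the
    top of its own and never does. Common earlier letters preserve this alternative. *)
Lemma UpsilonTP_lt s s' : DeltaP n s -> DeltaP n s' ->
  lex_lt s s' -> UpsilonTP R n s' < UpsilonTP R n s.
Proof.
move=> Ds Ds' [k [hk hlt]].
suff : height s' < height s \/ height s' = height s /\ ~ hits_alpha s' /\ hits_alpha s.
  rewrite lt_Ival !Ival_UpsilonTP //= => -[->//|[-> [h1 h2]]].
  by rewrite eqxx asboolF // asboolT // orbT.
have [b1 b2 b3 b4] := mu_bounds.
elim: k s s' Ds Ds' hk hlt => [|k IH] s s' Ds Ds' hk hlt.
  have := height_cases Ds; have := height_cases Ds'.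
  case=> -[sE' h1' h2'] [] [sE h1 h2]; move: hlt; rewrite sE sE' //= => _.
  - have [hlt|hge] := ltP (height s') (height s); [by left|right].
    have h : height s' = height s by lra.
    split => //; split; last by apply: hits_L1 => //; lra.
    by move=> /(hits_lt_max Ds')[] [sE'' _ ?]; move: sE''; rewrite sE' // => _; lra.
  - by left; lra.
  - have [hlt|hge] := ltP (height s') (height s); [by left|right].
    have h : height s' = height s by lra.
    split => //; split; last by apply: hits_L2 => //; lra.
    by move=> /(hits_lt_max Ds')[] [sE'' _ ?]; move: sE''; rewrite sE' // => _; lra.
have s0 : s 0%N = s' 0%N by apply: hk.
have [||h|[h [h1 h2]]] := IH (shiftN 1 s) (shiftN 1 s')
  (DeltaP_shiftN (j := 1) Ds) (DeltaP_shiftN (j := 1) Ds').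
- by move=> i ik; rewrite /shiftN hk // addn1.
- by rewrite /shiftN !addn1.
- by left; move: h; rewrite !height_shift // s0; lra.
- have hh : height s' = height s by move: h; rewrite !height_shift // s0; lra.
  right; split => //; split; last exact: hits_shift.
  move=> /hits_shiftV[//|sa].
  have : height (shiftN 1 s) = 0 by rewrite -h sa height_alpha.
  move=> /(height_eq0 (DeltaP_shiftN (j := 1) Ds)) E.
  by move: h2; rewrite E; exact: alpha_not_hits.
Qed.

Lemma lex_total (s s' : seqN) : s <> s' -> lex_lt s s' \/ lex_lt s' s.
Proof.
move=> ss'; have ex : exists i, s i != s' i.
  apply: contrapT => h; apply: ss'; apply/funext => i; apply/eqP/negPn/negP => hi.
  by apply: h; exists i.
case: (ex_minnP ex) => k hk kmin.
have agree i : (i < k)%N -> s i = s' i.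
  move=> ik; apply/eqP/negPn/negP => hi; have := kmin i hi.
  by rewrite leqNgt ik.
have [h|h|h] := ltngtP (s k) (s' k); first by left; exists k.
  by right; exists k; split => // i /agree ->.
by move: hk; rewrite (val_inj h) eqxx.
Qed.

Lemma UpsilonTP_inj s s' : DeltaP n s -> DeltaP n s' ->
  UpsilonTP R n s = UpsilonTP R n s' -> s = s'.
Proof.
move=> Ds Ds' E; apply: contrapT => /lex_total[|] /UpsilonTP_lt h.
  by have := h Ds Ds'; rewrite E ltxx.
by have := h Ds' Ds; rewrite E ltxx.
Qed.

Lemma D_mu1 : D_itm m1 m2 m1.
Proof.
by have [b1 b2 b3 b4] := mu_bounds; split; [apply/andP; split; lra|exists 0%N; left].
Qed.

Lemma D_mu2 : D_itm m1 m2 m2.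
Proof.
by have [b1 b2 b3 b4] := mu_bounds; split; [apply/andP; split; lra|exists 0%N; right].
Qed.

Lemma I_partE a (x : Itilde m1 m2) : I_part a x <->
  if a == L1 then (dup m1 m2 m2 <= x) && (x <= pt m1 m2 1)
  else if a == L2 then (dup m1 m2 m1 <= x) && (x <= pt m1 m2 m2)
  else (pt m1 m2 0 <= x) && (x <= pt m1 m2 m1).
Proof.
by rewrite /I_part; case: ifP => _; [|case: ifP => _]; rewrite /= in_itv.
Qed.

Lemma mu01 : [/\ 0 <= m1 <= 1 & 0 <= m2 <= 1].
Proof. by have [b1 b2 b3 b4] := mu_bounds; split; apply/andP; split; lra. Qed.

Lemma I_part_uniq a a' (x : Itilde m1 m2) : I_part a x -> I_part a' x -> a = a'.
Proof.
have [b1 b2 b3 b4] := mu_bounds; have [c1 c2] := mu01.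
have no u w : w < u -> u <= x -> x <= w -> False.
  by move=> wu ux xw; have := le_lt_trans (le_trans ux xw) wu; rewrite ltxx.
have p1 : pt m1 m2 m1 < dup m1 m2 m1.
  by rewrite lt_Ival Ival_pt // Ival_dup ?eqxx ?orbT //; exact: D_mu1.
have p2 : pt m1 m2 m2 < dup m1 m2 m2.
  by rewrite lt_Ival Ival_pt // Ival_dup ?eqxx ?orbT //; exact: D_mu2.
have p3 : pt m1 m2 m1 < dup m1 m2 m2.
  by apply: le_lt_trans p2; rewrite le_Ival !Ival_pt //= b2.
move=> /I_partE + /I_partE.
case: (letterP a) (letterP a') => -> [] -> //= /andP[h1 h2] /andP[h3 h4]; exfalso.
- exact: no p2 h1 h4.
- exact: no p3 h1 h4.
- exact: no p2 h3 h2.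
- exact: no p1 h1 h4.
- exact: no p3 h3 h2.
- exact: no p1 h3 h2.
Qed.

Lemma I_part_UpsilonTP s a : DeltaP n s -> s 0%N = a <-> I_part a (UpsilonTP R n s).
Proof.
move=> Ds; have [b1 b2 b3 b4] := mu_bounds; have [c1 c2] := mu01.
have hc := height_cases Ds.
have in_own : I_part (s 0%N) (UpsilonTP R n s).
  apply/I_partE; rewrite !le_Ival Ival_UpsilonTP // !Ival_dup // ?Ival_pt ?lexx ?ler01 //;
    [|exact: D_mu1|exact: D_mu2].
  case: (asboolP (hits_alpha s)) => hs /=.
    case: (hits_lt_max Ds hs) => -[-> h1 h2] /=; rewrite h2 /= andbT.
    - by case: ltgtP h1.
    - by case: ltgtP h1.
    - by case: ltgtP h1.
  case: hc => -[sE h1 h2]; rewrite sE /=.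
  - have h3 : m2 != height s by apply/eqP => /esym/(hits_L1 Ds sE).
    by rewrite lt_neqAle h3 h1 /=; case: ltgtP h2.
  - have h3 : m1 != height s by apply/eqP => /esym/(hits_L2 Ds sE).
    by rewrite lt_neqAle h3 h1 /=; case: ltgtP h2.
  - by apply/andP; split; [case: ltgtP h1|case: ltgtP h2].
by split=> [<-//|]; exact: I_part_uniq.
Qed.

Lemma UpsilonTP_itinerary s : DeltaP n s -> is_itinerary (UpsilonTP R n s) s.
Proof.
move=> Ds i a; rewrite -[iter _ _ _]/(iter i (T_tildeN R n) _) -UpsilonTP_iter //.
by rewrite -I_part_UpsilonTP //; exact: DeltaP_shiftN.
Qed.

End Coding.

Ltac absurd_lra := exfalso; repeat match goal with
  | H : _ <> _ |- _ => clear H | H : _ = L1 |- _ => clear H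
  | H : _ = L2 |- _ => clear H | H : _ = L3 |- _ => clear H end; lra.

(** * Induction of the extended map on the next level *)

Section Renormalization.
Context (R : realType) (n : nat -> nat).
Hypothesis n_pos : forall k : nat, (0 < k)%N -> (0 < n k)%N.

Local Notation g := (gell R n).
Local Notation m1 := (mu1 R n).
Local Notation m2 := (mu2 R n).
Local Notation P := (pp n g).
Local Notation Q := (qq n g).
Local Notation Rr := (rr n g).

Let gp := gell_pp_gt0 R n_pos.
Let gq := gell_qq_gt0 R n_pos.
Let gr := gell_rr_gt0 R n_pos.

(* [tau k] is the extended translation map at level [k], without normalization;
   a pair (y, b) is the point y, or its second copy when [b] is true. Its first
   return map to the points whose letter is not 1 is [tau k.+1]. *)
Definition lett (k : nat) (z : R * bool) : letter :=
  if (z.1 < Q k) || ((z.1 == Q k) && ~~ z.2) then L3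
  else if (z.1 < P k) || ((z.1 == P k) && ~~ z.2) then L2 else L1.

Definition tau (k : nat) (z : R * bool) : R * bool :=
  if z.2 && ((z.1 == Q k) || (z.1 == P k)) then (0, false)
  else (z.1 + wt n g k (lett k z), z.2).

Definition dom (k : nat) (z : R * bool) : Prop :=
  0 <= z.1 /\ (z.1 < Q k + Rr k \/ z.1 = Q k + Rr k /\ z.2 = false).

Lemma wtL1 k : wt n g k L1 = - P k. Proof. by rewrite /pp opprK. Qed.
Lemma wtL2 k : wt n g k L2 = - Q k. Proof. by rewrite /qq opprK. Qed.
Lemma wtL3 k : wt n g k L3 = Rr k. Proof. by []. Qed.

Lemma lett_cases k z :
  [\/ [/\ lett k z = L3, z.1 <= Q k & z.1 = Q k -> z.2 = false],
      [/\ lett k z = L2, Q k <= z.1, z.1 <= P k, z.1 = Q k -> z.2 = true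
         & z.1 = P k -> z.2 = false] |
      [/\ lett k z = L1, P k <= z.1 & z.1 = P k -> z.2 = true]].
Proof.
rewrite /lett; case: z => y b /=; have QP := qq_lt_pp n_pos gp gq gr k.
case: (ltgtP y (Q k)) => yQ /=; last 1 first.
- case: b => /=; last by constructor 1; split => //; lra.
  by rewrite yQ QP; constructor 2; split => //; lra.
- by constructor 1; split => //; lra.
case: (ltgtP y (P k)) => yP /=.
- by constructor 2; split => //; lra.
- by constructor 3; split => //; lra.
- case: b => /=; first by constructor 3; split => //; lra.
  by constructor 2; split => //; lra.
Qed.

Lemma tau_dom k z : 0 <= z.1 <= Q k + Rr k -> dom k (tau k z).
Proof.
case: z => y b /= /andP[y0 yL]; have QP := qq_lt_pp n_pos gp gq gr k.
have q0 := gq k; have r0 := gr k; have PR := hi_le n_pos gp gq gr k L2.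
rewrite /hi /= in PR.
rewrite /tau /=; case: ifP => hb; first by split => //=; left; lra.
have [[-> h1 h2]|[-> h1 h2 h3 h4]|[-> h1 h2]] := lett_cases k (y, b);
  rewrite ?wtL1 ?wtL2 ?wtL3 /dom /= in h1 h2 *.
- split; first lra.
  have [yQ|yQ] := eqVneq y (Q k); first by right; split; [lra|exact: h2].
  by left; have : y < Q k by [rewrite lt_neqAle yQ]; lra.
- by split; [lra|left; lra].
- by split; [lra|left; lra].
Qed.

Lemma dom_le k z : dom k z -> 0 <= z.1 <= Q k + Rr k.
Proof. by move=> [h0 [h|[h _]]]; apply/andP; split => //; lra. Qed.

Lemma iter_tau_dom k N z : dom k z -> dom k (iter N (tau k) z).
Proof. by move=> Ez; elim: N => //= N /dom_le; exact: tau_dom. Qed.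

(** By [ppE] the right end of the domain at level k + 1 is p_k, where the region of the letter 1
    begins at level k. *)
Lemma dom_lett k z : dom k.+1 z <-> 0 <= z.1 /\ lett k z <> L1.
Proof.
rewrite /dom -ppE; case: z => y b /=; have QP := qq_lt_pp n_pos gp gq gr k.
have [[-> h1 h2]|[-> h1 h2 h3 h4]|[-> h1 h2]] := lett_cases k (y, b); rewrite /= in h1 h2 *.
- by split=> -[y0 h]; split => //; left; lra.
- split=> -[y0 h]; split => //.
  have [yP|yP] := eqVneq y (P k); first by right; split => //; exact: h4.
  by left; rewrite lt_neqAle yP.
- split=> -[y0] //; case=> [h|[h b0]]; exfalso; first by lra.
  by have := h2 h; rewrite b0.
Qed.


Lemma tauE k z : ~~ (z.2 && ((z.1 == Q k) || (z.1 == P k))) ->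
  tau k z = (z.1 + wt n g k (lett k z), z.2).
Proof. by rewrite /tau => /negbTE ->. Qed.

Lemma lett_low1 k z : dom k.+1 z -> lett k.+1 z = L1 -> lett k z = L2.
Proof.
move=> /dom_lett[y0 low] l1; have QE := qqE n g k.
have := lett_cases k.+1 z; rewrite l1 => -[[]//|[]//|[_ h1 h2]].
have [[_ h3 h4]|[//]|[//]] := lett_cases k z; rewrite -QE in h1 h2.
have zE : z.1 = Q k by lra.
by have := h2 zE; rewrite (h4 zE).
Qed.

Lemma lett_low3 k z : dom k.+1 z -> lett k.+1 z <> L1 -> lett k z = L3.
Proof.
move=> Ez l1; have QE := qqE n g k; have QP := qq_lt_pp n_pos gp gq gr k.
have QP1 := qq_lt_pp n_pos gp gq gr k.+1.
have [h1 h2] : z.1 <= Q k /\ (z.1 = Q k -> z.2 = false).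
  rewrite QE; have [[_ h1 h2]|[_ _ h1 _ h2]|[]] := lett_cases k.+1 z => //.
  by split; lra.
have [[//]|[_ h3 _ h4 _]|[_ h3 _]] := lett_cases k z; last by absurd_lra.
have zE : z.1 = Q k by lra.
by have := h4 zE; rewrite (h2 zE).
Qed.

(** From a point of letter 3 the orbit jumps up by r_k and then descends in steps p_k through letter
    1. It meets the value p_k only from the second copy of q_{k+1} at the last step, from where it
    drops to 0; this exception is the last clause. *)
Lemma tower_ones k z i : dom k.+1 z -> lett k.+1 z <> L1 ->
    (i < n k.+1 + (lett k.+1 z == L2))%N ->
  [/\ iter i.+1 (tau k) z = (z.1 + (Rr k - P k *+ i), z.2),
      P k <= z.1 + (Rr k - P k *+ i)
    & z.1 + (Rr k - P k *+ i) = P k ->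
      [/\ z.2 = true, z.1 = Q k.+1, lett k.+1 z = L2 & i = n k.+1]].
Proof.
move=> Ez l1; have l3 := lett_low3 Ez l1.
have y0 : 0 <= z.1 by case: Ez.
have PE := ppE n g k; have RE := rrE n g k; have r1 := gr k.+1.
have QP := qq_lt_pp n_pos gp gq gr k; have q1 := gq k.+1.
have start : iter 1 (tau k) z = (z.1 + (Rr k - P k *+ 0), z.2).
  rewrite /= tauE ?l3 ?wtL3 ?mulr0n ?subr0 //; apply/negP => /andP[c /orP[/eqP h|/eqP h]].
    have [[_ _ h2]|[]|[]] := lett_cases k z; rewrite ?l3 //.
    by move: c; rewrite h2.
  have [[_ h2 _]|[l _ _ _ _]|[l _ _]] := lett_cases k z.
  - by have := le_lt_trans h2 QP; rewrite h ltxx.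
  - by rewrite l3 in l.
  - by rewrite l3 in l.
have ge j : (j < n k.+1 + (lett k.+1 z == L2))%N -> P k <= z.1 + (Rr k - P k *+ j)
    /\ (z.1 + (Rr k - P k *+ j) = P k ->
      [/\ z.2 = true, z.1 = Q k.+1, lett k.+1 z = L2 & j = n k.+1]).
  move=> jm; have [jlt|jge] := ltnP j (n k.+1).
    have : P k *+ j + P k *+ 1 <= P k *+ n k.+1.
      by rewrite -mulrnDr (pp_muln_ge gp) // addn1.
    by rewrite mulr1n => h; split; [lra|move=> h'; absurd_lra].
  have a2 : lett k.+1 z = L2 by apply/eqP; move: jm; case: (_ == L2); lia.
  have jE : j = n k.+1 by move: jm; rewrite a2 eqxx; lia.
  have [[]|[_ h1 _ h2 _]|[]] := lett_cases k.+1 z; rewrite ?a2 // jE.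
  split; first lra; move=> h; have zE : z.1 = Q k.+1 by lra.
  by split => //; exact: h2.
elim: i => [|i IH] im; first by have [] := ge 0%N im.
have [h1 h2] := ge i.+1 im; split => //.
have [E g1 g2] := IH (ltnW im).
rewrite iterS E tauE.
  have -> : lett k (z.1 + (Rr k - P k *+ i), z.2) = L1.
    have := lett_cases k (z.1 + (Rr k - P k *+ i), z.2).
    rewrite /= => -[[_ h _]|[_ _ h _ h']|[]//]; first by absurd_lra.
    have hE : z.1 + (Rr k - P k *+ i) = P k by lra.
    by have [c _ _ _] := g2 hE; have := h' hE; rewrite c.
  by rewrite wtL1 mulrSr /=; congr (_, _); ring.
apply/negP => /andP[_ /orP[/eqP/= h|/eqP/= h]]; first absurd_lra.
by have [_ _ a2 iE] := g2 h; move: im; rewrite a2 eqxx iE; lia.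
Qed.

Lemma lett_ones k z i : dom k.+1 z -> lett k.+1 z <> L1 ->
    (i < n k.+1 + (lett k.+1 z == L2))%N ->
  lett k (z.1 + (Rr k - P k *+ i), z.2) = L1.
Proof.
move=> Ez l1 im; have [_ g1 g2] := tower_ones Ez l1 im.
have QP := qq_lt_pp n_pos gp gq gr k.
have := lett_cases k (z.1 + (Rr k - P k *+ i), z.2).
rewrite /= => -[[_ h _]|[_ _ h _ h']|[]//]; first by absurd_lra.
have hE : z.1 + (Rr k - P k *+ i) = P k by lra.
by have [c _ _ _] := g2 hE; have := h' hE; rewrite c.
Qed.

Lemma tower k z u b v : dom k.+1 z -> Lambda (n k.+1) [:: lett k.+1 z] = u ++ b :: v ->
  iter (size u) (tau k) z = (z.1 + wsum g (LambdaK n k u), z.2)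
  /\ lett k (z.1 + wsum g (LambdaK n k u), z.2) = b.
Proof.
move=> Ez /edgeP; have zz : z = (z.1, z.2) by case: z {Ez}.
remember (lett k.+1 z) as a eqn:aE => h; case: h aE => [|{}a a1|{}a i a1 im] aE.
- rewrite LambdaK_nil wsum_nil addr0 -zz; split => //.
  exact: lett_low1.
- rewrite LambdaK_nil wsum_nil addr0 -zz; split => //.
  by apply: lett_low3 => //; rewrite -aE; exact/eqP.
- have l1 : lett k.+1 z <> L1 by rewrite -aE; exact/eqP.
  rewrite wsum_3nseq [size _]/= size_nseq; rewrite aE in im.
  by have [-> _ _] := tower_ones Ez l1 im; rewrite lett_ones.
Qed.

Lemma first_return k z : dom k.+1 z ->
  iter (size (Lambda (n k.+1) [:: lett k.+1 z])) (tau k) z = tau k.+1 z.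
Proof.
move=> Ez; have y0 : 0 <= z.1 by case: Ez.
have PE := ppE n g k; have RE := rrE n g k; have r1 := gr k.+1; have QE := qqE n g k.
have QP := qq_lt_pp n_pos gp gq gr k; have q1 := gq k.+1.
have QP1 := qq_lt_pp n_pos gp gq gr k.+1.
have nk := n_pos (ltn0Sn k).
rewrite Lambda_letter; case: eqP => [l1|l1].
  rewrite /= /tau (lett_low1 Ez l1) l1 wtL1 wtL2 -QE.
  have [[]|[]|[_ h1 h2]] := lett_cases k.+1 z; rewrite ?l1 //.
  have [[]|[_ h3 h4 h5 h6]|[]] := lett_cases k z; rewrite ?(lett_low1 Ez l1) //.
  have -> : (z.1 == Q k.+1) = false by apply/eqP => h; lra.
  case: (z.1 =P P k) => [h|_]; last by rewrite orbF.
  by rewrite (h6 h).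
rewrite [size _]/= size_nseq.
case: (letterP (lett k.+1 z)) => // a.
- have im : (n k.+1 < n k.+1 + (lett k.+1 z == L2))%N by rewrite a eqxx; lia.
  rewrite a eqxx addn1 iterS; have [-> g1 g2] := tower_ones Ez l1 im.
  rewrite /tau /= (lett_ones Ez l1 im) a wtL1 wtL2.
  have [[]|[_ h1 h2 h3 h4]|[]] := lett_cases k.+1 z; rewrite ?a //.
  have -> : (z.1 + (Rr k - P k *+ n k.+1) == Q k) = false by apply/eqP => h; lra.
  have -> : (z.1 + (Rr k - P k *+ n k.+1) == P k) = (z.1 == Q k.+1).
    by apply/eqP/eqP => h; lra.
  case: (z.1 =P P k.+1) => [h|_]; first rewrite (h4 h).
    by rewrite /=; congr (_, _); lra.
  rewrite orbF; case: ifP => // _; congr (_, _); lra.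
- case nE : (n k.+1) (nk) => [//|m] _.
  have im : (m < n k.+1 + (lett k.+1 z == L2))%N by rewrite nE; lia.
  rewrite a (_ : (L3 == L2) = false) // addn0 iterS; have [-> g1 g2] := tower_ones Ez l1 im.
  rewrite tauE; last first.
    apply/negP => /andP[_ /orP[/eqP/= h|/eqP/= h]]; first absurd_lra.
    by have [_ _ _] := g2 h; rewrite nE; lia.
  rewrite (lett_ones Ez l1 im) wtL1 tauE.
    rewrite a wtL3 /=; congr (_, _).
    by move: RE; rewrite nE mulrSr; lra.
  apply/negP => /andP[c /orP[/eqP h|/eqP h]].
    have [[_ _ h2]|[]|[]] := lett_cases k.+1 z; rewrite ?a //.
    by move: c; rewrite h2.
  by have [[_ h2 _]|[]|[]] := lett_cases k.+1 z; rewrite ?a // => *; absurd_lra.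
Qed.

Lemma tau_L1 k z : lett k z = L1 -> (tau k z).1 = 0 \/ (tau k z).1 = z.1 - P k.
Proof. by rewrite /tau; case: ifP => _ l1; [left|right; rewrite l1 wtL1]. Qed.

Lemma size_Lambda_letter m a : (size (Lambda m [:: a]) <= m + 2)%N.
Proof.
by case: (letterP a) => ->; rewrite Lambda_letter /= ?size_nseq ?addn0 ?addn1; lia.
Qed.

Lemma reach_low k z : dom k z ->
  exists j, (j <= n k.+1 + 2)%N /\ dom k.+1 (iter j (tau k) z).
Proof.
move=> Ez; have PE := ppE n g k; have RE := rrE n g k; have r1 := gr k.+1.
have QP := qq_lt_pp n_pos gp gq gr k; have q1 := gq k.+1.
have p0 := gp k.
apply: contrapT => h.
have up j : (j <= n k.+1 + 2)%N -> (iter j (tau k) z).1 + P k *+ j <= z.1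
    /\ P k <= (iter j (tau k) z).1.
  elim: j => [|j IH] jm.
    rewrite mulr0n addr0 /=; split => //.
    have : ~ dom k.+1 (iter 0 (tau k) z) by move=> h'; apply: h; exists 0%N.
    rewrite dom_lett /=; case: Ez => y0 _ hl.
    have [[l _ _]|[l _ _ _ _]|[_ //]] := lett_cases k z;
      by exfalso; apply: hl; rewrite l.
  have [g1 g2] := IH (ltnW jm).
  have zd j' : (j' <= n k.+1 + 2)%N -> lett k (iter j' (tau k) z) = L1.
    move=> jm'; apply: contrapT => hl; apply: h; exists j'; split => //.
    by apply/dom_lett; split => //; case: (iter_tau_dom j' Ez).
  have l1 := zd j (ltnW jm); have l2 := zd j.+1 jm.
  have p2 : P k <= (iter j.+1 (tau k) z).1.
    by have [[]|[]|[]] := lett_cases k (iter j.+1 (tau k) z); rewrite ?l2.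
  split => //; move: p2; rewrite iterS mulrSr.
  by case: (tau_L1 l1) => ->; lra.
(* While the letter is 1, the point stays at or above p_k and each step lowers it by p_k; but q_k +
   r_k < (n_{k+1} + 2) p_k. *)
have [g1 g2] := up _ (leqnn _).
have /andP[_ zL] := dom_le Ez.
by move: g1; rewrite mulrnDr mulr2n; lra.
Qed.

Lemma decompose k z d : dom k.+1 z -> exists N u b v,
  let z' := iter N (tau k.+1) z in
  [/\ Lambda (n k.+1) [:: lett k.+1 z'] = u ++ b :: v,
      iter d (tau k) z = iter (size u) (tau k) z'
    & (d <= N * (n k.+1 + 2) + size u)%N].
Proof.
move=> Ez; elim: d => [|d [N [u [b [v [E dE dN]]]]]].
  have [b [v E]] : exists b v, Lambda (n k.+1) [:: lett k.+1 z] = b :: v.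
    by rewrite Lambda_letter; case: ifP => _; eexists; eexists.
  by exists 0%N, [::], b, v.
set z' := iter N _ _ in E dE.
have Ez' : dom k.+1 z' by exact: iter_tau_dom.
have sL := size_Lambda_letter (n k.+1) (lett k.+1 z').
case: v E => [|b' v] E.
  have [b2 [v2 E2]] : exists b v, Lambda (n k.+1) [:: lett k.+1 (tau k.+1 z')] = b :: v.
    by rewrite Lambda_letter; case: ifP => _; eexists; eexists.
  exists N.+1, [::], b2, v2; split => //.
    rewrite iterS dE [RHS]/= -/z' -(first_return Ez') E size_cat /= addn1.
    by rewrite iterS.
  move: E sL => ->; rewrite size_cat /= mulSn; lia.
exists N, (rcons u b), b', v; rewrite -/z'; split.
- by rewrite cat_rcons.
- by rewrite iterS dE size_rcons.
- by rewrite size_rcons; lia.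
Qed.

Definition omega (k : nat) (z : R * bool) : Prop :=
  forall N, exists2 z0, dom k z0 & iter N (tau k) z0 = z.

Definition over (k : nat) (z z' : R * bool) (u v : word) : Prop :=
  [/\ dom k.+1 z', Lambda (n k.+1) [:: lett k.+1 z'] = u ++ lett k z :: v
    & z = (z'.1 + wsum g (LambdaK n k u), z'.2)].

Lemma over_exists k z N : omega k z -> exists z' u v,
  over k z z' u v /\ exists2 z0, dom k.+1 z0 & iter N (tau k.+1) z0 = z'.
Proof.
(* At most n_{k+1} + 2 steps are spent on reaching the lower domain and fewer than that on the last
   incomplete return. The other steps fill at least N returns. *)
move=> oz; pose M := (N.+1 * (n k.+1 + 2) + (n k.+1 + 2))%N.
have [z0 Ez0 zE] := oz M.
have [j [jm Ej]] := reach_low Ez0.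
have [N' [u [b [v [E dE dN]]]]] := decompose (M - j) Ej.
set z' := iter N' _ _ in E dE.
have Ez' : dom k.+1 z' by exact: iter_tau_dom.
have [t1 t2] := tower Ez' E.
have jM : (j <= M)%N by rewrite /M; lia.
have zz : z = (z'.1 + wsum g (LambdaK n k u), z'.2).
  by rewrite -t1 -dE -iterD subnK.
exists z', u, v; split; first by split => //; rewrite zz t2.
have uL : (size u < n k.+1 + 2)%N.
  apply: leq_trans (size_Lambda_letter (n k.+1) (lett k.+1 z')).
  by rewrite E size_cat /= addnS ltnS leq_addr.
have NN : (N <= N')%N.
  rewrite leqNgt; apply/negP => lt; have : (N' * (n k.+1 + 2) <= N * (n k.+1 + 2))%N.
    by rewrite leq_mul2r ltnW ?orbT.
  by move: dN; rewrite /M mulSn; lia.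
exists (iter (N' - N) (tau k.+1) (iter j (tau k) z0)); first exact: iter_tau_dom.
by rewrite -iterD subnKC.
Qed.

(** Below letter 1, two candidates with different numbers of 1s would differ by at least p_k, but
    both lie in [0, q_k] and q_k < p_k. For the other letters u is empty. *)
Lemma over_uniq k z z1 z2 u1 u2 v1 v2 :
  over k z z1 u1 v1 -> over k z z2 u2 v2 -> z1 = z2.
Proof.
move=> [E1 L1' zE1] [E2 L2' zE2].
have QP := qq_lt_pp n_pos gp gq gr k; have QE := qqE n g k.
have s12 : z1.2 = z2.2 by rewrite zE1 in zE2; case: zE2.
have w12 : z1.1 + wsum g (LambdaK n k u1) = z2.1 + wsum g (LambdaK n k u2).
  by rewrite zE1 in zE2; case: zE2.
suff h : z1.1 = z2.1 by case: z1 z2 h s12 {E1 E2 L1' L2' zE1 zE2 w12} => [? ?] [? ?] /= -> ->.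
have sp z' u v : dom k.+1 z' -> Lambda (n k.+1) [:: lett k.+1 z'] = u ++ lett k z :: v ->
    u = [::] /\ lett k z <> L1 \/
    exists i, [/\ u = L3 :: nseq i L1, lett k z = L1, 0 <= z'.1 & z'.1 <= Q k].
  move=> Ez' /edgeP h; remember (lett k.+1 z') as a eqn:aE; remember (lett k z) as b eqn:bE.
  case: h aE bE => [|{}a a1|{}a i a1 im] aE bE; [by left|by left|right].
  exists i; split => //; first by case: Ez'.
  have QP1 := qq_lt_pp n_pos gp gq gr k.+1.
  have [[_ h _]|[_ _ h _ _]|[h _ _]] := lett_cases k.+1 z'; rewrite ?QE; [lra|lra|].
  by move: a1; rewrite aE h.
have wlog_lt i j : (i < j)%N -> P k *+ i + P k <= P k *+ j.
  by move=> ij; rewrite -mulrSr (pp_muln_ge gp).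
have [[n1 l1]|[i [u1E l1 a1 b1]]] := sp _ _ _ E1 L1';
have [[n2 l2]|[j [u2E l2 a2 b2]]] := sp _ _ _ E2 L2'.
- by move: w12; rewrite n1 n2 => /addIr.
- by case: l1.
- by case: l2.
- move: w12; rewrite u1E u2E !wsum_3nseq.
  have [ij|ij|->] := ltngtP i j.
  + have := wlog_lt _ _ ij; lra.
  + have := wlog_lt _ _ ij; lra.
  + by move=> /addIr.
Qed.

Lemma over_omega k z : omega k z -> exists z' u v, over k z z' u v /\ omega k.+1 z'.
Proof.
move=> oz; have [z' [u [v [ov _]]]] := over_exists 0 oz.
exists z', u, v; split => // N.
have [z2 [u2 [v2 [ov2 h2]]]] := over_exists N oz.
by rewrite (over_uniq ov ov2).
Qed.

Lemma omega_dom k z : omega k z -> dom k z.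
Proof. by move=> /(_ 0%N)[z0 Ez0 <-]. Qed.

Lemma omega_path z : omega 0 z -> exists G, [/\ is_path n G, Psi n g G = z.1,
  edge_a (G 0%N) = lett 0 z
  & z.2 = false -> ~ S1 n G /\ ~ S1_hat n G].
Proof.
move=> oz.
have /choice[f fP] : forall kz : nat * (R * bool), exists r : (R * bool) * (word * word),
    omega kz.1 kz.2 -> over kz.1 kz.2 r.1 r.2.1 r.2.2 /\ omega kz.1.+1 r.1.
  move=> [k y] /=; have [oy|noy] := pselect (omega k y); last by exists (y, ([::], [::])).
  by have [z' [u [v h]]] := over_omega oy; exists (z', (u, v)).
pose fix zs (k : nat) : R * bool := if k is k'.+1 then (f (k', zs k')).1 else z.
pose us k := (f (k, zs k)).2.1; pose vs k := (f (k, zs k)).2.2.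
have zo k : omega k (zs k).
  by elim: k => //= k IH; have [] := fP (k, zs k) IH.
have ov k : over k (zs k) (zs k.+1) (us k) (vs k).
  by have [] := fP (k, zs k) (zo k).
pose G k : edge := (us k, lett k (zs k), vs k).
have pG : is_path n G by move=> k; have [] := ov k.
have side k : (zs k).2 = z.2.
  by elim: k => // k <-; have [_ _ ->] := ov k.
have zY k : (zs k).1 - Y n g G k = z.1 - Psi n g G.
  elim: k => [|k <-]; first by rewrite Y0.
  have [_ _ zE] := ov k; have YS := Y_step n g G k.
  have -> : (zs k).1 = (zs k.+1).1 + cG n g G k by rewrite zE.
  by rewrite YS; ring.
have zle k : 0 <= (zs k).1 <= 2 * Rr k.
  have /andP[-> h] := dom_le (omega_dom (zo k)); apply: le_trans h _.
  by have := qq_lt_pp n_pos gp gq gr k; have := pp_le_rr n_pos gp k; have := gr k.+1; lra.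
have small x y : (forall N, exists k, (N <= k)%N /\ x - y <= 2 * Rr k) -> x <= y.
  by move=> h; rewrite -subr_le0; apply: (le0_rr n_pos gp gq gr h).
have PsiE : Psi n g G = z.1.
  apply: le_anti; apply/andP; split; apply: small => N; exists N; split => //.
    have := zY N; have := Y_le_rr n_pos gp gq gr pG N; have /andP[h1 h2] := zle N; lra.
  have := zY N; have := Y_ge0 n_pos gp gq gr pG N; have /andP[h1 h2] := zle N; lra.
exists G; split => // z2.
have YE k : Y n g G k = (zs k).1 by have := zY k; rewrite PsiE; lra.
(* In a path of S1 or S1-hat the tail at a high level with letter 1 is minimal, that is p_M; a point
   of value p_M with letter 1 is a second copy, unlike [z]. *)
have no M : edge_a (G M) = L1 -> Y n g G M = lo n g M L1 -> False.
  rewrite YE /lo /= => l1 zP; have l1' : lett M (zs M) = L1 by exact: l1.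
  have [[h _ _]|[h _ _ _ _]|[_ _ h]] := lett_cases M (zs M).
  - by rewrite h in l1'.
  - by rewrite h in l1'.
  - by have := h zP; rewrite side z2.
have stA k : cG n g (G_beta n) k + lo n g k.+1 (edge_a (G_beta n k.+1))
    = lo n g k (edge_a (G_beta n k)).
  rewrite /cG /G_beta /=; case: (odd k) => /=; rewrite /lo /=.
    by rewrite LambdaK_nil wsum_nil add0r qqE.
  by rewrite wsum_3nseq rrE ppE; lra.
have stB k : cG n g (G_beta_hat n) k + lo n g k.+1 (edge_a (G_beta_hat n k.+1))
    = lo n g k (edge_a (G_beta_hat n k)).
  rewrite /cG /G_beta_hat /=; case: (odd k) => /=; rewrite /lo /=.
    by rewrite wsum_3nseq rrE ppE; lra.
  by rewrite LambdaK_nil wsum_nil add0r qqE.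
split=> -[_ /tail_eqP[M hM]].
- apply: (no (2 * M)%N); first by rewrite hM ?beta_a.
  rewrite (step_min_Y n_pos gp gq gr pG) ?hM ?beta_a // => k Mk.
  by rewrite /cG !hM -?/(cG n g (G_beta n) k) //; lia.
- apply: (no (2 * M).+1); first by rewrite hM /G_beta_hat /= ?oddM.
  rewrite (step_min_Y n_pos gp gq gr pG) ?hM /G_beta_hat /= ?oddM // => k Mk.
  by rewrite /cG !hM -?/(cG n g (G_beta_hat n) k) //; lia.
Qed.

End Renormalization.

(** * The image is the attractor *)

Section Attractor.
Context (R : realType) (n : nat -> nat).
Hypothesis n_pos : forall k : nat, (0 < k)%N -> (0 < n k)%N.

Local Notation g := (gell R n).
Local Notation m1 := (mu1 R n).
Local Notation m2 := (mu2 R n).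
Local Notation T := (T_tildeN R n).
Local Notation Ups := (UpsilonTP R n).

Let gp := gell_pp_gt0 R n_pos.
Let gq := gell_qq_gt0 R n_pos.
Let gr := gell_rr_gt0 R n_pos.

Lemma Ival01 (x : Itilde m1 m2) : 0 <= (Ival x).1 <= 1.
Proof. by case: x => -[y b] /= /andP[]. Qed.

Lemma Ival_D (x : Itilde m1 m2) : (Ival x).2 -> D_itm m1 m2 (Ival x).1.
Proof. by case: x => -[y b] /= /andP[_ /implyP h] /h /asboolP. Qed.

Lemma T_itm_lett y b : y <> m1 -> y <> m2 ->
  T_itm m1 m2 y = y + wt n g 0 (lett n 0 (y, b)).
Proof.
move=> y1 y2; have [b1 b2 b3 b4] := mu_bounds R n_pos.
have := lett_cases n_pos 0 (y, b); rewrite /= -mu1E -mu2E /T_itm.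
case=> [[-> h _]|[-> h1 h2 _ _]|[-> h _]]; rewrite ?wtL1 ?wtL2 ?wtL3 -?mu1E -?mu2E.
- have -> : y < m1 by rewrite lt_neqAle h andbT; apply/eqP.
  by rewrite -[rr _ _ _](addrK (qq n g 0)) [rr _ _ _ + _]addrC qq_rr1 // -mu1E addrA.
- have -> : (y < m1) = false by apply/negbTE; rewrite -leNgt.
  by have -> : y < m2 by rewrite lt_neqAle h2 andbT; apply/eqP.
- have -> : (y < m1) = false by apply/negbTE; rewrite -leNgt; lra.
  by have -> : (y < m2) = false by apply/negbTE; rewrite -leNgt.
Qed.

Lemma T_itm01 y : 0 <= y <= 1 -> 0 <= T_itm m1 m2 y <= 1.
Proof.
have [b1 b2 b3 b4] := mu_bounds R n_pos.
move=> /andP[y0 y1]; rewrite /T_itm.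
by have [h|h] := ltP y m1; [|have [h'|h'] := ltP y m2]; apply/andP; split; lra.
Qed.

Lemma Ival_T (x : Itilde m1 m2) : Ival (T x) = tau n 0 (Ival x).
Proof.
have [b1 b2 b3 b4] := mu_bounds R n_pos.
have x01 := Ival01 x; have xD := @Ival_D x.
rewrite /T_tildeN /T_tilde; case: (Ival x) x01 xD => y b /= y01 yD.
rewrite /tau /= -mu1E -mu2E; case: b yD => /= yD.
  case: ifPn => [_|/norP[/eqP n1 /eqP n2]]; first by rewrite Ival_pt // lexx ler01.
  have := yD isT => -[_ [i hi]].
  rewrite Ival_dup ?(T_itm_lett true) //.
    by rewrite -(T_itm_lett true) //; exact: T_itm01.
  split; first by rewrite -(T_itm_lett true) //; exact: T_itm01.
  case: i hi => [|i] /= hi; first by case: hi.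
  by exists i; rewrite -(T_itm_lett true) // -iterSr.
have lc := lett_cases n_pos 0 (y, false); rewrite /= -mu1E -mu2E in lc.
case: eqP => [y1|n1].
  rewrite Ival_pt ?lexx ?ler01 //; case: lc => [[-> _ _]|[_ _ _ h _]|[_ h _]].
  - by rewrite wtL3 y1 mu1E qq_rr1.
  - by have := h y1.
  - by exfalso; lra.
case: eqP => [y2|n2].
  rewrite Ival_pt; last by apply/andP; split; lra.
  case: lc => [[_ h _]|[-> _ _ _ _]|[_ _ h]].
  - by exfalso; lra.
  - by rewrite wtL2 y2 mu1E.
  - by have := h y2.
by rewrite Ival_pt ?(T_itm_lett false) // -(T_itm_lett false) //; exact: T_itm01.
Qed.

Lemma Ival_iter_T i (x : Itilde m1 m2) : Ival (iter i T x) = iter i (tau n 0) (Ival x).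
Proof. by elim: i => //= i IH; rewrite Ival_T IH. Qed.

Lemma Omega_omega (x : Itilde m1 m2) : OmegaN R n x -> omega n 0 (Ival x).
Proof.
(* The additional preimage provides a starting point [T z]: images under [T] lie in [dom], which
   excludes a second copy of the right end 1. *)
move=> ox N; have [z _ zE] := ox N.+1 I.
exists (Ival (T z)); last by rewrite -Ival_iter_T -iterSr -zE.
by rewrite Ival_T; apply: (tau_dom n_pos); rewrite qq_rr1 //; exact: Ival01.
Qed.

Lemma Omega_T (x : Itilde m1 m2) : OmegaN R n x -> OmegaN R n (T x).
Proof.
move=> ox i _; have [z _ zE] := ox i I.
by exists (T z) => //; rewrite -zE -iterSr.
Qed.

Lemma past_DeltaP s i : DeltaP n s -> exists2 s', DeltaP n s' & shiftN i s' = s.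
Proof.
move=> /(DeltaP_path n_pos)[G pG <-].
have [x Dx <-] := path_Delta n_pos pG.
exists (projN (shiftZ (- i%:Z) x)); first exact/(Delta_proj n_pos)/(Delta_shift n_pos).
by apply/funext => k; rewrite /shiftN /projN /shiftZ; congr x; lia.
Qed.

Lemma Ups_Omega s : DeltaP n s -> OmegaN R n (Ups s).
Proof.
move=> Ds i _; have [s' Ds' <-] := past_DeltaP i Ds.
by exists (Ups s') => //; rewrite UpsilonTP_iter.
Qed.

(* Two points of the attractor with the same image other than 0 agree: only the
   letters 1 and 2 can compete, and this is excluded by [two_preimages]. *)
Lemma T_inj_Omega (x x' : Itilde m1 m2) : OmegaN R n x -> OmegaN R n x' ->
  T x = T x' -> x = x' \/ T x = pt m1 m2 0.
Proof.
move=> ox ox' TE.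
have [b1 b2 b3 b4] := mu_bounds R n_pos.
have [[G [pG GE aG _]] [G' [pG' GE' aG' _]]] :=
  (omega_path n_pos (Omega_omega ox), omega_path n_pos (Omega_omega ox')).
have tE : tau n 0 (Ival x) = tau n 0 (Ival x') by rewrite -!Ival_T TE.
have T0 (w : Itilde m1 m2) : Ival w = (0, false) -> w = pt m1 m2 0.
  by move=> wE; apply/val_inj; rewrite /= wE Ival_pt // lexx ler01.
move: tE; rewrite /tau.
case: ifPn => [hb _|hb]; first by right; apply: T0; rewrite Ival_T /tau hb.
case: ifPn => [hb' _|hb' tE]; first by right; rewrite TE; apply: T0; rewrite Ival_T /tau hb'.
have yE : (Ival x).1 + wt n g 0 (lett n 0 (Ival x)) =
          (Ival x').1 + wt n g 0 (lett n 0 (Ival x')) by case: tE.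
have sE : (Ival x).2 = (Ival x').2 by case: tE.
have [l|l] := eqVneq (lett n 0 (Ival x)) (lett n 0 (Ival x')).
  left; apply/val_inj => /=; move: yE; rewrite l => /addIr h.
  by case: (Ival x) (Ival x') h sE => [? ?] [? ?] /= -> ->.
exfalso; have r1 := Y_lo n_pos gp gq gr pG 0; have r2 := Y_hi n_pos gp gq gr pG 0.
have r1' := Y_lo n_pos gp gq gr pG' 0; have r2' := Y_hi n_pos gp gq gr pG' 0.
rewrite Y0 GE aG in r1 r2; rewrite Y0 GE' aG' in r1' r2'.
have zero y : 0 <= y -> (exists G1 G2, [/\ is_path n G1 /\ is_path n G2,
       edge_a (G1 0%N) = L1 /\ edge_a (G2 0%N) = L2,
       Psi n g G1 = y + m2 & Psi n g G2 = y + m1]) -> y = 0.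
  move=> y0 [G1 [G2 [h1 h2 h3 h4]]].
  apply: (two_preimages n_pos gp gq gr y0); exists G1, G2.
  by rewrite !Y0 -mu1E -mu2E.
(* With letter 1 the value m2 belongs to the second copy, whose image is 0, a case already set
   aside. *)
have noL1 (w : Itilde m1 m2) :
    ~~ ((Ival w).2 && (((Ival w).1 == qq n g 0) || ((Ival w).1 == pp n g 0))) ->
    lett n 0 (Ival w) = L1 -> (Ival w).1 = m2 -> False.
  move=> /negP hw lw w2; have [[h _ _]|[h _ _ _ _]|[_ _ h]] := lett_cases n_pos 0 (Ival w).
  - by rewrite h in lw.
  - by rewrite h in lw.
  - by apply: hw; rewrite (h _) ?w2 ?mu2E // eqxx orbT.
move: r1 r2 r1' r2' l yE; rewrite /lo /hi -?mu1E -?mu2E ?qq_rr1 //.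
have w3 : wt n g 0 L3 = 1 - m1 by rewrite wtL3 -(qq_rr1 R n_pos) mu1E; lra.
have rE : m1 + rr n g 0 = 1 by rewrite mu1E qq_rr1.
have L12 (w w' : Itilde m1 m2) G1 G2 : is_path n G1 -> is_path n G2 ->
    Psi n g G1 = (Ival w).1 -> Psi n g G2 = (Ival w').1 ->
    edge_a (G1 0%N) = L1 -> edge_a (G2 0%N) = L2 -> m2 <= (Ival w).1 ->
    (Ival w).1 - m2 = (Ival w').1 - m1 -> (Ival w).1 = m2.
  move=> p1 p2 E1 E2 a1 a2 lo1 E; apply/eqP; rewrite -subr_eq0; apply/eqP.
  apply: zero; first by rewrite subr_ge0.
  by exists G1, G2; split; [|split|rewrite subrK|rewrite E subrK].
have nx : (Ival x).1 = m2 -> lett n 0 (Ival x) = L1 -> False.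
  by move=> h1 h2; exact: (noL1 x).
have nx' : (Ival x').1 = m2 -> lett n 0 (Ival x') = L1 -> False.
  by move=> h1 h2; exact: (noL1 x').
have := L12 x x' G G' pG pG' GE GE'; have := L12 x' x G' G pG' pG GE' GE.
move: nx nx'; rewrite aG aG'; clear -w3 rE b1 b2 b3 b4.
move: (Ival x).1 (Ival x').1 => y y'.
case: (letterP (lett n 0 (Ival x))) => ->; case: (letterP (lett n 0 (Ival x'))) => ->;
  rewrite /= ?eqxx // ?wtL1 ?wtL2 ?w3 -?mu1E -?mu2E ?rE => nx nx' h h' r1 r2 r1' r2' _ yE.
- by apply: nx => //; apply: h'.
- by clear h h' nx nx'; lra.
- by apply: nx' => //; apply: h => //; rewrite yE.
- by clear h h' nx nx'; lra.
- by clear h h' nx nx'; lra.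
- by clear h h' nx nx'; lra.
Qed.

Lemma Ups_t1 : Ival (Ups (projN (shiftZ (- 1%:Z) (t_seq n)))) = (m2, true).
Proof.
rewrite Ival_UpsilonTP //; last exact: DeltaP_t.
rewrite asboolT; last exact: hits_t.
rewrite height_last //; last exact: DeltaP_t.
by rewrite /t_seq /= beta0 gL1 opprK.
Qed.

Lemma Ups_t_hat1 : Ival (Ups (projN (shiftZ (- 1%:Z) (t_hat n)))) = (m1, true).
Proof.
rewrite Ival_UpsilonTP //; last exact: DeltaP_t_hat.
rewrite asboolT; last exact: hits_t_hat.
rewrite height_last //; last exact: DeltaP_t_hat.
by rewrite /t_hat /= beta_hat0 gL2 opprK.
Qed.

Lemma DeltaP_cons_past s : DeltaP n s -> hits_alpha n s ->
  exists s', [/\ DeltaP n s', hits_alpha n s' & shiftN 1 s' = s].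
Proof.
move=> Ds /(hits_alphaP R n_pos Ds)[[j j0 ->]|[j j0 ->]].
- exists (projN (shiftZ (- (j.+1)%:Z) (t_seq n))); split.
  + exact: DeltaP_t.
  + exact: hits_t.
  + by apply/funext => i; rewrite /shiftN /projN /shiftZ; congr (t_seq n); lia.
- exists (projN (shiftZ (- (j.+1)%:Z) (t_hat n))); split.
  + exact: DeltaP_t_hat.
  + exact: hits_t_hat.
  + by apply/funext => i; rewrite /shiftN /projN /shiftZ; congr (t_hat n); lia.
Qed.

(** A point of I is the image of the word of its path, which does not reach alpha. For a second copy
    the argument is by induction on the time until m1 or m2: a sequence for [T x] has a past
    reaching alpha, and [T_inj_Omega] identifies the image of that past with [x], as [T x], again a
    second copy, is not 0. *)
Lemma Ups_surj (x : Itilde m1 m2) : OmegaN R n x -> exists2 s, DeltaP n s & Ups s = x.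
Proof.
move=> ox; case xE : (Ival x) => [y b]; case: b xE => xE; last first.
  have [G [pG GE _ hG]] := omega_path n_pos (Omega_omega ox).
  exists (H n G); first exact: path_DeltaP.
  apply/val_inj => /=; rewrite Ival_UpsilonTP //; last exact: path_DeltaP.
  rewrite height_H // GE asboolF; first by rewrite xE.
  by move=> /(@H_hits_alpha R n n_pos G pG)[]; case: hG => //; rewrite xE.
have [|_ [i hi]] := @Ival_D x; first by rewrite xE.
rewrite xE /= in hi.
elim: i x y ox xE hi => [|i IH] x y ox xE hi.
  case: hi => /= yE.
  - exists (projN (shiftZ (- 1%:Z) (t_hat n))); first exact: DeltaP_t_hat.
    by apply/val_inj => /=; rewrite Ups_t_hat1 xE yE.
  - exists (projN (shiftZ (- 1%:Z) (t_seq n))); first exact: DeltaP_t.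
    by apply/val_inj => /=; rewrite Ups_t1 xE yE.
have [y1|n1] := eqVneq y m1.
  exists (projN (shiftZ (- 1%:Z) (t_hat n))); first exact: DeltaP_t_hat.
  by apply/val_inj => /=; rewrite Ups_t_hat1 xE y1.
have [y2|n2] := eqVneq y m2.
  exists (projN (shiftZ (- 1%:Z) (t_seq n))); first exact: DeltaP_t.
  by apply/val_inj => /=; rewrite Ups_t1 xE y2.
have TxE : Ival (T x) = (T_itm m1 m2 y, true).
  rewrite Ival_T xE /tau /= -mu1E -mu2E (negbTE n1) (negbTE n2) /=.
  by rewrite (T_itm_lett true) //; exact/eqP.
rewrite iterSr in hi.
have [s Ds sE] := IH _ _ (Omega_T ox) TxE hi.
have hs : hits_alpha n s.
  by apply: contrapT => nhs; have := Ival_UpsilonTP R n_pos Ds; rewrite sE TxE asboolF.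
have [s' [Ds' hs' s1]] := DeltaP_cons_past Ds hs.
exists s' => //; have TE : T (Ups s') = T x by rewrite -UpsilonTP_shift // s1.
have [//|h0] := T_inj_Omega (Ups_Omega Ds') ox TE.
by have := TxE; rewrite -TE h0 Ival_pt ?lexx ?ler01.
Qed.

Lemma Ups_bij : set_bij (DeltaP n) (OmegaN R n) Ups.
Proof.
split.
- by move=> s Ds; exact: Ups_Omega.
- by move=> s s' /set_mem Ds /set_mem Ds' /(UpsilonTP_inj n_pos Ds Ds').
- by move=> x /Ups_surj[s Ds <-]; exists s.
Qed.

End Attractor.

(** * Homeomorphism, and the fibres over the two-sided set *)

Section Topology.
Context (R : realType) (n : nat -> nat).
Hypothesis n_pos : forall k : nat, (0 < k)%N -> (0 < n k)%N.

Local Notation g := (gell R n).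
Local Notation m1 := (mu1 R n).
Local Notation m2 := (mu2 R n).
Local Notation T := (T_tildeN R n).
Local Notation Ups := (UpsilonTP R n).
Local Notation height := (height R n).

Let gp := gell_pp_gt0 R n_pos.
Let gq := gell_qq_gt0 R n_pos.
Let gr := gell_rr_gt0 R n_pos.

Lemma compact_DeltaP : compact (DeltaP n).
Proof.
apply: (@subclosed_compact _ _ [set f : seqN | forall i, [set: discrete_topology letter] (f i)]).
- exact: closed_closure.
- apply: (@tychonoff nat (fun=> discrete_topology letter) (fun=> setT)) => i.
  have -> : [set: discrete_topology letter] = [set L1] `|` ([set L2] `|` [set L3]).
    by apply/seteqP; split => // a _; case: (letterP a) => ->; [left|right; left|right; right].
  by apply: compactU; [|apply: compactU]; exact: compact_set1.
- by [].
Qed.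

Lemma mkseq_agree (s s' : seqN) K : (forall i, (i < K)%N -> s' i = s i) ->
  mkseq s' K = mkseq s K.
Proof.
move=> h; apply: (@eq_from_nth _ L1); rewrite !size_mkseq // => i iK.
by rewrite !nth_mkseq // h.
Qed.

Lemma height_continuous e : 0 < e -> exists K, forall s s' : seqN,
  DeltaP n s -> DeltaP n s' -> (forall i, (i < K)%N -> s' i = s i) ->
  height s - height s' < e.
Proof.
move=> e0; have [K hK] := Psi_continuous n_pos gp gq gr e0.
exists K => s s' Ds Ds' /mkseq_agree ss'.
have [pG HG] := H_invP n_pos Ds; have [pG' HG'] := H_invP n_pos Ds'.
by rewrite !height_Psi //; apply: hK => //; rewrite HG HG'.
Qed.

Lemma height_shiftN s i : DeltaP n s ->
  height (shiftN i s) = height s + wsum g (mkseq s i).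
Proof.
move=> Ds; apply: (Val_uniq (g := g) (s := shiftN i s)).
  exact/Val_height/DeltaP_shiftN.
have := Val_shift i (Val_height R n_pos Ds); congr Val.
by apply/funext => j; rewrite /shiftN addnC.
Qed.

(** If c is the first copy of the value of [s], take a neighbour sharing the letters up to the time
    when [s] becomes alpha. If its value is not larger, it also has value 0 at that time, hence
    becomes alpha there and equals [s]. *)
Lemma Ups_low (c : Itilde m1 m2) s : DeltaP n s -> c < Ups s ->
  exists K, forall s' : seqN, DeltaP n s' -> (forall i, (i < K)%N -> s' i = s i) ->
    c < Ups s'.
Proof.
move=> Ds; rewrite lt_Ival Ival_UpsilonTP //= => /orP[zh|].
  have e0 : 0 < height s - (Ival c).1 by rewrite subr_gt0.
  have [K hK] := height_continuous e0; exists K => s' Ds' ss'.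
  rewrite lt_Ival Ival_UpsilonTP //=; have := hK _ _ Ds Ds' ss'.
  by move=> h; have -> : (Ival c).1 < height s' by lra.
move=> /andP[/eqP zh /andP[c2 /asboolP hs]]; have [i i0 hi] := hs.
exists i => s' Ds' ss'; have [h|h] := ltP (height s) (height s').
  by rewrite lt_Ival Ival_UpsilonTP //= zh h.
suff -> : s' = s by rewrite lt_Ival Ival_UpsilonTP //= zh eqxx c2 asboolT // orbT.
have h0 : height (shiftN i s) = 0 by rewrite hi height_alpha.
have h1 : shiftN i s' = alpha n.
  apply: (height_eq0 (R := R) n_pos); first exact: DeltaP_shiftN.
  apply: le_anti; apply/andP; split; last first.
    by have /andP[] := height01 R n_pos (DeltaP_shiftN (j := i) Ds').
  move: h0; rewrite !height_shiftN // (mkseq_agree ss'); lra.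
apply/funext => j; have [ji|ij] := ltnP j i; first exact: ss'.
by have := congr1 (fun f : seqN => f (j - i)%N) h1; rewrite -hi /shiftN subnK.
Qed.

Lemma T_itm_interior s : DeltaP n s -> height s <> m1 -> height s <> m2 ->
  T_itm m1 m2 (height s) = height (shiftN 1 s).
Proof.
move=> Ds n1 n2; have [b1 b2 b3 b4] := mu_bounds R n_pos.
rewrite height_shift // /T_itm.
case: (height_cases R n_pos Ds) => -[-> h1 h2]; rewrite ?gL1 ?gL2 ?gL3 //.
- by rewrite !ltNge h1 (le_trans (ltW b2)).
- by rewrite ltNge h1 /= lt_neqAle h2 andbT; case: eqP.
- by rewrite lt_neqAle h2 andbT; case: eqP => // _ /=; ring.
Qed.

(** When the orbit of the value arrives at m1 or m2, the value of the shifted sequence is the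
    maximum for its letter, since alpha is not reached. A neighbour with the same letters cannot
    exceed it, and by [height_max] equality also prevents it from reaching alpha. *)
Lemma Ups_high_boundary i s : DeltaP n s -> ~ hits_alpha n s ->
    iter i (T_itm m1 m2) (height s) = m1 \/ iter i (T_itm m1 m2) (height s) = m2 ->
  exists K, forall s' : seqN, DeltaP n s' -> (forall i, (i < K)%N -> s' i = s i) ->
    height s' < height s \/ height s' = height s /\ ~ hits_alpha n s'.
Proof.
have [b1 b2 b3 b4] := mu_bounds R n_pos.
have base s0 : DeltaP n s0 -> ~ hits_alpha n s0 -> height s0 = m1 \/ height s0 = m2 ->
    exists K, forall s' : seqN, DeltaP n s' -> (forall i, (i < K)%N -> s' i = s0 i) ->
    height s' < height s0 \/ height s' = height s0 /\ ~ hits_alpha n s'.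
  move=> Ds nh hm; exists 1%N => s' Ds' /(_ 0%N isT) ss'.
  have hE : height s0 = hi n g 0 (s' 0%N).
    rewrite /hi ss' qq_rr1 // -mu1E -mu2E.
    case: (height_cases R n_pos Ds) => -[sE h1 h2]; rewrite sE /=; case: hm => hm; try lra.
    - by exfalso; apply: nh; apply: hits_L1 hm.
    - by exfalso; apply: nh; apply: hits_L2 hm.
  have /andP[_] := height_range R n_pos Ds'; rewrite -hE le_eqVlt => /orP[/eqP h|]; last by left.
  right; split => //; have [] := @height_max R n n_pos s' Ds' _; last by [].
  by rewrite h hE.
elim: i s => [|i IH] s Ds nh hm; first exact: base.
have [h1|n1] := pselect (height s = m1); first by apply: base => //; left.
have [h2|n2] := pselect (height s = m2); first by apply: base => //; right.
rewrite iterSr T_itm_interior // in hm.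
have nh1 : ~ hits_alpha n (shiftN 1 s) by move=> /hits_shift.
have [K hK] := IH _ (DeltaP_shiftN (j := 1) Ds) nh1 hm.
exists K.+1 => s' Ds' ss'.
have s0 : s' 0%N = s 0%N by exact: ss'.
have [|h|[h nh']] := hK (shiftN 1 s') (DeltaP_shiftN (j := 1) Ds').
- by move=> j jK; rewrite /shiftN ss' // addn1.
- by left; move: h; rewrite !height_shift // s0; lra.
- right; split; first by move: h; rewrite !height_shift // s0; lra.
  move=> /hits_shiftV[//|sa]; apply: nh.
  exists 1%N => //; apply: (height_eq0 (R := R) n_pos); first exact: DeltaP_shiftN.
  by rewrite -h sa height_alpha.
Qed.

Lemma Ups_high (c : Itilde m1 m2) s : DeltaP n s -> Ups s < c ->
  exists K, forall s' : seqN, DeltaP n s' -> (forall i, (i < K)%N -> s' i = s i) ->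
    Ups s' < c.
Proof.
move=> Ds; rewrite lt_Ival Ival_UpsilonTP //= => /orP[zh|].
  have e0 : 0 < (Ival c).1 - height s by rewrite subr_gt0.
  have [K hK] := height_continuous e0; exists K => s' Ds' ss'.
  rewrite lt_Ival Ival_UpsilonTP //=.
  have := hK _ _ Ds' Ds (fun i iK => esym (ss' i iK)).
  by move=> h; have -> : height s' < (Ival c).1 by lra.
move=> /andP[/eqP zh /andP[/asboolPn nh c2]].
have [_ [i hi]] := Ival_D c2; rewrite -zh in hi.
have [K hK] := Ups_high_boundary Ds nh hi.
exists K => s' Ds' ss'; rewrite lt_Ival Ival_UpsilonTP //= -zh c2.
case: (hK s' Ds' ss') => [->//|[-> nh']].
by rewrite eqxx asboolF // orbT.
Qed.

Lemma Ups_nbhs s (V : set (Itilde m1 m2)) : DeltaP n s -> nbhs (Ups s) V ->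
  exists K, forall s' : seqN, DeltaP n s' -> (forall i, (i < K)%N -> s' i = s i) ->
    V (Ups s').
Proof.
move=> Ds; rewrite itv_nbhsE => -[[l r] [oi si] sV].
have [K1 h1] : exists K, forall s' : seqN, DeltaP n s' ->
    (forall i, (i < K)%N -> s' i = s i) -> (l <= BLeft (Ups s'))%O.
  case: l oi si {sV} => [b c|b] oi; rewrite itv_boundlr => /andP[lc _]; last first.
    by case: b oi lc => // _ _; exists 0%N => s' _ _.
  case: b oi lc => oi lc; first by move: oi; rewrite /itv_open_ends /=; case: r.
  rewrite bnd_simp in lc; have [K hK] := Ups_low Ds lc.
  by exists K => s' Ds' ss'; rewrite bnd_simp; exact: hK.
have [K2 h2] : exists K, forall s' : seqN, DeltaP n s' ->
    (forall i, (i < K)%N -> s' i = s i) -> (BRight (Ups s') <= r)%O.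
  case: r oi si {sV} => [b c|b] oi; rewrite itv_boundlr => /andP[_ rc]; last first.
    by case: b oi rc => // _ _; exists 0%N => s' _ _.
  case: b oi rc => oi rc; last by move: oi; rewrite /itv_open_ends /=; case: l {h1} => [[]|[]].
  rewrite bnd_simp in rc; have [K hK] := Ups_high Ds rc.
  by exists K => s' Ds' ss'; rewrite bnd_simp; exact: hK.
exists (maxn K1 K2) => s' Ds' ss'; apply: sV => /=; rewrite itv_boundlr.
by rewrite h1 ?h2 // => i iK; apply: ss'; rewrite leq_max iK ?orbT.
Qed.

Lemma Ups_continuous : {within DeltaP n, continuous (Ups : seqN -> _)}.
Proof.
apply/subspace_continuousP => s Ds V /(Ups_nbhs Ds)[K hK].
rewrite /= nbhs_filterE /fmap /= /within /=.
by apply/nbhs_seqN; exists K => s' ss' Ds'; exact: hK.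
Qed.

(** The points of the minimal set outside a neighbourhood of [s] form a compact set; its image is
    closed in the Hausdorff order topology and misses the image of [s]. *)
Lemma Ups_inverse : exists h : Itilde m1 m2 -> seqN,
  {in DeltaP n, cancel Ups h} /\ {within OmegaN R n, continuous h}.
Proof.
pose h (x : Itilde m1 m2) : seqN := xget (alpha n) [set s | DeltaP n s /\ Ups s = x].
have hK s : DeltaP n s -> h (Ups s) = s.
  move=> Ds; rewrite /h; case: xgetP => [s' _ [Ds' E]|/(_ s)[]//].
  exact: (UpsilonTP_inj n_pos Ds' Ds E).
exists h; split; first by move=> s /set_mem; exact: hK.
apply/subspace_continuousP => x /(Ups_surj n_pos)[s Ds <-] U sU.
have {}sU : nbhs s U by rewrite -(hK s Ds).
pose C := DeltaP n `&` ~` (U°).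
have cC : compact C.
  apply: compact_closedI; first exact: compact_DeltaP.
  by apply: open_closedC; exact: open_interior.
have cUC : closed (Ups @` C).
  apply: compact_closed; first exact: order_hausdorff.
  apply: continuous_compact cC.
  by apply: continuous_subspaceW Ups_continuous => ? [].
have nUC : ~ (Ups @` C) (Ups s).
  move=> [s' [Ds' nU] E]; have ss' := UpsilonTP_inj n_pos Ds' Ds E.
  by apply: nU; rewrite ss'.
have : nbhs (Ups s) (~` (Ups @` C)).
  by apply: open_nbhs_nbhs; split => //; exact: closed_openC.
rewrite /= nbhs_filterE /fmap /= /within /=; apply: filterS => y ny /(Ups_surj n_pos)[s' Ds' yE].
rewrite -yE in ny *; apply: contrapT => nU; apply: ny; exists s' => //.
split => // /interior_subset; rewrite -[X in U X](hK s' Ds') => sU'.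
exact: (nU sU').
Qed.

Lemma shift_inj s s' : DeltaP n s -> DeltaP n s' -> shiftN 1 s = shiftN 1 s' ->
  s <> s' -> shiftN 1 s = alpha n.
Proof.
move=> Ds Ds' E ss'.
have TE : T (Ups s) = T (Ups s') by rewrite -!UpsilonTP_shift // E.
have [/(UpsilonTP_inj n_pos Ds Ds')//|h] :=
  T_inj_Omega n_pos (Ups_Omega R n_pos Ds) (Ups_Omega R n_pos Ds') TE.
apply: (@UpsilonTP_inj R n n_pos); [exact: DeltaP_shiftN|exact: DeltaP_alpha|].
by rewrite UpsilonTP_shift // h UpsilonTP_alpha.
Qed.

Lemma shiftZ_shiftZ (i j : int) (x : seqZ) : shiftZ i (shiftZ j x) = shiftZ (i + j) x.
Proof. by apply/funext => k; rewrite /shiftZ addrA. Qed.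

Lemma projN_shiftZ (j : nat) (x : seqZ) : projN (shiftZ j%:Z x) = shiftN j (projN x).
Proof. by apply/funext => i; rewrite /projN /shiftZ /shiftN. Qed.

Lemma projN_shiftZN (j : nat) (x : seqZ) : projN x = shiftN j (projN (shiftZ (- j%:Z) x)).
Proof.
rewrite -projN_shiftZ shiftZ_shiftZ subrr; congr projN.
by apply/funext => i; rewrite /shiftZ addr0.
Qed.

(** At the first difference to the left of the point, two distinct one-sided sequences have the same
    shift, which [shift_inj] only allows to be alpha. *)
Lemma same_future x x' : Delta n x -> Delta n x' -> projN x = projN x' -> x <> x' ->
  exists j : nat, projN (shiftZ (- j%:Z) x) = alpha n /\ projN (shiftZ (- j%:Z) x') = alpha n.
Proof.
move=> Dx Dx' E xx'.
have ex : exists i : nat, x (Negz i) != x' (Negz i).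
  apply: contrapT => h; apply: xx'; apply/funext => -[i|i].
    by have := congr1 (fun f : seqN => f i) E.
  by apply/eqP/negPn/negP => hi; apply: h; exists i.
case: (ex_minnP ex) => j hj jmin.
have agree i : (i < j)%N -> x (Negz i) = x' (Negz i).
  move=> ij; apply/eqP/negPn/negP => hi; have := jmin i hi.
  by rewrite leqNgt ij.
have Ej : projN (shiftZ (- j%:Z) x) = projN (shiftZ (- j%:Z) x').
  apply/funext => i; rewrite /projN /shiftZ; have [ij|ji] := ltnP i j.
    have -> : i%:Z + - j%:Z = Negz (j - i.+1) by lia.
    by apply: agree; lia.
  have -> : i%:Z + - j%:Z = (i - j)%N%:Z by lia.
  by have := congr1 (fun f : seqN => f (i - j)%N) E.
exists j; rewrite -Ej; suff : projN (shiftZ (- j%:Z) x) = alpha n by [].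
have sh (y : seqZ) : shiftN 1 (projN (shiftZ (- (j.+1)%:Z) y)) = projN (shiftZ (- j%:Z) y).
  by apply/funext => i; rewrite /shiftN /projN /shiftZ; congr y; lia.
rewrite -sh; apply: (@shift_inj _ (projN (shiftZ (- (j.+1)%:Z) x'))).
- exact/(Delta_proj n_pos)/(Delta_shift n_pos).
- exact/(Delta_proj n_pos)/(Delta_shift n_pos).
- by rewrite !sh.
- move=> /(congr1 (fun f : seqN => f 0%N)); rewrite /projN /shiftZ.
  have -> : 0%N%:Z + - (j.+1)%:Z = Negz j by lia.
  by apply/eqP.
Qed.

Lemma alpha_aperiodic i j (s : seqN) : shiftN i s = alpha n -> shiftN j s = alpha n -> i = j.
Proof.
wlog ij : i j / (i < j)%N => [W hi hj|hi].
  have [h|h|//] := ltngtP i j; first exact: W.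
  by apply/esym; exact: W.
rewrite -(subnKC (ltnW ij)) -shiftN_shiftN hi => h; exfalso.
by apply: (alpha_not_hits R n_pos); exists (j - i)%N; rewrite ?subn_gt0.
Qed.

(** Each finite past agrees with that of t or of t-hat by [hits_alphaP]; the lengths match because
    alpha does not recur. The letter just before the point, 1 or 2, makes the choice the same for
    all lengths. *)
Lemma past_of_alpha x : Delta n x -> projN x = alpha n -> x = t_seq n \/ x = t_hat n.
Proof.
move=> Dx xa.
have sh (y : seqZ) i : projN y = alpha n -> shiftN i.+1 (projN (shiftZ (- (i.+1)%:Z) y)) = alpha n.
  by move=> ya; rewrite -projN_shiftZN.
have past i : (forall p, (p <= i)%N -> x (Negz p) = t_seq n (Negz p)) \/
              (forall p, (p <= i)%N -> x (Negz p) = t_hat n (Negz p)).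
  have Ds : DeltaP n (projN (shiftZ (- (i.+1)%:Z) x)).
    exact/(Delta_proj n_pos)/(Delta_shift n_pos).
  have hs : hits_alpha n (projN (shiftZ (- (i.+1)%:Z) x)) by exists i.+1 => //; exact: sh.
  have rd (y : seqZ) j : projN y = alpha n ->
      projN (shiftZ (- (i.+1)%:Z) x) = projN (shiftZ (- j%:Z) y) ->
      forall p, (p <= i)%N -> x (Negz p) = y (Negz p).
    move=> ya E p pi; have ij : i.+1 = j.
      apply: (@alpha_aperiodic _ _ (projN (shiftZ (- (i.+1)%:Z) x))); first exact: sh.
      by rewrite E -projN_shiftZN.
    have := congr1 (fun f : seqN => f (i - p)%N) E; rewrite /projN /shiftZ -ij.
    by have -> : (i - p)%N%:Z + - (i.+1)%:Z = Negz p by lia.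
  by case: (hits_alphaP R n_pos Ds hs) => -[j _ E]; [left|right]; exact: rd E.
have [x0|x0] : x (Negz 0) = L1 \/ x (Negz 0) = L2.
- case: (past 0%N) => /(_ 0%N isT) ->; [left|right]; first exact: beta0.
  exact: beta_hat0.
- left; apply/funext => -[i|i]; first by have := congr1 (fun f : seqN => f i) xa.
  case: (past i) => h; first exact: h.
  by have := h 0%N isT; rewrite x0 /t_hat /= beta_hat0.
- right; apply/funext => -[i|i]; first by have := congr1 (fun f : seqN => f i) xa.
  case: (past i) => h; last exact: h.
  by have := h 0%N isT; rewrite x0 /t_seq /= beta0.
Qed.

Lemma iter_T_0 j : iter j T (pt m1 m2 0) = Ups (shiftN j (alpha n)).
Proof. by rewrite UpsilonTP_iter ?UpsilonTP_alpha //; exact: DeltaP_alpha. Qed.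

Lemma Ups_semiconjugacy : topological_semiconjugacy (Delta n) (OmegaN R n)
  (shiftZ 1) T (UpsilonT R n).
Proof.
split.
- apply/seteqP; split => [_ [x Dx <-]|y /(Ups_surj n_pos)[s Ds <-]].
    by apply: (Ups_Omega R n_pos); exact: Delta_proj.
  have [G pG HG] := DeltaP_path n_pos Ds; have [x Dx xE] := path_Delta n_pos pG.
  by exists x => //; rewrite /UpsilonT xE HG.
- apply/subspace_continuousP => x Dx V.
  move=> /(Ups_nbhs (Delta_proj n_pos Dx))[K hK].
  rewrite /= nbhs_filterE /fmap /= /within /=.
  apply/nbhs_seqZ; exists K => x' xx' Dx'; apply: hK; first exact: Delta_proj.
  by move=> i iK; rewrite /projN xx' //; lia.
- move=> x Dx; rewrite /UpsilonT (projN_shiftZ 1) UpsilonTP_shift //.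
  exact: Delta_proj.
Qed.

Lemma fiber_orbit0 j : [set x : seqZ | Delta n x /\
    UpsilonT R n x = iter j T (pt m1 m2 0)]
  = [set shiftZ j%:Z (t_seq n); shiftZ j%:Z (t_hat n)].
Proof.
have Dj (j' : nat) : DeltaP n (shiftN j' (alpha n)) by exact/DeltaP_shiftN/DeltaP_alpha.
apply/seteqP; split => x /=; last first.
  rewrite iter_T_0 /UpsilonT => -[->|->]; split; rewrite ?projN_shiftZ //.
  - exact/(Delta_shift n_pos)/(Delta_t n_pos).
  - exact/(Delta_shift n_pos)/(Delta_t_hat n_pos).
rewrite iter_T_0 => -[Dx /(UpsilonTP_inj n_pos (Delta_proj n_pos Dx) (Dj j)) xj].
have Dt : Delta n (shiftZ j%:Z (t_seq n)) by exact/(Delta_shift n_pos)/(Delta_t n_pos).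
have [->|xt] := pselect (x = shiftZ j%:Z (t_seq n)); first by left.
have [|k [ka kt]] := same_future Dx Dt _ xt; first by rewrite xj projN_shiftZ.
(* Otherwise alpha would reach itself after |j - k| > 0 steps. *)
have jk : j = k.
  have a1 : shiftN k (projN (shiftZ (- k%:Z) (shiftZ j%:Z (t_seq n)))) = shiftN j (alpha n).
    by rewrite -projN_shiftZN projN_shiftZ.
  rewrite kt in a1.
  have [h|h|//] := ltngtP j k; exfalso.
  - apply: (alpha_not_hits R n_pos); rewrite -kt shiftZ_shiftZ.
    have -> : - k%:Z + j%:Z = - (k - j)%N%:Z by lia.
    by apply: hits_t; rewrite subn_gt0.
  - apply: (alpha_not_hits R n_pos); exists (j - k)%N; first by rewrite subn_gt0.
    move: kt; rewrite shiftZ_shiftZ; have -> : - k%:Z + j%:Z = (j - k)%N%:Z by lia.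
    by rewrite projN_shiftZ.
have Dk : Delta n (shiftZ (- k%:Z) x) by exact: Delta_shift.
have [h|h] := past_of_alpha Dk ka; [left|right];
  by rewrite -h jk shiftZ_shiftZ subrr; apply/funext => i; rewrite /shiftZ addr0.
Qed.

End Topology.

Theorem theorem1p1 (R : realType) (n : nat -> nat)
  (n_pos : forall k : nat, (0 < k)%N -> (0 < n k)%N) :
  (topological_conjugacy (DeltaP n) (OmegaN R n)
      (shiftN 1) (T_tildeN R n) (UpsilonTP R n)
   /\ (forall s s' : seqN, DeltaP n s -> DeltaP n s' ->
         lex_lt s s' -> UpsilonTP R n s' < UpsilonTP R n s)
   /\ (forall s : seqN, DeltaP n s -> is_itinerary (UpsilonTP R n s) s))
  /\
  (topological_semiconjugacy (Delta n) (OmegaN R n)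
      (shiftZ 1) (T_tildeN R n) (UpsilonT R n)
   /\ (forall j : nat,
         shiftZ j (t_seq n) <> shiftZ j (t_hat n) /\
         [set x : seqZ | Delta n x /\
            UpsilonT R n x
              = iter j (T_tildeN R n) (pt (mu1 R n) (mu2 R n) 0)]
         = [set shiftZ j (t_seq n); shiftZ j (t_hat n)])
   /\ (forall x x' : seqZ, Delta n x -> Delta n x' ->
         UpsilonT R n x = UpsilonT R n x' -> x <> x' ->
         exists j : nat,
           UpsilonT R n x
             = iter j (T_tildeN R n) (pt (mu1 R n) (mu2 R n) 0))).
Proof.
split; [split; [|split]|split; [|split]].
- split; first by split; [exact: Ups_bij|exact: Ups_continuous|exact: Ups_inverse].
  by move=> s Ds; exact: UpsilonTP_shift.
- by move=> s s' Ds Ds'; exact: UpsilonTP_lt.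
- by move=> s Ds; exact: UpsilonTP_itinerary.
- exact: Ups_semiconjugacy.
- move=> j; split; last exact: fiber_orbit0.
  (* This index is the place just before the original point, where t has the letter 1 and t-hat the
     letter 2. *)
  move=> /(congr1 (fun f : seqZ => f (- (j.+1)%:Z))); rewrite /shiftZ.
  have -> : - (j.+1)%:Z + j%:Z = Negz 0 by lia.
  by rewrite /t_seq /t_hat /= beta0 beta_hat0.
- move=> x x' Dx Dx' E xx'.
  have pE := UpsilonTP_inj n_pos (Delta_proj n_pos Dx) (Delta_proj n_pos Dx') E.
  have [j [ja _]] := same_future R n_pos Dx Dx' pE xx'.
  by exists j; rewrite iter_T_0 // /UpsilonT (projN_shiftZN j x) ja.
Qed.
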